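(* Let $\{u_k\}_{k\in\mathbb N}$ and $\{\mathcal T_k\}_{k\in\mathbb N}$ be produced by Adaptive Algorithm $C$ (described in the context), let $f_k=\bar f_k/\|K\bar f_k\|_{a,\Omega}$ and $w_k=Kf_k$, and let $\alpha$ be a fixed number with $\hat\alpha<\alpha<1$. When $H$ is sufficiently small, the following inequalities hold for all $k\in\mathbb N$: $$\|w_k-Ew_k\|_{a,\Omega}\le C_w\,\eta_a(V_H)\,\eta(f_k;\mathcal T_k),$$ $$\|(I-R_{k+1})w_{k+1}\|_{a,\Omega}^2+\gamma\,\eta^2(f_{k+1};\mathcal T_{k+1})\le\alpha^2\big(\|(I-R_k)w_k\|_{a,\Omega}^2+\gamma\,\eta^2(f_k;\mathcal T_k)\big).$$
   Context: PROBLEM. $\Omega\subset\mathbb R^d$ ($d\ge1$) is a bounded polytopic domain with Lipschitz boundary, $V=H_0^1(\Omega)$, $(\cdot,\cdot)$ is the $L^2(\Omega)$ inner product. $A=(a_{ij})_{d\times d}$ is a symmetric positive definite matrix with $a_{ij}\in W^{1,\infty}(\Omega)$, $0\le\varphi\in L^\infty(\Omega)$, $Lu=-\nabla\cdot(A\nabla u)+\varphi u$, $a(u,v)=\int_\Omega(A\nabla u\cdot\nabla v+\varphi uv)\,d\Omega$, $\|w\|_{a,\Omega}=\sqrt{a(w,w)}$, and $c_a,C_a>0$ satisfy $c_a\|w\|_{1,\Omega}\le\|w\|_{a,\Omega}\le C_a\|w\|_{1,\Omega}$ on $V$. Eigenvalue problem: $(\lambda,u)\in\mathbb R\times V$, $\|u\|_{a,\Omega}=1$,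 $a(u,v)=\lambda(u,v)$ for all $v\in V$; eigenvalues $0<\hat\lambda^1<\hat\lambda^2\le\cdots$, eigenfunctions $\hat u^i$ with $a(\hat u^i,\hat u^j)=\delta_{ij}$. $M(\hat\lambda^1)$ is the eigenspace of $\hat\lambda^1$ and $E:V\to M(\hat\lambda^1)$ is the $a$-orthogonal projection. $K:L^2(\Omega)\to V$ is defined by $a(Kw,v)=(w,v)$ for all $v\in V$ (so $L^{-1}f=Kf$). Only the first eigenpair is considered; it is assumed that $\hat u^1$ is not a piecewise polynomial. FINITE ELEMENTS AND ESTIMATOR. All meshes are conforming, nested and shape regular: $h_T/\rho_T\le\gamma^*$ for all elements $T$ ($h_T$ diameter, $\rho_T$ diameter of the largest inscribed ball). $V_k\subset V$ is the space of continuous piecewise polynomials of fixed degree $m\ge1$ on $\mathcal T_k$ vanishing on $\partial\Omega$; $R_k:V\to V_k$ is the Galerkin projection, $a(v-R_kv,v_k)=0$ for all $v_k\in V_k$. $\mathcal E_k$ is the set of interior faces. For $f\in L^2(\Omega)$, $v_k\in V_k$: $\mathcal R_T(f,v_k)=f+\nabla\cdot(A\nabla v_k)-\varphi v_k$ in $T$; $\mathcal J_E(v_k)=-A\nabla v_k^+\cdot\nu^+-A\nabla v_k^-\cdot\nu^-$ on $E\in\mathcal E_k$, $E$ being the common side of $T^\pm$ with outward normals $\nu^\pm$; $\eta_k^2(f,v_k;T)=h_T^2\|\mathcal R_T(f,v_k)\|_{0,T}^2+\sum_{E\in\mathcal E_k,E\subset\partial T}h_E\|\mathcal J_E(v_k)\|_{0,E}^2$;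 $\eta_k(f,v_k;\mathcal T')=(\sum_{T\in\mathcal T'}\eta_k^2(f,v_k;T))^{1/2}$ for $\mathcal T'\subset\mathcal T_k$; $\eta(f;\mathcal T_k):=\eta_k(f,R_kKf;\mathcal T_k)$. Oscillation: ${\rm osc}(g;\mathcal T_k)=(\sum_{T\in\mathcal T_k}\|h_T(g-P_Tg)\|_{0,T}^2)^{1/2}$, $P_T$ the $L^2(T)$-projection onto polynomials of some fixed degree (such that ${\rm osc}(f-Lv_k;\mathcal T_k)={\rm osc}(Lv_k;\mathcal T_k)$ for $f,v_k\in V_k$); $Lv_k$ is understood elementwise. ADAPTIVE ALGORITHM C. Modules: ESOLVE$(W)$ returns the first eigenpair $(\mu,w)\in\mathbb R\times W$ with $\|w\|_{a,\Omega}=1$, $a(w,v)=\mu(w,v)$ for all $v\in W$. LSOLVE$(f,W)$ returns $w\in W$ with $a(w,v)=(f,v)$ for all $v\in W$. MARK at level $k$ with parameter $\theta_1$ returns a minimal subset $\mathcal M_k\subset\mathcal T_k$ with $\eta_k(\bar f_k,\bar u_k;\mathcal M_k)\ge\theta_1\eta_k(\bar f_k,\bar u_k;\mathcal T_k)$. REFINE$(\mathcal M_k,\mathcal T_k)$ returns a conforming refinement $\mathcal T_{k+1}$ of $\mathcal T_k$ (by iterative or recursive bisection, with the minimal refinement condition) in which at least all elements of $\mathcal M_k$ are refined, together with $V_{k+1}$. Initialization: given $\theta_1,\theta_2\in(0,1)$ and a coarse mesh $\mathcal T_H$ of mesh size $H$ with finite element space $V_H$, refine $\mathcal T_H$ regularly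 to get $\mathcal T_1$ and $V_1$ (possibly $\mathcal T_1=\mathcal T_H$). $(\lambda_1,u_1)=$ESOLVE$(V_1)$; set $\bar f_2^{(0)}=\bar f_1=\tilde u_1=u_1$, $\bar u_1=u_1/\lambda_1$, $n_1=1$, $k=2$, $\ell=1$, $j=0$, and the number $\eta_1=\eta_1(\bar f_1,\bar u_1;\mathcal T_1)$. Iterate: (1) MARK on $\mathcal T_{k-1}$ gives $\mathcal M_{k-1}$. (2) $(\mathcal T_k,V_k)=$REFINE$(\mathcal M_{k-1},\mathcal T_{k-1})$. (3) $\bar u_k^{(j)}=$LSOLVE$(\bar f_k^{(j)},V_k)$, $u_k^{(j)}=\bar u_k^{(j)}/\|\bar u_k^{(j)}\|_{a,\Omega}$, $\lambda_k^{(j)}=a(u_k^{(j)},u_k^{(j)})/(u_k^{(j)},u_k^{(j)})$. (4) Compute $\eta_k(\bar f_k^{(j)},\bar u_k^{(j)};T)$, $T\in\mathcal T_k$. (5) If $\eta_k(\bar f_k^{(j)},\bar u_k^{(j)};\mathcal T_k)\le\theta_2^{j+1}\eta_\ell$, then $(\tilde\lambda_k^{(j)},\tilde u_k^{(j)})=$ESOLVE$(V_H+{\rm span}\{u_k^{(j)}\})$, set $\bar f_k^{(j+1)}=\tilde u_k^{(j)}$, $j:=j+1$, go to (3); else set $\bar f_k=\bar f_k^{(j)}$, $\bar u_k=\bar u_k^{(j)}$, $u_k=u_k^{(j)}$, $\lambda_k=\lambda_k^{(j)}$. (6) If $j>0$, then $(\tilde\lambda_k,\tilde u_k)=$ESOLVE$(V_H+{\rm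 span}\{u_k\})$, $\bar f_{k+1}^{(0)}=\tilde u_k$, $\eta_{\ell+1}=\eta_k(\bar f_k^{(j)},\bar u_k^{(j)};\mathcal T_k)$, $n_{\ell+1}=k$, $\ell:=\ell+1$, $j:=0$; else $\bar f_{k+1}^{(0)}=u_k$. (7) $k:=k+1$, go to (1). Standing assumption: $\theta_1\in(0,\theta_* )$, where $\theta_*$ is the constant of Cascon–Kreuzer–Nochetto–Siebert with the property: if $f\in L^2(\Omega)$, $\mathcal T_{k,*}$ is a refinement of $\mathcal T_k$ (Galerkin projection $R_{k,*}$) and $\|(I-R_{k,*})Kf\|_{a,\Omega}^2+{\rm osc}^2(f-LR_{k,*}Kf;\mathcal T_{k,*})\le\tilde\xi_0^2(\|(I-R_k)Kf\|_{a,\Omega}^2+{\rm osc}^2(f-LR_kKf;\mathcal T_k))$ with $\tilde\xi_0^2\in(0,\frac12)$, then $\eta_k^2(f,R_kKf;\mathcal T_k\setminus(\mathcal T_{k,*}\cap\mathcal T_k))\ge\theta_*^2(1-2\tilde\xi_0^2)\,\eta_k^2(f,R_kKf;\mathcal T_k)$. QUANTITIES AND CONSTANTS. For a finite dimensional $W\subset V$: $\eta_a(W)=\sup_{f\in L^2(\Omega),\|f\|_{0,\Omega}=1}\inf_{v\in W}\|L^{-1}f-v\|_{a,\Omega}$, $\delta_W(\hat\lambda^1)=\sup_{v\in M(\hat\lambda^1),\|v\|_{a,\Omega}=1}\inf_{w\in W}\|v-w\|_{a,\Omega}$; both tend to $0$ for $W=V_H$ as $H\to0$. The following are known mesh-independent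 constants with the stated properties. - $C_{ea},C_{e0}$: for $W=V_1$ or $W=V_H+{\rm span}\{u\}$ with $u=u_{n_\ell}^{(j)}$ or $u=u_{n_\ell}$ ($\ell\ge2$), and $w$ the function returned by ESOLVE$(W)$, $\|w-Ew\|_{a,\Omega}\le C_{ea}\delta_W(\hat\lambda^1)$ (hence, for the second type of $W$, $\le C_{ea}\min\{\delta_{V_H}(\hat\lambda^1),\|\hat u^1-u\|_{a,\Omega}\}$) and $\|w-Ew\|_{0,\Omega}\le C_{e0}\eta_a(W)\|w-Ew\|_{a,\Omega}$ (with $\eta_a(W)\le\eta_a(V_H)$). - $C_{an}$: $\|(I-R_k)v\|_{0,\Omega}\le C_{an}\eta_a(V_k)\|(I-R_k)v\|_{a,\Omega}$ for $v\in V$. - $C_{\rm up},C_{\rm low}$: for $f\in L^2(\Omega)$, $\|(I-R_k)Kf\|_{a,\Omega}\le C_{\rm up}\eta(f;\mathcal T_k)$ and $C_{\rm low}\eta(f;\mathcal T_k)\le\|(I-R_k)Kf\|_{a,\Omega}+{\rm osc}(f-LR_kKf;\mathcal T_k)$. - $C_{oa}$: ${\rm osc}(Lv_k;\mathcal T_k)\le C_{oa}\|v_k\|_{a,\Omega}$ for $v_k\in V_k$. - $\gamma>0$, $\hat\alpha\in(0,1)$ (depending on $\gamma^*,A,\varphi,\theta_1$): for all $k$, $\|(I-R_{k+1})K\bar f_k\|_{a,\Omega}^2+\gamma\eta^2(\bar f_k;\mathcal T_{k+1})\le\hat\alpha^2(\|(I-R_k)K\bar f_k\|_{a,\Omega}^2+\gamma\eta^2(\bar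 f_k;\mathcal T_k))$. Derived constants: $C_{wu}=\frac{4C_{e0}C_{ea}\hat\lambda^1}{c_a}$, $C_{ww}=\frac{2C_{an}\hat\lambda^1}{c_a}$, $C_{w,1}=\frac{4\hat\lambda^1C_{e0}C_{\rm up}}{c_a}$, $C_{w,2}=\max\{\frac{C_{w,1}}{\theta_2},\frac{8C_{wu}\hat\lambda^1C_{\rm up}}{\theta_2c_a^2}\}$, $\bar C_w^{(0)}=\frac{C_{ww}\alpha(C_{\rm up}^2+\gamma)^{1/2}}{1-\alpha}+2C_{wu}C_{\rm up}$, $\bar C_w=\frac{2\bar C_w^{(0)}\hat\lambda^1}{\theta_2c_a^2}$, $C_w=\max\{C_{w,1},C_{w,2},\bar C_w\}$. ''$H$ sufficiently small'' means: there is $H_0>0$ such that the assertion holds whenever $0<H\le H_0$. *)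

(* Defs.v *)
From HB Require Import structures.
From mathcomp Require Import all_boot all_order all_algebra.
From mathcomp Require mpoly.
From mathcomp Require Import all_classical all_reals all_analysis.
Import Order.TTheory GRing.Theory Num.Theory.
Import numFieldNormedType.Exports.
Import (canonicals, coercions) mpoly.
Set Implicit Arguments. Unset Strict Implicit. Unset Printing Implicit Defensive.
Local Open Scope classical_set_scope.
Local Open Scope ring_scope.

Section rV_measurable.
Variables (R : realType) (n : nat).
Let coors : 'I_n -> 'rV[R]_n -> measurableTypeR R := fun i x => x 0 i.
Let rV_set0 : g_sigma_preimage coors set0.
Proof. exact: sigma_algebra0. Qed.
Let rV_setC A : g_sigma_preimage coors A -> g_sigma_preimage coors (~` A).
Proof. exact: sigma_algebraC. Qed.
Let rV_bigcup (F : (set 'rV[R]_n)^nat) : (forall i, g_sigma_preimage coors (F i)) ->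
  g_sigma_preimage coors (\bigcup_i (F i)).
Proof. exact: sigma_algebra_bigcup. Qed.
HB.instance Definition _ := @isMeasurable.Build
  (measure_tuple_display default_measure_display)
  'rV[R]_n (g_sigma_preimage coors) rV_set0 rV_setC rV_bigcup.

Lemma measurable_coor (i : 'I_n) :
  measurable_fun [set: 'rV[R]_n] (fun x : 'rV[R]_n => x 0 i : measurableTypeR R).
Proof.
move=> _ Y mY; rewrite setTI; apply: sub_sigma_algebra => /=.
rewrite -bigcup_seq/=; exists i => /=; first by rewrite mem_index_enum.
by exists Y => //; rewrite setTI.
Qed.

Lemma measurable_fun_rV d (T : measurableType d) (f : T -> 'rV[R]_n) :
  (forall i, measurable_fun setT (fun x => f x 0 i : measurableTypeR R)) ->
  measurable_fun setT f.
Proof.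
move=> mf; have: g_sigma_preimage (fun i x => coors i (f x)) `<=` measurable.
  apply: smallest_sub; first exact: sigma_algebra_measurable.
  move=> A; rewrite -bigcup_seq/= => -[i _ [B mB <-]]; exact: mf.
rewrite (_ : (fun i x => _) = (fun i => coors i \o f)) // g_sigma_preimage_comp.
by move=> sub _ A mA; apply: sub; exists A.
Qed.
End rV_measurable.

Section lebesgue_rV.
Variable R : realType.

Definition rV_cons n (p : measurableTypeR R * 'rV[R]_n) : 'rV[R]_n.+1 :=
  row_mx (const_mx p.1 : 'rV_1) p.2.

Lemma rV_cons0 n p : @rV_cons n p 0 ord0 = p.1.
Proof. by rewrite mxE; case: splitP => // j _; rewrite mxE. Qed.

Lemma rV_consS n p i : @rV_cons n p 0 (lift ord0 i) = p.2 0 i.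
Proof.
rewrite mxE; case: splitP => [j|k] /=; first by rewrite ord1.
by move=> /eqP; rewrite eqn_add2l => /eqP/val_inj ->.
Qed.

Lemma measurable_rV_cons n : measurable_fun setT (@rV_cons n).
Proof.
apply: measurable_fun_rV => i; case: (unliftP ord0 i) => [j|] ->.
  under eq_fun do rewrite rV_consS.
  exact: (measurableT_comp (measurable_coor j)).
under eq_fun do rewrite rV_cons0.
exact: measurable_fst.
Qed.

Section step.
Variables (n : nat) (mu : {sigma_finite_measure set 'rV[R]_n -> \bar R}).

Definition lebesgue_step : set 'rV[R]_n.+1 -> \bar R :=
  pushforward (@lebesgue_measure R \x mu)%E (@rV_cons n).


HB.instance Definition _ := Measure.copy lebesgue_step
  (measure_function_pushforward__canonical__measure_function_Measure
    (@lebesgue_measure R \x mu)%E (@measurable_rV_cons n)).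

Let lebesgue_step_sigma_finite : sigma_finite setT lebesgue_step.
Proof.
have /sigma_finiteP[F [TF ndF Foo]] := sigma_finiteT (@lebesgue_measure R).
have /sigma_finiteP[G [TG ndG Goo]] := sigma_finiteT mu.
pose g (x : 'rV[R]_n.+1) : measurableTypeR R * 'rV[R]_n :=
  (x 0 ord0, \row_i x 0 (lift ord0 i)).
have gK : cancel (@rV_cons n) g.
  move=> p; rewrite [p]surjective_pairing /g rV_cons0; congr pair.
  by apply/rowP => i; rewrite mxE rV_consS.
have mg : measurable_fun setT g.
  apply/measurable_fun_pairP; split; first exact: measurable_coor.
  by apply: measurable_fun_rV => i; under eq_fun do rewrite /= mxE; exact: measurable_coor.
exists (fun k => g @^-1` (F k `*` G k)).
  rewrite -preimage_bigcup (_ : \bigcup_k _ = setT) ?preimage_setT//.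
  apply/seteqP; split=> // -[x y] _.
  have [k _ Fkx] : (\bigcup_k F k) x by rewrite -TF.
  have [l _ Gly] : (\bigcup_k G k) y by rewrite -TG.
  exists (maxn k l) => //; split.
    by move: x Fkx; exact/subsetPset/ndF/leq_maxl.
  by move: y Gly; exact/subsetPset/ndG/leq_maxr.
move=> k; have [mFk Fk] := Foo k; have [mGk Gk] := Goo k; split.
  by rewrite -[X in measurable X]setTI; apply: mg => //; exact: measurableX.
rewrite /lebesgue_step /pushforward -comp_preimage (_ : g \o _ = id); last first.
  exact/funext/gK.
by rewrite product_measure1E// lte_mul_pinfty// ge0_fin_numE.
Qed.

HB.instance Definition _ := Measure_isSigmaFinite.Build _ _ _ lebesgue_step
  lebesgue_step_sigma_finite.
End step.

Fixpoint lebesgue_rV n : {sigma_finite_measure set 'rV[R]_n -> \bar R} :=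
  if n is n'.+1 then lebesgue_step (lebesgue_rV n')
  else \d_ (0 : 'rV[R]_0).

Lemma lebesgue_rV_box n (a b : 'I_n -> R) : (forall i, a i <= b i) ->
  lebesgue_rV n [set x | forall i, a i <= x 0 i <= b i] =
  (\prod_(i < n) (b i - a i))%:E.
Proof.
elim: n a b => [|n IHn] a b ab.
  rewrite big_ord0 /= diracE mem_set // => -[].
  by [].
rewrite /= /lebesgue_step /pushforward big_ord_recl EFinM.
rewrite -(IHn _ _ (fun i => ab (lift ord0 i))) .
set B := (X in lebesgue_rV n X).
rewrite (_ : _ @^-1` _ = `[a ord0, b ord0]%classic `*` B).
  have mB : measurable B.
    have -> : B = \bigcap_(i in [set: 'I_n])
        [set x : 'rV[R]_n | `[a (lift ord0 i), b (lift ord0 i)]%classic (x 0 i)].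
      apply/seteqP; split=> x /=.
        by move=> xB i _; rewrite /= in_itv/=; exact: xB.
      by move=> xB i; have := xB i I; rewrite /= in_itv.
    apply: fin_bigcap_measurable => [|i _]; first exact: finite_finset.
    by rewrite -[X in measurable X]setTI; exact: measurable_coor.
  rewrite product_measure1E //= lebesgue_measure_itv /= lte_fin.
  have := ab ord0; rewrite le_eqVlt => /orP[/eqP->|->//].
  by rewrite ltxx subrr.
apply/seteqP; split=> -[x y] /=.
  move=> xyB; split=> [|i]; rewrite ?in_itv/=.
    by have := xyB ord0; rewrite rV_cons0.
  by have := xyB (lift ord0 i); rewrite rV_consS.
rewrite in_itv /= => -[xab yB] i.
case: (unliftP ord0 i) => [j|] ->; rewrite ?rV_consS ?rV_cons0//; exact: yB.
Qed.
End lebesgue_rV.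

Section geometry.
Variable R : realType.

Definition dot k (x y : 'rV[R]_k) : R := \sum_i x 0 i * y 0 i.

(* Euclidean norm; the library norm on 'rV[R]_k is the sup norm. *)
Definition enorm k (x : 'rV[R]_k) : R := Num.sqrt (dot x x).

Definition diam k (S : set 'rV[R]_k) : R :=
  sup [set r | exists x y, [/\ S x, S y & r = enorm (x - y)]].

Definition inball_diam k (S : set 'rV[R]_k) : R :=
  sup [set r | 0 <= r /\
    exists c, forall y, enorm (y - c) <= r / 2 -> S y].

Definition chull k (S : set 'rV[R]_k) : set 'rV[R]_k :=
  [set x | exists (p : nat) (z : 'I_p -> 'rV[R]_k) (l : 'I_p -> R),
    [/\ forall i, S (z i), forall i, 0 <= l i, \sum_i l i = 1
      & x = \sum_i l i *: z i]].

Definition peval k (p : mpoly.mpoly k R) (x : 'rV[R]_k) : R :=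
  mpoly.meval (fun i => x 0 i) p.

Definition pgrad k (p : mpoly.mpoly k R) (x : 'rV[R]_k) : 'rV[R]_k :=
  \row_i peval (mpoly.mderiv i p) x.

Variable n : nat.
(* The space dimension is d = n.+1 >= 1. *)
Local Notation pt := 'rV[R]_n.+1.

Definition simplex := {ffun 'I_n.+2 -> pt}.

(* The natural number is a tag at the disposal of the bisection rule, e.g. the
   type of a simplex in Maubach's rule; the order of the vertices also matters
   only for that rule. *)
Definition element := (simplex * nat)%type.
Definition mesh := seq element.

Definition vertices (T : element) : set pt := range T.1.
Definition carrier (T : element) : set pt := chull (vertices T).

Definition nondegenerate (T : element) : Prop :=
  forall l : 'I_n.+2 -> R, \sum_i l i = 0 -> \sum_i l i *: T.1 i = 0 ->
    forall i, l i = 0.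

Definition meshsize (M : mesh) : R :=
  \big[Num.max/0]_(T <- M) diam (carrier T).

Definition bdry (D : set pt) : set pt := closure D `\` D.

Definition lipschitz_boundary (D : set pt) : Prop :=
  forall x, bdry D x -> exists (r : R) (Q : 'M[R]_n.+1) (g : 'rV[R]_n -> R)
    (L : R), [/\ 0 < r, Q *m Q^T = 1%:M,
      forall s t, `|g s - g t| <= L * enorm (s - t)
    & forall y, enorm (y - x) < r ->
        (D y <-> g (col' ord0 (y *m Q)) < (y *m Q) 0 ord0)].

Definition polytopic (D : set pt) : Prop :=
  exists M : mesh, (forall T, T \in M -> nondegenerate T) /\
    closure D = \bigcup_(T in [set` M]) carrier T.

Definition lipschitz_polytope (D : set pt) : Prop :=
  [/\ open D, connected D, D !=set0, bounded_set D
    & polytopic D /\ lipschitz_boundary D].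

Definition triangulation (D : set pt) (M : mesh) : Prop :=
  [/\ uniq M /\ (forall T, T \in M -> nondegenerate T),
      closure D = \bigcup_(T in [set` M]) carrier T,
      forall T T', T \in M -> T' \in M -> vertices T = vertices T' -> T = T'
    & forall T T', T \in M -> T' \in M ->
        carrier T `&` carrier T' = chull (vertices T `&` vertices T')].

Definition shape_regular (g : R) (M : mesh) : Prop :=
  forall T, T \in M -> diam (carrier T) <= g * inball_diam (carrier T).

Definition admissible (D : set pt) (g : R) (M : mesh) : Prop :=
  triangulation D M /\ shape_regular g M.

Definition nested (M M' : mesh) : Prop :=
  forall T', T' \in M' -> exists2 T, T \in M & carrier T' `<=` carrier T.

(* A bisection rule cuts every simplex through the midpoint of one of its edges;
   the choice of the edge and the numbering and tags of the children are left to
   the rule (newest vertex, longest edge, Maubach, ...). *)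
Definition bisection_rule (bis : element -> element * element) : Prop :=
  forall T, nondegenerate T -> exists i j, let z := 2^-1 *: (T.1 i + T.1 j) in
    [/\ i != j, vertices (bis T).1 = z |` (vertices T `\ T.1 i)
      & vertices (bis T).2 = z |` (vertices T `\ T.1 j)].

Inductive refinement (bis : element -> element * element) (M : mesh) :
    mesh -> Prop :=
| refinement_refl M' : perm_eq M M' -> refinement bis M M'
| refinement_step M' M'' T : refinement bis M M' -> T \in M' ->
    perm_eq M'' [:: (bis T).1, (bis T).2 & rem T M'] -> refinement bis M M''.

Definition refines_marked (D : set pt) bis (S M M' : mesh) : Prop :=
  [/\ refinement bis M M', triangulation D M'
    & forall T, T \in S -> T \notin M'].

Definition refine_output (D : set pt) bis (S M M' : mesh) : Prop :=
  refines_marked D bis S M M' /\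
  (forall M'', refines_marked D bis S M M'' -> refinement bis M'' M' ->
    perm_eq M'' M').

(* The side of T opposite to its vertex i is also the side of T' opposite to
   its vertex i'. *)
Definition common_side (T : element) (i : 'I_n.+2) (T' : element)
    (i' : 'I_n.+2) : bool :=
  (T' != T) && [forall j, (j != i) ==>
    [exists j', (j' != i') && (T.1 j == T'.1 j')]].

Definition side (T : element) (i : 'I_n.+2) : set pt :=
  chull [set T.1 j | j in [set j | j != i]].

Definition outer_normal (T : element) (i : 'I_n.+2) : pt :=
  xget 0 [set nu | [/\ enorm nu = 1,
    forall j k, j != i -> k != i -> dot nu (T.1 j - T.1 k) = 0
    & forall j, j != i -> dot nu (T.1 i - T.1 j) < 0]].

(* Surface integral over the side of T opposite to the vertex i, through the
   affine parametrization by the reference simplex of dimension d - 1 = n. For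
   d = 1 the side is a point and the integral is the value at that point. *)
Definition side_int (T : element) (i : 'I_n.+2) (g : pt -> R) : R :=
  let y (s : 'I_n.+1) := T.1 (lift i s) in
  let B : 'M[R]_(n, n.+1) := \matrix_(k < n) (y (lift ord0 k) - y ord0) in
  Num.sqrt (\det (B *m B^T)) *
  \int[lebesgue_rV R n]_(s in [set s : 'rV[R]_n |
      (forall k, 0 <= s 0 k) /\ \sum_k s 0 k <= 1]) g (y ord0 + s *m B).

(* A point has diameter 0: for d = 1 the size of a side is taken to be the
   larger of the sizes of the two adjacent elements. *)
Definition side_size (T : element) (i : 'I_n.+2) (T' : element) : R :=
  if n == 0%N then Num.max (diam (carrier T)) (diam (carrier T'))
  else diam (side T i).

End geometry.

Section sobolev.
Variables (R : realType) (n : nat).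
Local Notation pt := 'rV[R]_n.+1.
Local Notation mu := (lebesgue_rV R n.+1).
Variable D : set pt.

Definition inL2 (S : set pt) (f : pt -> R) : Prop :=
  measurable_fun S f /\ mu.-integrable S (fun x => (f x ^+ 2)%:E).

Definition inLinf (f : pt -> R) : Prop :=
  measurable_fun D f /\
  exists C : R, {ae mu, forall x, D x -> `|f x| <= C}.

Definition ip0 (S : set pt) (f g : pt -> R) : R :=
  \int[mu]_(x in S) (f x * g x).
Definition norm0 (S : set pt) (f : pt -> R) : R := Num.sqrt (ip0 S f f).

Definition grad (f : pt -> R) (x : pt) : pt := \row_i 'D_(delta_mx 0 i) f x.

Fixpoint Ck (k : nat) (f : pt -> R) : Prop :=
  continuous f /\
  if k is k'.+1 then
    forall i : 'I_n.+1, (forall x, derivable f x (delta_mx 0 i)) /\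
      Ck k' (fun x => grad f x 0 i)
  else True.

Definition test_function (f : pt -> R) : Prop :=
  (forall k, Ck k f) /\
  exists S : set pt, [/\ compact S, S `<=` D & forall x, ~ S x -> f x = 0].

Definition weak_gradient (u : pt -> R) (g : pt -> pt) : Prop :=
  forall f, test_function f -> forall i,
    \int[mu]_(x in D) (u x * grad f x 0 i) =
    - \int[mu]_(x in D) (g x 0 i * f x).

(* An element of H^1(D) is represented by a function and its weak gradient,
   both given by representatives of their classes modulo null sets. *)
Definition sob := ((pt -> R) * (pt -> pt))%type.

Definition inH1 (u : sob) : Prop :=
  [/\ inL2 D u.1, forall i, inL2 D (fun x => u.2 x 0 i)
    & weak_gradient u.1 u.2].

Definition norm1 (u : sob) : R :=
  Num.sqrt (norm0 D u.1 ^+ 2 + \sum_i norm0 D (fun x => u.2 x 0 i) ^+ 2).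

Definition H10 : set sob :=
  [set u | inH1 u /\ forall e : R, 0 < e ->
    exists2 f, test_function f & norm1 (u - (f, grad f)) < e].

End sobolev.

Record problem (R : realType) (n : nat) := Problem {
  dom : set 'rV[R]_n.+1;
  coefA : 'rV[R]_n.+1 -> 'M[R]_n.+1;
  (* dcoefA k x i j is the weak derivative of a_ij in direction k at x *)
  dcoefA : 'I_n.+1 -> 'rV[R]_n.+1 -> 'M[R]_n.+1;
  coefphi : 'rV[R]_n.+1 -> R }.

Section fem.
Variables (R : realType) (n : nat) (pb : problem R n).
Local Notation pt := 'rV[R]_n.+1.
Local Notation mesh := (mesh R n).
Local Notation element := (element R n).
Local Notation sob := (sob R n).
Local Notation mu := (lebesgue_rV R n.+1).
Local Notation D := (dom pb).
Local Notation A := (coefA pb).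
Local Notation dA := (dcoefA pb).
Local Notation phi := (coefphi pb).
Local Notation V := (H10 D).

(* The last clause fixes the continuous representative of the coefficients
   a_ij in W^{1,oo}, which is the one restricted to element sides. *)
Definition valid_problem : Prop :=
  [/\ lipschitz_polytope D,
      forall x, D x -> (A x)^T = A x /\
        forall y : pt, y != 0 -> 0 < dot (y *m A x) y,
      forall i j, [/\ inLinf D (fun x => A x i j),
        forall k, inLinf D (fun x => dA k x i j)
        & weak_gradient D (fun x => A x i j) (fun x => \row_k dA k x i j)],
      inLinf D phi /\ {ae mu, forall x, D x -> 0 <= phi x}
    & forall i j, {within closure D, continuous (fun x => A x i j)}].

(* A g, for a gradient g written as a row vector. *)
Definition flux (x g : pt) : pt := g *m (A x)^T.

Definition form_a (u v : sob) : R :=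
  \int[mu]_(x in D) (dot (flux x (u.2 x)) (v.2 x) + phi x * u.1 x * v.1 x).
Definition norm_a (u : sob) : R := Num.sqrt (form_a u u).

Definition fe_space (m : nat) (M : mesh) : set sob :=
  [set v | [/\ V v, {within closure D, continuous v.1},
    forall x, bdry D x -> v.1 x = 0
    & forall T, T \in M -> exists2 p : mpoly.mpoly n.+1 R,
        (mpoly.msize p <= m.+1)%N & forall x, carrier T x -> v.1 x = peval p x]].

Definition piece (T : element) (v : pt -> R) : mpoly.mpoly n.+1 R :=
  xget 0 [set p | forall x, carrier T x -> v x = peval p x].

(* div (A grad v) in T, expanded by the product rule. *)
Definition div_flux (T : element) (v : sob) (x : pt) : R :=
  \sum_i \sum_j
    (dA i x i j * peval (mpoly.mderiv j (piece T v.1)) x +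
     A x i j * peval (mpoly.mderiv i (mpoly.mderiv j (piece T v.1))) x).

Definition elemL (T : element) (v : sob) (x : pt) : R :=
  - div_flux T v x + phi x * v.1 x.

Definition residual (f : pt -> R) (v : sob) (T : element) (x : pt) : R :=
  f x + div_flux T v x - phi x * v.1 x.

Definition jump (v : sob) (T : element) i (T' : element) i' (x : pt) : R :=
  - dot (flux x (pgrad (piece T v.1) x)) (outer_normal T i)
  - dot (flux x (pgrad (piece T' v.1) x)) (outer_normal T' i').

(* Integrals over T are taken over the part of T in D, which differs from T by
   a null set: the coefficients are meaningful in D only. *)
Definition cell (T : element) : set pt := carrier T `&` D.

Definition eta2 (M : mesh) (f : pt -> R) (v : sob) (T : element) : R :=
  diam (carrier T) ^+ 2 * norm0 (cell T) (residual f v T) ^+ 2 +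
  \sum_i \sum_(T' <- M) \sum_(i' | common_side T i T' i')
    side_size T i T' * side_int T i (fun x => jump v T i T' i' x ^+ 2).

Definition eta_on (M S : mesh) (f : pt -> R) (v : sob) : R :=
  Num.sqrt (\sum_(T <- S) eta2 M f v T).

Definition l2_projection (q : nat)
    (P : element -> (pt -> R) -> pt -> R) : Prop :=
  forall T g, inL2 (cell T) g ->
    (exists2 p : mpoly.mpoly n.+1 R,
      (mpoly.msize p <= q.+1)%N & P T g = peval p) /\
    (forall r : mpoly.mpoly n.+1 R, (mpoly.msize r <= q.+1)%N ->
      ip0 (cell T) (fun x => g x - P T g x) (peval r) = 0).

(* The argument g is given elementwise. *)
Definition osc (P : element -> (pt -> R) -> pt -> R) (M : mesh)
    (g : element -> pt -> R) : R :=
  Num.sqrt (\sum_(T <- M)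
    norm0 (cell T) (fun x => diam (carrier T) * (g T x - P T (g T) x)) ^+ 2).

Definition galerkin (W : set sob) (Rk : sob -> sob) : Prop :=
  forall v, V v -> W (Rk v) /\ forall w, W w -> form_a (v - Rk v) w = 0.

Definition solution_operator (K : (pt -> R) -> sob) : Prop :=
  forall f, inL2 D f -> V (K f) /\
    forall v, V v -> form_a (K f) v = ip0 D f v.1.

Definition eigenspace_of (l : R) : set sob :=
  [set u | V u /\ forall v, V v -> form_a u v = l * ip0 D u.1 v.1].

Definition a_projection (W : set sob) (E : sob -> sob) : Prop :=
  forall v, V v -> W (E v) /\ forall w, W w -> form_a (v - E v) w = 0.

(* The sequences are numbered from 0. The last clause says that they list all
   eigenpairs, with multiplicity: the eigenfunctions span a dense subspace. *)
Definition eigen_system (lam : nat -> R) (uh : nat -> sob) : Prop :=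
  [/\ forall i, eigenspace_of (lam i) (uh i),
      forall i j, form_a (uh i) (uh j) = (i == j)%:R,
      0 < lam 0%N /\ lam 0%N < lam 1%N,
      forall i, lam i <= lam i.+1
    & forall v, V v -> forall e : R, 0 < e -> exists (N : nat) (c : nat -> R),
        norm_a (v - \sum_(i < N) c i *: uh i) < e].

Definition piecewise_polynomial (u : sob) : Prop :=
  exists2 M : mesh, triangulation D M & forall T, T \in M ->
    exists p : mpoly.mpoly n.+1 R,
      {ae mu, forall x, cell T x -> u.1 x = peval p x}.

Definition dist_a (v : sob) (W : set sob) : R :=
  inf [set norm_a (v - w) | w in W].

Definition eta_a (K : (pt -> R) -> sob) (W : set sob) : R :=
  sup [set dist_a (K f) W | f in [set f | inL2 D f /\ norm0 D f = 1]].

Definition delta_a (l : R) (W : set sob) : R :=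
  sup [set dist_a v W | v in [set v | eigenspace_of l v /\ norm_a v = 1]].

Definition discrete_eigenpair (W : set sob) (l : R) (w : sob) : Prop :=
  [/\ W w, norm_a w = 1 & forall v, W v -> form_a w v = l * ip0 D w.1 v.1].

Definition ESOLVE (W : set sob) (l : R) (w : sob) : Prop :=
  discrete_eigenpair W l w /\
  forall l' w', discrete_eigenpair W l' w' -> l <= l'.

Definition LSOLVE (f : pt -> R) (W : set sob) (w : sob) : Prop :=
  W w /\ forall v, W v -> form_a w v = ip0 D f v.1.

Definition add_span (W : set sob) (u : sob) : set sob :=
  [set v | exists2 w, W w & exists c : R, v = w + c *: u].

(* Minimality is with respect to inclusion. *)
Definition MARK (theta : R) (M : mesh) (f : pt -> R) (v : sob) (S : mesh) :
    Prop :=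
  let marks S' := theta * eta_on M M f v <= eta_on M S' f v in
  [/\ uniq S, {subset S <= M}, marks S
    & forall S', uniq S' -> {subset S' <= S} -> marks S' -> perm_eq S' S].

(* The data produced by the algorithm. At level k the loop over j stops at
   [jlast k]; [lev k] is the value of the counter l while level k is processed;
   [ll k j], [etal l], [nlev l] are lambda_k^(j), eta_l, n_l. Levels are numbered
   from 1, and level 1 only has the index j = 0. *)
Record run := Run {
  msh : nat -> mesh;
  marked : nat -> mesh;
  jlast : nat -> nat;
  fbar : nat -> nat -> sob;
  ubar : nat -> nat -> sob;
  uu : nat -> nat -> sob;
  ll : nat -> nat -> R;
  lev : nat -> nat;
  etal : nat -> R;
  nlev : nat -> nat }.

Definition fbar_last (r : run) k := fbar r k (jlast r k).
Definition ubar_last (r : run) k := ubar r k (jlast r k).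
Definition u_last (r : run) k := uu r k (jlast r k).
Definition eta_run (r : run) k j : R :=
  eta_on (msh r k) (msh r k) (fbar r k j).1 (ubar r k j).

Definition algorithmC_init (m : nat) (MH : mesh) (r : run) : Prop :=
  [/\ nested MH (msh r 1),
      ESOLVE (fe_space m (msh r 1)) (ll r 1 0) (uu r 1 0),
      [/\ fbar r 1 0 = uu r 1 0, ubar r 1 0 = (ll r 1 0)^-1 *: uu r 1 0
        & jlast r 1 = 0%N],
      fbar r 2 0 = uu r 1 0
    & [/\ lev r 2 = 1%N, nlev r 1 = 1%N & etal r 1 = eta_run r 1 0]].

Definition algorithmC_step (m : nat) bis (theta1 theta2 : R) (MH : mesh)
    (r : run) (k : nat) : Prop :=
  let VH := fe_space m MH in
  let l := lev r k in
  [/\ MARK theta1 (msh r k.-1) (fbar_last r k.-1).1 (ubar_last r k.-1)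
        (marked r k.-1),
      refine_output D bis (marked r k.-1) (msh r k.-1) (msh r k),
      forall j, (j <= jlast r k)%N ->
        [/\ LSOLVE (fbar r k j).1 (fe_space m (msh r k)) (ubar r k j),
            uu r k j = (norm_a (ubar r k j))^-1 *: ubar r k j
          & ll r k j = form_a (uu r k j) (uu r k j) /
                       ip0 D (uu r k j).1 (uu r k j).1],
      (forall j, (j < jlast r k)%N ->
         eta_run r k j <= theta2 ^+ j.+1 * etal r l /\
         exists lt, ESOLVE (add_span VH (uu r k j)) lt (fbar r k j.+1)) /\
      ~~ (eta_run r k (jlast r k) <= theta2 ^+ (jlast r k).+1 * etal r l)
    & if (0 < jlast r k)%N then
        (exists lt, ESOLVE (add_span VH (u_last r k)) lt (fbar r k.+1 0)) /\
        [/\ etal r l.+1 = eta_run r k (jlast r k), nlev r l.+1 = k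
          & lev r k.+1 = l.+1]
      else fbar r k.+1 0 = u_last r k /\ lev r k.+1 = l].

Definition algorithmC (m : nat) (gstar : R) bis (theta1 theta2 : R)
    (MH : mesh) (r : run) : Prop :=
  [/\ admissible D gstar MH,
      forall k, (1 <= k)%N -> admissible D gstar (msh r k) /\
        nested (msh r k) (msh r k.+1),
      algorithmC_init m MH r
    & forall k, (2 <= k)%N -> algorithmC_step m bis theta1 theta2 MH r k].

Section operators.
Variables (K : (pt -> R) -> sob) (Rk : mesh -> sob -> sob) (E : sob -> sob).
Variable P : element -> (pt -> R) -> pt -> R.

Definition eta_sub (M S : mesh) (f : pt -> R) : R :=
  eta_on M S f (Rk M (K f)).
Definition eta (M : mesh) (f : pt -> R) : R := eta_sub M M f.

Definition err_a (M : mesh) (f : pt -> R) : R := norm_a (K f - Rk M (K f)).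

(* osc (f - L R_k K f; T_k) *)
Definition osc_res (M : mesh) (f : pt -> R) : R :=
  osc P M (fun T x => f x - elemL T (Rk M (K f)) x).

Definition eigen_approx (l1 Cea Ce0 : R) (W : set sob) : Prop :=
  forall l w, ESOLVE W l w ->
    norm_a (w - E w) <= Cea * delta_a l1 W /\
    norm0 D (w - E w).1 <= Ce0 * eta_a K W * norm_a (w - E w).

Definition osc_property (m : nat) (gstar : R) : Prop :=
  forall M f v, admissible D gstar M -> fe_space m M f -> fe_space m M v ->
    osc P M (fun T x => f.1 x - elemL T v x) = osc P M (fun T => elemL T v).

Definition marking_property (gstar : R) bis (thetas : R) : Prop :=
  forall M M' f (xi : R), admissible D gstar M -> admissible D gstar M' ->
    refinement bis M M' -> inL2 D f -> 0 < xi ^+ 2 < 2^-1 ->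
    err_a M' f ^+ 2 + osc_res M' f ^+ 2 <=
      xi ^+ 2 * (err_a M f ^+ 2 + osc_res M f ^+ 2) ->
    thetas ^+ 2 * (1 - 2 * xi ^+ 2) * eta M f ^+ 2 <=
      eta_sub M [seq T <- M | T \notin M'] f ^+ 2.

Definition vanishing_approximation (m : nat) (gstar l1 : R) : Prop :=
  forall e : R, 0 < e -> exists2 H1 : R, 0 < H1 &
    forall M, admissible D gstar M -> meshsize M <= H1 ->
      eta_a K (fe_space m M) <= e /\ delta_a l1 (fe_space m M) <= e.

Definition run_estimates (m : nat) (l1 : R) (MH : mesh) (r : run)
    (Cea Ce0 Can Cup Clow Coa gam alphah : R) : Prop :=
  [/\ [/\ eigen_approx l1 Cea Ce0 (fe_space m (msh r 1))
        & forall l k j, (2 <= k)%N -> (2 <= l <= lev r k)%N ->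
            (j <= jlast r (nlev r l))%N ->
            eigen_approx l1 Cea Ce0
              (add_span (fe_space m MH) (uu r (nlev r l) j))],
      forall k v, (1 <= k)%N -> V v ->
        norm0 D (v - Rk (msh r k) v).1 <=
          Can * eta_a K (fe_space m (msh r k)) * norm_a (v - Rk (msh r k) v),
      forall k f, (1 <= k)%N -> inL2 D f ->
        err_a (msh r k) f <= Cup * eta (msh r k) f /\
        Clow * eta (msh r k) f <= err_a (msh r k) f + osc_res (msh r k) f,
      forall k v, (1 <= k)%N -> fe_space m (msh r k) v ->
        osc P (msh r k) (fun T => elemL T v) <= Coa * norm_a v
    & forall k, (1 <= k)%N -> let f := (fbar_last r k).1 in
        err_a (msh r k.+1) f ^+ 2 + gam * eta (msh r k.+1) f ^+ 2 <=
        alphah ^+ 2 * (err_a (msh r k) f ^+ 2 + gam * eta (msh r k) f ^+ 2)].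

Definition fnorm (r : run) k : sob :=
  (norm_a (K (fbar_last r k).1))^-1 *: fbar_last r k.
Definition wrun (r : run) k : sob := K (fnorm r k).1.

End operators.
End fem.

Section constants.
Variables (R : realType) (ca l1 Cea Ce0 Can Cup gam alpha theta2 : R).
Definition Cwu : R := 4 * Ce0 * Cea * l1 / ca.
Definition Cww : R := 2 * Can * l1 / ca.
Definition Cw1 : R := 4 * l1 * Ce0 * Cup / ca.
Definition Cw2 : R :=
  Num.max (Cw1 / theta2) (8 * Cwu * l1 * Cup / (theta2 * ca ^+ 2)).
Definition Cwbar0 : R :=
  Cww * alpha * Num.sqrt (Cup ^+ 2 + gam) / (1 - alpha) + 2 * Cwu * Cup.
Definition Cwbar : R := 2 * Cwbar0 * l1 / (theta2 * ca ^+ 2).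
Definition Cw : R := Num.max Cw1 (Num.max Cw2 Cwbar).
End constants.

(* Main.v *)
Require Import Defs.
From mathcomp Require Import all_boot all_order all_algebra.
From mathcomp Require mpoly.
From mathcomp Require Import all_classical all_reals all_analysis.
From mathcomp Require Import measurable_realfun ring lra.
Import Order.TTheory GRing.Theory Num.Theory.
Import numFieldNormedType.Exports.
Import (canonicals, coercions) mpoly.
Set Implicit Arguments. Unset Strict Implicit. Unset Printing Implicit Defensive.
Local Open Scope classical_set_scope.
Local Open Scope ring_scope.

(** The algorithm is an inexact inverse iteration. The source problem is solved by
    an operator [K], the exact step maps a datum [f] to [K f], and the computed
    step is a Galerkin approximation of [K f]. Split the energy space into the
    line of the first eigenvector and its orthogonal complement, and call the
    component of a vector in the complement its direction error. The theorem says
    that the direction error of [K f] is of higher order than the estimator, by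
    the factor [eta_a] of the coarse space, and that error plus estimator of the
    normalised data contract from level to level.

    Three facts about one step carry the proof. First, [K] is bounded from the
    weak norm to the energy norm, and the result of an eigensolve has a direction
    error that is smaller by [eta_a] in the weak norm; so [K] turns it into a
    direction error of higher order ([weak_gain]). Secondly, a datum close to the
    first eigenspace is mapped to such a datum ([aligned_step]). Thirdly, one step
    without eigensolve does not increase the relative direction error, because of
    the gap between the first two eigenvalues, up to the weak norm of the Galerkin
    error, which again is of higher order ([chain_step]).

    On a stretch of levels without eigensolve the direction error is thus at most
    its initial value plus a sum of Galerkin errors. These decrease geometrically
    once the second claim is known, but the second claim on a level needs the
    first one on this level and on the next. A potential, which is the current
    direction error plus the whole remaining geometric series, resolves the
    circularity: it starts at a higher order multiple of the reference estimator
    ([potential_start]) and does not increase as long as the claims hold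
    ([algorithm_invariant]). The stopping tests compare the estimator with the
    reference value, and so convert the bound into one by the estimator of the
    level itself; if inner passes took place, their last eigensolve does this
    ([inner_loop], [level_bound]).

    For the contraction, the estimate for a fixed datum on two consecutive meshes
    is given; the datum has to be changed. Normalised, two consecutive data are
    mapped by [K] to unit vectors, which differ up to sign by the sum of their
    direction errors, because the first eigenspace is a line ([unit_compare]). The
    total error is a seminorm of the datum, controlled on discrete data by the
    energy of [K f]. Hence the change of the datum costs a higher order multiple
    of the total errors, and the slack between the two contraction numbers absorbs
    it on a fine coarse mesh ([level_contraction]).

    All this is carried out for an abstract pair of semi-inner products with a
    spectral gap ([adaptive_iteration]) and then applied to the boundary value
    problem ([run_bounds]). Functions represent classes modulo null sets there,
    so that [K] and the Galerkin projections are linear only up to functions of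
    zero energy. The estimator, however, uses pointwise values on element sides.
    It is well behaved because finite element functions are continuous and vanish
    at the boundary, hence determined by their classes ([fe_null]), and because
    the polynomial pieces on nondegenerate simplices have unique derivatives
    ([piece_deriv_lin]); the squared estimator is then a quadratic function of the
    datum ([eta_on_pencil], [eta_quadratic]). The gap follows from the density of
    the eigenfunctions ([spectral_gap]). *)

(** * Quadratic pencils and semi-inner products *)

Section nonnegative_pencils.
Variable R : realType.
Implicit Types A B C : R.

Lemma pencil_ge0 A B C :
  (forall t, 0 <= A + 2 * t * C + t ^+ 2 * B) -> 0 <= A /\ 0 <= B.
Proof.
move=> h; have A0 : 0 <= A by have := h 0; rewrite mulr0 mul0r expr0n mul0r !addr0.
split=> //; rewrite leNgt; apply/negP => B0.
(* At opposite points the linear terms cancel, and these two are so far out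
   that the quadratic term outweighs [A]. *)
have := h (1 + A / - B); have := h (- (1 + A / - B)).
have : (1 + A / - B) ^+ 2 * B = B - 2 * A + A * (A / B) by field; rewrite lt_eqF.
have : A * (A / B) <= 0 by rewrite mulr_ge0_le0// mulr_ge0_le0// invr_le0 ltW.
rewrite sqrrN; set t := 1 + _; lra.
Qed.

Lemma pencil_discriminant A B C :
  (forall t, 0 <= A + 2 * t * C + t ^+ 2 * B) -> C ^+ 2 <= A * B.
Proof.
move=> h; have [A0 B0] := pencil_ge0 h.
move: B0; rewrite le_eqVlt => /predU1P[B0|B0].
  have [->|C0] := eqVneq C 0; first by rewrite expr0n/= -B0 mulr0.
  have := h (- (A + 1) / (2 * C)); rewrite -B0 mulr0 addr0.
  have -> : A + 2 * (- (A + 1) / (2 * C)) * C = -1 by field.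
  by rewrite ler0N1.
have := h (- C / B); have -> : A + 2 * (- C / B) * C + (- C / B) ^+ 2 * B =
  (A * B - C ^+ 2) / B by field; rewrite gt_eqF.
by rewrite pmulr_lge0 ?invr_gt0// subr_ge0.
Qed.

(** Minkowski's inequality. It is stated for the values of a quadratic polynomial,
    and not for a bilinear form, because the squared estimator is accessible only
    through its restrictions to lines. *)
Lemma pencil_triangle A B C :
  (forall t, 0 <= A + 2 * t * C + t ^+ 2 * B) ->
  Num.sqrt (A + 2 * C + B) <= Num.sqrt A + Num.sqrt B.
Proof.
move=> h; have dC := pencil_discriminant h; have [A0 B0] := pencil_ge0 h.
have CAB : C <= Num.sqrt A * Num.sqrt B.
  rewrite -sqrtrM//; apply: le_trans (ler_norm C) _.
  by rewrite -sqrtr_sqr ler_wsqrtr.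
rewrite -[leRHS](@ger0_norm _) ?addr_ge0 ?sqrtr_ge0// -sqrtr_sqr ler_wsqrtr//.
by rewrite sqrrD !sqr_sqrtr//; lra.
Qed.
End nonnegative_pencils.

(** Functions stand for their classes modulo null sets, so that the forms in use
    are only semidefinite; and they are additive only on a subspace [V] of
    functions with finite integrals. *)
Record semi_inner (R : realType) (X : lmodType R) (V : set X)
    (a : X -> X -> R) : Prop := SemiInner {
  si_mem0 : V 0;
  si_memP : forall c u v, V u -> V v -> V (c *: u + v);
  si_sym : forall u v, V u -> V v -> a u v = a v u;
  si_lin : forall c u v w, V u -> V v -> V w ->
    a (c *: u + v) w = c * a u w + a v w;
  si_ge0 : forall u, V u -> 0 <= a u u }.

Definition snorm (R : realType) (X : lmodType R) (a : X -> X -> R) (u : X) : R :=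
  Num.sqrt (a u u).

Section semi_inner_theory.
Variables (R : realType) (X : lmodType R) (V : set X) (a : X -> X -> R).
Hypothesis aP : semi_inner V a.
Local Notation na := (snorm a).
Implicit Types (u v w : X) (c : R).

Lemma memD u v : V u -> V v -> V (u + v).
Proof. by move=> Vu Vv; rewrite -[u]scale1r; exact: si_memP aP _ _ _ Vu Vv. Qed.

Lemma memZ c u : V u -> V (c *: u).
Proof. by move=> Vu; rewrite -[_ *: _]addr0; apply: (si_memP aP) => //; case: aP. Qed.

Lemma memN u : V u -> V (- u).
Proof. by move=> Vu; rewrite -scaleN1r; exact: memZ. Qed.

Lemma memB u v : V u -> V v -> V (u - v).
Proof. by move=> Vu Vv; apply: memD => //; exact: memN. Qed.

Lemma siDl u v w : V u -> V v -> V w -> a (u + v) w = a u w + a v w.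
Proof. by move=> Vu Vv Vw; rewrite -[u in LHS]scale1r (si_lin aP)// mul1r. Qed.

Lemma si0l w : V w -> a 0 w = 0.
Proof.
move=> Vw; have V0 := si_mem0 aP.
by have := siDl V0 V0 Vw; rewrite addr0 => /eqP; rewrite -subr_eq subrr eq_sym => /eqP.
Qed.

Lemma siZl c u w : V u -> V w -> a (c *: u) w = c * a u w.
Proof.
move=> Vu Vw; rewrite -[c *: u]addr0 (si_lin aP)//; last by case: aP.
by rewrite si0l// addr0.
Qed.

Lemma siBl u v w : V u -> V v -> V w -> a (u - v) w = a u w - a v w.
Proof.
by move=> Vu Vv Vw; rewrite siDl//; [rewrite -scaleN1r siZl// mulN1r|exact: memN].
Qed.

Lemma siDr u v w : V u -> V v -> V w -> a w (u + v) = a w u + a w v.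
Proof.
move=> Vu Vv Vw; rewrite (si_sym aP) ?siDl//; last exact: memD.
by rewrite (si_sym aP Vu)// (si_sym aP Vv).
Qed.

Lemma siZr c u w : V u -> V w -> a w (c *: u) = c * a w u.
Proof.
by move=> Vu Vw; rewrite (si_sym aP) ?siZl// ?(si_sym aP Vu)//; exact: memZ.
Qed.

Lemma snorm_ge0 u : 0 <= na u. Proof. exact: sqrtr_ge0. Qed.

Lemma sqr_snorm u : V u -> na u ^+ 2 = a u u.
Proof. by move=> Vu; rewrite sqr_sqrtr// (si_ge0 aP). Qed.

Lemma si_pencil u v (t : R) : V u -> V v ->
  a (u + t *: v) (u + t *: v) = a u u + 2 * t * a u v + t ^+ 2 * a v v.
Proof.
move=> Vu Vv; have Vtv : V (t *: v) by exact: memZ.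
rewrite siDl ?siDr ?siZl ?siZr//; last exact: memD.
by rewrite (si_sym aP Vv Vu); ring.
Qed.

Lemma si_pencil_ge0 u v (t : R) : V u -> V v ->
  0 <= a u u + 2 * t * a u v + t ^+ 2 * a v v.
Proof.
by move=> Vu Vv; rewrite -si_pencil// (si_ge0 aP)//; apply: memD => //; exact: memZ.
Qed.

Lemma cauchy_schwarz u v : V u -> V v -> `|a u v| <= na u * na v.
Proof.
move=> Vu Vv; rewrite -sqrtrM ?(si_ge0 aP)// -sqrtr_sqr ler_wsqrtr//.
by apply: pencil_discriminant => t; exact: si_pencil_ge0.
Qed.

Lemma snormD u v : V u -> V v -> na (u + v) <= na u + na v.
Proof.
move=> Vu Vv; rewrite {1}/snorm -[v in X in X <= _]scale1r si_pencil//.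
by rewrite mulr1 expr1n mul1r; apply: pencil_triangle => t; exact: si_pencil_ge0.
Qed.

Lemma snormZ c u : V u -> na (c *: u) = `|c| * na u.
Proof.
move=> Vu; have Vc : V (c *: u) by exact: memZ.
by rewrite /snorm siZl ?siZr// mulrA -expr2 sqrtrM ?sqr_ge0// sqrtr_sqr.
Qed.

Lemma snormN u : V u -> na (- u) = na u.
Proof. by move=> Vu; rewrite -scaleN1r snormZ// normrN1 mul1r. Qed.

Lemma snormB u v : V u -> V v -> na (u - v) <= na u + na v.
Proof. by move=> Vu Vv; rewrite -(snormN Vv) snormD//; exact: memN. Qed.

Lemma snorm_subC u v : V u -> V v -> na (u - v) = na (v - u).
Proof. by move=> Vu Vv; rewrite -opprB snormN//; exact: memB. Qed.

Lemma snorm0 : na 0 = 0.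
Proof. by rewrite /snorm si0l ?sqrtr0//; case: aP. Qed.

Lemma snorm_le_subD u v : V u -> V v -> na u <= na v + na (u - v).
Proof.
by move=> Vu Vv; rewrite addrC -{1}[u](subrK v) snormD//; exact: memB.
Qed.

Lemma si_null u v : V u -> V v -> na u = 0 -> a u v = 0.
Proof.
move=> Vu Vv u0; have := cauchy_schwarz Vu Vv.
by rewrite u0 mul0r normr_le0 => /eqP.
Qed.

Lemma snorm_null_eq u v : V u -> V v -> na (u - v) = 0 -> na u = na v.
Proof.
move=> Vu Vv uv; apply/eqP; rewrite eq_le; apply/andP; split.
  by have := snorm_le_subD Vu Vv; rewrite uv addr0.
by have := snorm_le_subD Vv Vu; rewrite snorm_subC// uv addr0.
Qed.

(** The Galerkin equations say that an approximation from a subspace is a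
    nearest point of that subspace. *)
Lemma galerkin_best (W : set X) u w : W `<=` V -> (forall v v', W v -> W v' -> W (v - v')) ->
  V u -> W w -> (forall v, W v -> a (u - w) v = 0) ->
  forall v, W v -> na (u - w) <= na (u - v).
Proof.
move=> WV WB Vu Ww orth v Wv; have Vw := WV _ Ww; have Vv := WV _ Wv.
have Vuw : V (u - w) by exact: memB.
rewrite ler_wsqrtr//.
have -> : u - v = (u - w) + 1 *: (w - v) by rewrite scale1r subrKA.
rewrite si_pencil//; last by exact: memB.
have -> : a (u - w) (w - v) = 0 by apply: orth; apply: WB.
by rewrite mulr0 addr0 lerDl mulr_ge0 ?sqr_ge0// (si_ge0 aP)//; exact: memB.
Qed.

Lemma snorm_galerkin (W : set X) u w : W `<=` V -> (forall v v', W v -> W v' -> W (v - v')) ->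
  W 0 -> V u -> W w -> (forall v, W v -> a (u - w) v = 0) ->
  na (u - w) <= na u /\ na w <= na u.
Proof.
move=> WV WB W0 Vu Ww orth; have Vw := WV _ Ww.
have Vuw : V (u - w) by exact: memB.
split; first by have := galerkin_best WV WB Vu Ww orth W0; rewrite subr0.
rewrite ler_wsqrtr//.
have -> : u = w + 1 *: (u - w) by rewrite scale1r addrC subrK.
rewrite si_pencil// (si_sym aP Vw)// orth//.
by rewrite mulr0 addr0 expr1n mul1r lerDl (si_ge0 aP).
Qed.
End semi_inner_theory.

(** * Inverse iteration near the first eigenvector *)

(** The source problem in energy form: [a] is the energy, [b] the inner product
    of the right-hand sides, [kap] the solution operator, and [e0] a normalised
    eigenvector whose eigenvalue [l] is separated by a gap from the rest of the
    spectrum, which lies in [l2, +oo[. *)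
Record eigen_model (R : realType) (X : lmodType R) (V : set X) (a b : X -> X -> R)
    (ca l l2 : R) (e0 : X) (kap : X -> X) : Prop := EigenModel {
  em_a : semi_inner V a;
  em_b : semi_inner V b;
  em_ca0 : 0 < ca;
  em_ca : forall u, V u -> ca * snorm b u <= snorm a u;
  em_mem : V e0;
  em_norm : a e0 e0 = 1;
  em_l0 : 0 < l;
  em_l2 : l < l2;
  em_eig : forall v, V v -> a e0 v = l * b e0 v;
  em_gap : forall v, V v -> a v e0 = 0 -> l2 * b v v <= a v v;
  em_kapV : forall f, V f -> V (kap f);
  em_kap : forall f v, V f -> V v -> a (kap f) v = b f v }.

Section deflation.
Variables (R : realType) (X : lmodType R) (V : set X) (a b : X -> X -> R).
Variables (ca l l2 : R) (e0 : X) (kap : X -> X).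
Hypothesis em : eigen_model V a b ca l l2 e0 kap.
Let aP := em_a em.
Let bP := em_b em.
Let ca0 := em_ca0 em.
Let ca_le := em_ca em.
Let Ve0 := em_mem em.
Let ae0 := em_norm em.
Let l0 := em_l0 em.
Let ll2 := em_l2 em.
Let e0P := em_eig em.
Let gap := em_gap em.
Let kapV := em_kapV em.
Let kapP := em_kap em.

Local Notation na := (snorm a).
Local Notation nb := (snorm b).
Implicit Types (u v w f : X) (c : R).

(** The distance of a vector to the first eigenspace is measured through this
    explicit linear map; it agrees with the identity minus the projection up to
    vectors of zero energy. *)
Definition defl u : X := u - a u e0 *: e0.
Local Notation nd u := (na (defl u)).

Let memaB := memB aP. Let memaZ := memZ aP. Let memaD := memD aP.
Hint Resolve Ve0 : core.

Lemma deflV u : V u -> V (defl u).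
Proof. by move=> Vu; apply: memaB => //; exact: memaZ. Qed.

Lemma deflB u v : V u -> V v -> defl (u - v) = defl u - defl v.
Proof.
move=> Vu Vv; rewrite /defl (siBl aP)// scalerBl !opprB -!addrA; congr (_ + _).
by rewrite addrCA [RHS]addrCA [- v - _]addrC.
Qed.

Lemma deflZ c u : V u -> defl (c *: u) = c *: defl u.
Proof. by move=> Vu; rewrite /defl (siZl aP)// scalerBr scalerA. Qed.

Lemma a_defl_e0 u : V u -> a (defl u) e0 = 0.
Proof.
by move=> Vu; rewrite /defl (siBl aP)// ?(siZl aP)// ?ae0 ?mulr1 ?subrr//; exact: memaZ.
Qed.

Lemma b_e0_defl u : V u -> b e0 (defl u) = 0.
Proof.
move=> Vu; have Vd := deflV Vu; apply: (mulfI (lt0r_neq0 l0)).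
by rewrite -e0P// (si_sym aP)// a_defl_e0// mulr0.
Qed.

Lemma sqr_na_defl u : V u -> na u ^+ 2 = a u e0 ^+ 2 + nd u ^+ 2.
Proof.
move=> Vu; have Vd := deflV Vu; have Vc := memaZ (a u e0) Ve0.
have {1}-> : u = defl u + a u e0 *: e0 by rewrite subrK.
rewrite !(sqr_snorm aP)//; last exact: memaD.
rewrite (si_pencil aP)// a_defl_e0// ae0; ring.
Qed.

Lemma nd_le u : V u -> nd u <= na u.
Proof.
move=> Vu; rewrite -(ler_pXn2r (n := 2))// ?nnegrE ?snorm_ge0//.
by rewrite [leRHS]sqr_na_defl// lerDr sqr_ge0.
Qed.

Lemma coef_le u : V u -> `|a u e0| <= na u.
Proof.
move=> Vu; rewrite -(ler_pXn2r (n := 2))// ?nnegrE ?snorm_ge0// real_normK ?num_real//.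
by rewrite [leRHS]sqr_na_defl// lerDl sqr_ge0.
Qed.

Lemma na_le_coef u : V u -> na u <= `|a u e0| + nd u.
Proof.
move=> Vu; rewrite -(ler_pXn2r (n := 2))// ?nnegrE ?addr_ge0 ?snorm_ge0//.
rewrite sqr_na_defl// sqrrD real_normK ?num_real// addrAC lerDl.
by rewrite mulrn_wge0// mulr_ge0// snorm_ge0.
Qed.

Lemma nb_le u : V u -> nb u <= na u / ca.
Proof. by move=> Vu; rewrite ler_pdivlMr// mulrC ca_le. Qed.

Lemma nb_gap v : V v -> a v e0 = 0 -> nb v <= na v / Num.sqrt l2.
Proof.
move=> Vv v0; have l20 := lt_trans l0 ll2.
rewrite ler_pdivlMr ?sqrtr_gt0// mulrC -sqrtrM ?(ltW l20)//.
by rewrite ler_wsqrtr// gap.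
Qed.

Lemma a_kap_e0 f : V f -> a (kap f) e0 = a f e0 / l.
Proof.
move=> Vf; rewrite kapP// (si_sym aP Vf)// e0P// (si_sym bP Vf)// [l * _]mulrC.
by rewrite mulfK// gt_eqF.
Qed.

(** The eigenvector is orthogonal to every deflated vector in both forms, so that
    the source problem can be restricted to the deflated parts. *)
Lemma sqr_nd_kap f : V f -> nd (kap f) ^+ 2 = b (defl f) (defl (kap f)).
Proof.
move=> Vf; have Vk := kapV Vf; have Vdk := deflV Vk; have Vd := deflV Vf.
rewrite (sqr_snorm aP)// {1}/defl (siBl aP)//; last exact: memaZ.
rewrite (siZl aP)// (si_sym aP Ve0)// a_defl_e0// mulr0 subr0 kapP//.
rewrite /defl -/(defl (kap f)) (siBl bP)//; last exact: memaZ.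
by rewrite (siZl bP)// b_e0_defl// mulr0 subr0.
Qed.

(** The solution operator is smoothing: it turns the weak norm of a direction
    error into its energy norm. *)
Lemma nd_kap_b f : V f -> nd (kap f) <= nb (defl f) / ca.
Proof.
move=> Vf; have Vk := kapV Vf; have Vdk := deflV Vk; have Vd := deflV Vf.
have h : nd (kap f) ^+ 2 <= nb (defl f) / ca * nd (kap f).
  rewrite sqr_nd_kap//; apply: le_trans (ler_norm _) _.
  apply: le_trans (cauchy_schwarz bP Vd Vdk) _.
  by rewrite -mulrA ler_wpM2l ?snorm_ge0// mulrC nb_le.
have := snorm_ge0 a (defl (kap f)); rewrite le_eqVlt => /predU1P[<-|p].
  by rewrite divr_ge0 ?snorm_ge0// ltW.
by rewrite -(ler_pM2r p) -expr2.
Qed.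

(** After Cauchy's inequality for [b] the gap applies to both factors. *)
Lemma nd_kap_gap f : V f -> nd (kap f) <= nd f / l2.
Proof.
move=> Vf; have Vk := kapV Vf; have Vdk := deflV Vk; have Vd := deflV Vf.
have l20 := lt_trans l0 ll2.
have h : nd (kap f) ^+ 2 <= nd f / l2 * nd (kap f).
  rewrite sqr_nd_kap//; apply: le_trans (ler_norm _) _.
  apply: le_trans (cauchy_schwarz bP Vd Vdk) _.
  have -> : nd f / l2 * nd (kap f) = nd f / Num.sqrt l2 * (nd (kap f) / Num.sqrt l2).
    rewrite mulrACA -invfM -expr2 sqr_sqrtr ?(ltW l20)//; ring.
  by rewrite ler_pM ?snorm_ge0// nb_gap// a_defl_e0.
have := snorm_ge0 a (defl (kap f)); rewrite le_eqVlt => /predU1P[<-|p].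
  by rewrite divr_ge0 ?snorm_ge0// ltW.
by rewrite -(ler_pM2r p) -expr2.
Qed.

Lemma na_kap_le f : V f -> na (kap f) <= nb f / ca.
Proof.
move=> Vf; have Vk := kapV Vf.
have h : na (kap f) ^+ 2 <= nb f / ca * na (kap f).
  rewrite (sqr_snorm aP)// kapP//; apply: le_trans (ler_norm _) _.
  apply: le_trans (cauchy_schwarz bP Vf Vk) _.
  by rewrite -mulrA ler_wpM2l ?snorm_ge0// mulrC nb_le.
have := snorm_ge0 a (kap f); rewrite le_eqVlt => /predU1P[<-|p].
  by rewrite divr_ge0 ?snorm_ge0// ltW.
by rewrite -(ler_pM2r p) -expr2.
Qed.

(** [kap] is linear only up to vectors of zero energy. *)
Lemma kap_null f g (s : R) : V f -> V g ->
  na (kap (f - s *: g) - (kap f - s *: kap g)) = 0.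
Proof.
move=> Vf Vg; have Vsg : V (s *: g) by exact: memaZ.
have Vk := kapV Vf; have Vk' := kapV Vg.
have Vsk : V (s *: kap g) by exact: memaZ.
have Vd : V (kap f - s *: kap g) by exact: memaB.
have Vfg : V (f - s *: g) by exact: memaB.
have Vkd := kapV Vfg; set z := _ - _; have Vz : V z by exact: memaB.
suff : a z z = 0 by rewrite /snorm => ->; rewrite sqrtr0.
rewrite {1}/z (siBl aP)// kapP// (siBl aP)// (siZl aP)// !kapP// (siBl bP)//.
by rewrite (siZl bP)// subrr.
Qed.

(** The first eigenvalue is simple: an eigenvector orthogonal to [e0] violates
    the gap unless it has no energy. *)
Lemma eigenvector_null v : V v -> (forall w, V w -> a v w = l * b v w) -> nd v = 0.
Proof.
move=> Vv hv; have Vd := deflV Vv; have Vce := memaZ (a v e0) Ve0.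
have h : a (defl v) (defl v) = l * b (defl v) (defl v).
  have -> : a (defl v) (defl v) = a (v - a v e0 *: e0) (defl v) by [].
  have -> : b (defl v) (defl v) = b (v - a v e0 *: e0) (defl v) by [].
  by rewrite (siBl aP)// (siBl bP)// (siZl aP)// (siZl bP)// hv// e0P//; ring.
have := gap Vd (a_defl_e0 Vv); have := si_ge0 bP Vd.
rewrite /snorm h; set z := b _ _ => z0 hz.
suff -> : z = 0 by rewrite mulr0 sqrtr0.
apply/eqP; rewrite eq_le z0 andbT leNgt; apply/negP => zp.
by move: hz; rewrite leNgt ltr_pM2r// ll2.
Qed.

Lemma null_b u : V u -> na u = 0 -> nb u = 0.
Proof.
move=> Vu u0; apply/eqP; rewrite eq_le snorm_ge0 andbT.
by have := nb_le Vu; rewrite u0 mul0r.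
Qed.

Lemma defl_sub_eigenvector u w : V u -> V w -> nd w = 0 -> a (u - w) e0 = 0 ->
  na (u - w) = nd u /\ nb (u - w) = nb (defl u).
Proof.
move=> Vu Vw w0; rewrite (siBl aP)// => /subr0_eq ce.
have Vd := deflV Vu; have Vuw := memaB Vu Vw; have Vz := memaB Vuw Vd.
have nz : na (u - w - defl u) = 0.
  have -> : u - w - defl u = - defl w.
    by rewrite /defl ce !opprB addrC addrA subrK.
  by rewrite (snormN aP)//; exact: deflV.
split; first exact: (snorm_null_eq aP Vuw Vd nz).
exact: (snorm_null_eq bP Vuw Vd (null_b Vz nz)).
Qed.

(** A unit vector [u] approximates the unit eigenvector [v] as well as the
    eigenspace approximates [u]. *)
Lemma unit_multiple_dist u v : V u -> V v -> na u = 1 -> na v = 1 -> nd v = 0 ->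
  na (v - a v u *: u) <= nd u.
Proof.
move=> Vu Vv u1 v1 dv; have Vcu := memaZ (a v u) Vu; have Vd := deflV Vv.
have Vdu := deflV Vu; have Vce := memaZ (a v e0) Ve0.
rewrite -ler_sqr ?nnegrE ?snorm_ge0//.
have sq1 : a u u = 1 by rewrite -(sqr_snorm aP)// u1 expr1n.
have sv1 : a v v = 1 by rewrite -(sqr_snorm aP)// v1 expr1n.
have := sqr_na_defl Vu; rewrite u1 expr1n => eu.
have := sqr_na_defl Vv; rewrite v1 dv expr0n /= addr0 expr1n => ce.
have avu : a v u = a v e0 * a u e0.
  have := si_null aP Vd Vu dv.
  by rewrite {1}/defl (siBl aP)// (siZl aP)// (si_sym aP Ve0 Vu) => /subr0_eq.
rewrite (sqr_snorm aP); last exact: memaB.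
rewrite -scaleNr (si_pencil aP)// sq1 sv1.
have -> : na (defl u) ^+ 2 = 1 - a u e0 ^+ 2 by lra.
have -> : 1 + 2 * - a v u * a v u + (- a v u) ^+ 2 * 1 = 1 - a v u ^+ 2 by ring.
by rewrite avu exprMn -ce mul1r.
Qed.

Lemma na_kapZ s u v : 0 < s -> V u -> V v ->
  na (kap (s *: u) - v) = s * na (kap u - s^-1 *: v).
Proof.
move=> s0 Vu Vv; have Vk := kapV Vu; have Vsu := memaZ s Vu; have Vk' := kapV Vsu.
have Vv' := memaZ s^-1 Vv; have Vd := memaB Vk Vv'; have Vsk := memaZ s Vk.
rewrite -[X in X * _](gtr0_norm s0) -(snormZ aP)//.
apply: (snorm_null_eq aP); [exact: memaB|exact: memaZ|].
have -> : kap (s *: u) - v - s *: (kap u - s^-1 *: v) = kap (s *: u) - s *: kap u.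
  by rewrite scalerBr scalerA divff ?gt_eqF// scale1r opprB addrA subrK.
have Vz : V (kap (s *: u) - s *: kap u) by exact: memaB.
suff : a (kap (s *: u) - s *: kap u) (kap (s *: u) - s *: kap u) = 0.
  by rewrite /snorm => ->; rewrite sqrtr0.
by rewrite (siBl aP)// (siZl aP)// !kapP// (siZl bP)// subrr.
Qed.

Local Notation q := (l / l2).
(** The threshold below which the direction of a vector stays below the
    threshold under one step of inverse iteration, because [l < l2]. *)
Definition tol : R := (1 - q) / 4.
Local Notation t0 := tol.

Lemma tol_bounds : [/\ 0 < q, q = 1 - 4 * t0, 0 < t0 & t0 < 1 / 4].
Proof.
have q0 : 0 < q by rewrite divr_gt0// (lt_trans l0).
have q1 : q < 1 by rewrite ltr_pdivrMr ?mul1r// (lt_trans l0).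
by rewrite /tol; move: (q) q0 q1 => x x0 x1; split; lra.
Qed.

(** The neighbourhood of the first eigenspace in which all data stay. *)
Definition aligned f := [/\ V f, na f = 1 & nd f <= t0].

Lemma aligned_coef f : aligned f -> 1 - t0 <= `|a f e0|.
Proof.
case=> Vf f1 ft; have := na_le_coef Vf; rewrite f1; lra.
Qed.

Lemma aligned_kap f : aligned f ->
  [/\ (1 - t0) / l <= na (kap f), nd (kap f) <= q * t0 / l,
      (na (kap f))^-1 <= 2 * l, 0 < na (kap f) & na (kap f) <= 1 / ca ^+ 2].
Proof.
move=> gf; have cf := aligned_coef gf; case: gf => Vf f1 ft.
have [q0 qt t00 t04] := tol_bounds; have Vk := kapV Vf.
have k1 : (1 - t0) / l <= na (kap f).
  apply: le_trans (coef_le Vk); rewrite a_kap_e0// normrM normfV (gtr0_norm l0).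
  by rewrite ler_pM2r// invr_gt0.
have p0 : 0 < (1 - t0) / l by rewrite divr_gt0//; lra.
have k0 := lt_le_trans p0 k1.
have l20 := lt_trans l0 ll2.
split=> //.
- apply: le_trans (nd_kap_gap Vf) _.
  have -> : q * t0 / l = t0 / l2 by field; rewrite !gt_eqF.
  by rewrite ler_pM2r// invr_gt0.
- rewrite -[leRHS]invrK lef_pV2 ?posrE ?invr_gt0 ?mulr_gt0//.
  apply: le_trans k1; rewrite invfM ler_pM2r ?invr_gt0//; lra.
- apply: le_trans (na_kap_le Vf) _.
  rewrite expr2 invfM mulrA ler_pM2r ?invr_gt0//.
  by rewrite -f1 nb_le.
Qed.

(** One step of inverse iteration in a subspace. Here [w] stands for the
    Galerkin approximation of [kap f]. *)
Lemma aligned_step f w : aligned f -> V w -> na (kap f - w) <= t0 ^+ 2 / l ->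
  let u := (na w)^-1 *: w in
  [/\ aligned u, (na w)^-1 <= 2 * l, 0 < na w &
      nd u <= 2 * l * (na (kap f - w) + nd (kap f))].
Proof.
move=> gf Vw ew u; have [k1 k2 k3 k0 _] := aligned_kap gf; have cf := aligned_coef gf.
case: gf => Vf f1 ft; have Vk := kapV Vf; have [q0 qt t00 t04] := tol_bounds.
have Vkw : V (kap f - w) by exact: memaB.
have cw : (1 - t0 - t0 ^+ 2) / l <= `|a w e0|.
  have : `|a (kap f) e0| <= `|a w e0| + `|a (kap f - w) e0|.
    by rewrite (siBl aP)// (le_trans _ (ler_normD _ _))// addrC subrK.
  have := coef_le Vkw.
  have : (1 - t0) / l <= `|a (kap f) e0|.
    by rewrite a_kap_e0// normrM normfV (gtr0_norm l0) ler_pM2r// invr_gt0.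
  rewrite mulrBl; lra.
have dw : nd w <= na (kap f - w) + nd (kap f).
  rewrite -[X in defl X](subKr (kap f)) deflB//.
  apply: le_trans (snormB aP (deflV _) (deflV _)) _ => //.
  by rewrite addrC lerD2r nd_le.
have wc := coef_le Vw.
have w1 : (2 * l)^-1 <= na w.
  apply: le_trans (le_trans cw wc); rewrite invfM ler_pM2r ?invr_gt0//; nra.
have w0 : 0 < na w by rewrite (lt_le_trans _ w1)// invr_gt0 mulr_gt0.
have w2 : (na w)^-1 <= 2 * l by rewrite -[leRHS]invrK lef_pV2 ?posrE ?invr_gt0 ?mulr_gt0.
have du : nd u = (na w)^-1 * nd w.
  by rewrite /u deflZ// (snormZ aP) ?ger0_norm ?invr_ge0 ?snorm_ge0//; exact: deflV.
split=> //.
- split; first exact: memaZ.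
    by rewrite /u (snormZ aP)// ger0_norm ?invr_ge0 ?snorm_ge0// mulVf// gt_eqF.
  rewrite du mulrC ler_pdivrMr//; apply: le_trans dw _.
  apply: le_trans (lerD ew k2) _.
  apply: (@le_trans _ _ (t0 * ((1 - t0 - t0 ^+ 2) / l))).
    rewrite -mulrDl [leRHS]mulrA ler_pM2r ?invr_gt0// qt; nra.
  by rewrite ler_pM2l// (le_trans cw).
- rewrite du ler_pM ?invr_ge0 ?snorm_ge0//.
Qed.

(** The direction error of [kap f] passes to the next iterate [kap w] with a
    factor of at most one, because [kap] contracts it by [l2] and the first
    eigenvector only by [l]; the Galerkin error enters in the weak norm. *)
Lemma chain_step f w (d : R) : aligned f -> V w -> na (kap f - w) <= t0 ^+ 2 / l ->
  nb (kap f - w) <= d * na (kap f - w) -> 0 <= d ->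
  nd (kap ((na w)^-1 *: w)) / na (kap ((na w)^-1 *: w)) <=
    nd (kap f) / na (kap f) + 2 * l * d / ca * (na (kap f - w) / na (kap f)).
Proof.
move=> gf Vw ew bw d0; set u := _ *: w.
have [[Vu u1 ut] _ w0 _] := aligned_step gf Vw ew; rewrite -/u in Vu u1 ut.
have [k1 k2 k3 k0 _] := aligned_kap gf; have cf := aligned_coef gf.
case: gf => Vf f1 ft; have Vk := kapV Vf; have [q0 qt t00 t04] := tol_bounds.
have Vkw : V (kap f - w) by exact: memaB.
have Vdk := deflV Vk; have Vku := kapV Vu; have Vdku := deflV Vku.
have wu : w = na w *: u by rewrite /u scalerA divff ?scale1r// gt_eqF.
have l20 := lt_trans l0 ll2.
(* [w] differs from [kap f] by the Galerkin error; tested with the deflated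
   part of the next iterate, this error is seen in the weak norm only. *)
have h1 : na w * nd (kap u) <= nd (kap f) / l2 + d * na (kap f - w) / ca.
  have h : na w * nd (kap u) ^+ 2 <=
      (nd (kap f) / l2 + d * na (kap f - w) / ca) * nd (kap u).
    rewrite sqr_nd_kap// -(siZl bP)//; last exact: deflV.
    have -> : na w *: defl u = defl (kap f) - defl (kap f - w).
      by rewrite -deflB// subKr {2}wu deflZ.
    rewrite (siBl bP)//; last exact: deflV.
    have -> : b (defl (kap f - w)) (defl (kap u)) = b (kap f - w) (defl (kap u)).
      rewrite {1}/defl (siBl bP)//; last exact: memaZ.
      by rewrite (siZl bP)// b_e0_defl// mulr0 subr0.
    rewrite mulrDl; apply: lerD.
      apply: le_trans (ler_norm _) _.
      apply: le_trans (cauchy_schwarz bP Vdk Vdku) _.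
      have -> : nd (kap f) / l2 * nd (kap u) =
          nd (kap f) / Num.sqrt l2 * (nd (kap u) / Num.sqrt l2).
        rewrite mulrACA -invfM -expr2 sqr_sqrtr ?(ltW l20)//; ring.
      by rewrite ler_pM ?snorm_ge0// nb_gap// a_defl_e0.
    apply: le_trans (ler_norm _) _; rewrite normrN.
    apply: le_trans (cauchy_schwarz bP Vkw Vdku) _.
    rewrite [leRHS]mulrAC -[leRHS]mulrA ler_pM ?snorm_ge0//.
    exact: nb_le.
  have := snorm_ge0 a (defl (kap u)); rewrite le_eqVlt => /predU1P[<-|p].
    by rewrite mulr0 addr_ge0// divr_ge0 ?mulr_ge0 ?snorm_ge0// ltW.
  by rewrite -(ler_pM2r p) -[leLHS]mulrA -expr2.
(* The component of the next iterate along the eigenvector nearly exhausts the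
   energy of [kap f], because [f] is aligned. *)
have h2 : na (kap f) * (1 - t0) / l <= na w * na (kap u).
  have : `|a w e0| / l <= na w * na (kap u).
    have : `|a (kap u) e0| <= na (kap u) by exact: coef_le.
    rewrite a_kap_e0// normrM normfV (gtr0_norm l0) -(ler_pM2l w0) mulrA.
    have -> : a w e0 = a (na w *: u) e0 by rewrite -wu.
    by rewrite (siZl aP)// normrM (gtr0_norm w0).
  apply: le_trans; rewrite ler_pM2r ?invr_gt0//.
  have : `|a (kap f) e0| <= `|a w e0| + `|a (kap f - w) e0|.
    by rewrite (siBl aP)// (le_trans _ (ler_normD _ _))// addrC subrK.
  have := coef_le Vkw; have := na_le_coef Vk.
  have h : q * t0 / l + t0 ^+ 2 / l <= na (kap f) * t0.
    apply: (@le_trans _ _ ((1 - t0) / l * t0)); last by rewrite ler_pM2r.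
    rewrite -mulrDl [leRHS]mulrAC ler_pM2r ?invr_gt0// qt; nra.
  lra.
have kp : 0 < na (kap f) * (1 - t0) / l by rewrite divr_gt0// mulr_gt0//; lra.
have -> : nd (kap u) / na (kap u) = na w * nd (kap u) / (na w * na (kap u)).
  by rewrite -mulf_div divff ?mul1r// gt_eqF.
apply: (@le_trans _ _ ((nd (kap f) / l2 + d * na (kap f - w) / ca) /
   (na (kap f) * (1 - t0) / l))).
  apply: ler_pM => //; rewrite ?mulr_ge0 ?snorm_ge0 ?invr_ge0//.
    by rewrite mulr_ge0// snorm_ge0.
  by rewrite lef_pV2 ?posrE// (lt_le_trans kp).
have -> : (nd (kap f) / l2 + d * na (kap f - w) / ca) / (na (kap f) * (1 - t0) / l)
   = nd (kap f) / na (kap f) * (q / (1 - t0)) +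
     2 * l * d / ca * (na (kap f - w) / na (kap f)) * (2^-1 / (1 - t0)).
  by field; rewrite !gt_eqF ?subr_gt0//; lra.
(* Both extra factors are at most one since [q = 1 - 4 * tol]. *)
apply: lerD.
  rewrite ler_piMr ?divr_ge0 ?snorm_ge0// ler_pdivrMr ?mul1r; lra.
rewrite ler_piMr//; last by rewrite ler_pdivrMr ?mul1r; lra.
by rewrite mulr_ge0 ?divr_ge0 ?snorm_ge0 ?(ltW ca0) ?mulr_ge0// ltW.
Qed.

(** An eigensolve in a space that contains [u] returns a function [w] whose
    error is controlled by that of [u], with a gain [d] in the weak norm. *)
Lemma weak_gain (w : X) (C d x : R) : V w -> 0 <= C -> 0 <= d ->
  nb (defl w) <= C * d * nd w -> nd w <= x ->
  nd (kap w) <= C / ca * d * x.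
Proof.
move=> Vw C0 d0 hb hx; apply: le_trans (nd_kap_b Vw) _.
have -> : C / ca * d * x = C * d * x / ca by ring.
rewrite ler_pM2r ?invr_gt0//.
by apply: le_trans hb _; rewrite ler_wpM2l// mulr_ge0.
Qed.

(** Two unit vectors close to the first eigenspace are close to each other up
    to a sign, the eigenspace being a line. *)
Lemma unit_compare w1 w2 : V w1 -> V w2 -> na w1 = 1 -> na w2 = 1 ->
  exists2 s : R, `|s| = 1 & na (w2 - s *: w1) <= 2 * (nd w1 + nd w2).
Proof.
move=> V1 V2 n1 n2.
have c1 := coef_le V1; have c2 := coef_le V2; rewrite n1 in c1; rewrite n2 in c2.
have g1 := na_le_coef V1; have g2 := na_le_coef V2; rewrite n1 in g1; rewrite n2 in g2.
pose sg (x : R) : R := if 0 <= x then 1 else -1.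
have sg1 x : `|sg x| = 1 by rewrite /sg; case: ifP; rewrite ?normrN normr1.
have sgM x : x = sg x * `|x|.
  by rewrite /sg; case: ger0P => _; rewrite ?mulrNN mul1r.
pose s := sg (a w2 e0) * sg (a w1 e0); have s1 : `|s| = 1 by rewrite normrM !sg1 mulr1.
exists s => //; have Vs := memaZ s V1; have Vd := memaB V2 Vs.
apply: le_trans (na_le_coef Vd) _.
have : `|a (w2 - s *: w1) e0| <= nd w1 + nd w2.
  rewrite (siBl aP)// (siZl aP)//.
  have -> : s * a w1 e0 = sg (a w2 e0) * `|a w1 e0|.
    have sq : sg (a w1 e0) * sg (a w1 e0) = 1.
      by rewrite -expr2 -[_ ^+ 2]real_normK ?num_real// sg1 expr1n.
    by rewrite {1}(sgM (a w1 e0)) /s -mulrA [sg (a w1 e0) * _]mulrA sq mul1r.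
  rewrite {1}(sgM (a w2 e0)).
  rewrite -mulrBr normrM sg1 mul1r ler_norml.
  by have := snorm_ge0 a (defl w1); have := snorm_ge0 a (defl w2); lra.
have : nd (w2 - s *: w1) <= nd w1 + nd w2.
  rewrite deflB// deflZ//; apply: le_trans (snormB aP (deflV V2) _) _.
    by apply: memaZ; exact: deflV.
  by rewrite (snormZ aP) ?s1 ?mul1r 1?addrC//; exact: deflV.
lra.
Qed.

End deflation.

(** * Square integrable functions *)

Section square_integrable.
Context d (T : measurableType d) (R : realType) (mu : {measure set T -> \bar R}).
Variable D : set T.
Hypothesis mD : measurable D.
Implicit Types f g : T -> R.

(** The measure is arbitrary since the estimator integrates over elements and, for
    the jumps, over the reference simplex of their sides. *)
Definition sqint f : Prop :=
  measurable_fun D f /\ mu.-integrable D (fun x => (f x ^+ 2)%:E).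

Lemma sqintM f g : sqint f -> sqint g ->
  mu.-integrable D (fun x => (f x * g x)%:E).
Proof.
move=> [mf f2] [mg g2].
apply: (@le_integrable _ _ _ mu D mD _ (fun x => (f x ^+ 2)%:E + (g x ^+ 2)%:E)%E).
- by apply/measurable_EFinP; exact: measurable_funM.
- move=> x Dx; rewrite -EFinD !abse_EFin lee_fin.
  rewrite [leRHS]ger0_norm ?addr_ge0 ?sqr_ge0// ler_norml.
  have := sqr_ge0 (f x + g x); have := sqr_ge0 (f x - g x).
  by rewrite sqrrB sqrrD; have := sqr_ge0 (f x); have := sqr_ge0 (g x); lra.
- exact: integrableD.
Qed.

Lemma sqint_lin (c : R) f g : sqint f -> sqint g -> sqint (fun x => c * f x + g x).
Proof.
move=> Lf Lg; have [mf f2] := Lf; have [mg g2] := Lg; split.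
  by apply: measurable_funD => //; exact: measurable_funM.
have -> : (fun x => ((c * f x + g x) ^+ 2)%:E) = (fun x =>
    (c ^+ 2)%:E * (f x ^+ 2)%:E + (((2 * c)%:E * (f x * g x)%:E) + (g x ^+ 2)%:E))%E.
  by apply/funext => x; rewrite -!EFinM -!EFinD; congr EFin; ring.
apply: integrableD => //; first exact: integrableZl.
by apply: integrableD => //; apply: integrableZl => //; exact: sqintM.
Qed.

Lemma sqint0 : sqint (fun=> 0).
Proof. by split => //; rewrite expr0n/=; exact: integrable0. Qed.

Lemma sqintZ c f : sqint f -> sqint (fun x => c * f x).
Proof.
move=> Lf; have := sqint_lin c Lf sqint0.
by under eq_fun do rewrite addr0.
Qed.

Lemma sqintD f g : sqint f -> sqint g -> sqint (fun x => f x + g x).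
Proof.
move=> Lf Lg; have := sqint_lin 1 Lf Lg.
by under eq_fun do rewrite mul1r.
Qed.

Lemma sqintN f : sqint f -> sqint (fun x => - f x).
Proof.
move=> Lf; have := sqintZ (-1) Lf.
by under eq_fun do rewrite mulN1r.
Qed.

Lemma sqintB f g : sqint f -> sqint g -> sqint (fun x => f x - g x).
Proof. by move=> Lf Lg; apply: sqintD => //; exact: sqintN. Qed.

Lemma sqint_sum (I : Type) (s : seq I) (F : I -> T -> R) :
  (forall i, sqint (F i)) -> sqint (fun x => \sum_(i <- s) F i x).
Proof.
move=> LF; elim: s => [|i s IH].
  by under eq_fun do rewrite big_nil; exact: sqint0.
by under eq_fun do rewrite big_cons; exact: sqintD.
Qed.

Lemma sqint_bounded f (C : R) : (mu D < +oo)%E -> measurable_fun D f ->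
  (forall x, D x -> `|f x| <= C) -> sqint f.
Proof.
move=> Dfin mf fC; split => //; apply: measurable_bounded_integrable => //.
  exact: measurable_funX.
exists (C ^+ 2); split; first by rewrite num_real.
move=> M CM x Dx /=; rewrite normrX (le_trans _ (ltW CM))//.
by rewrite ler_pXn2r ?nnegrE// ?fC// (le_trans _ (fC _ Dx)).
Qed.

Lemma sqint_ess_bounded (h : T -> R) f (C : R) : measurable_fun D h ->
  {ae mu, forall x, D x -> `|h x| <= C} -> sqint f -> sqint (fun x => h x * f x).
Proof.
move=> mh hC [mf f2]; have mhf : measurable_fun D (fun x => h x * f x).
  exact: measurable_funM.
split=> //; apply/integrableP; split.
  by apply/measurable_EFinP; exact: measurable_funX.
have /integrableP[mf2 f2oo] := integrableZl mD (C ^+ 2) f2.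
apply: le_lt_trans f2oo; apply: ae_ge0_le_integral => //.
- by apply: measurableT_comp => //; apply/measurable_EFinP; exact: measurable_funX.
- by apply: measurableT_comp.
- apply: filterS hC => x hx Dx; have {}hx := hx Dx.
  rewrite -EFinM !abse_EFin lee_fin [leRHS]normrM !normrX normrM exprMn.
  by rewrite ler_wpM2r ?exprn_ge0// ler_pXn2r ?nnegrE// (le_trans hx)// ler_norm.
Qed.

Lemma sqint_sub (E : set T) f : measurable E -> E `<=` D -> sqint f ->
  measurable_fun E f /\ mu.-integrable E (fun x => (f x ^+ 2)%:E).
Proof.
move=> mE ED [mf f2]; split; first exact: measurable_funS mf.
exact: integrableS f2.
Qed.

Lemma eq_sqint f g : {in D, f =1 g} -> sqint f -> sqint g.
Proof.
move=> fg [mf f2]; split; first exact: eq_measurable_fun mf.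
by apply: eq_integrable f2 => // x xD; rewrite fg.
Qed.

Definition ipint f g : R := \int[mu]_(x in D) (f x * g x).

Lemma ipintC f g : ipint f g = ipint g f.
Proof. by apply: eq_Rintegral => x _; rewrite mulrC. Qed.

Lemma ipint_lin c f g h : sqint f -> sqint g -> sqint h ->
  ipint (fun x => c * f x + g x) h = c * ipint f h + ipint g h.
Proof.
move=> Lf Lg Lh; rewrite /ipint.
under eq_Rintegral do rewrite mulrDl -mulrA.
have fh := sqintM Lf Lh; have gh := sqintM Lg Lh.
rewrite RintegralD//; first by rewrite RintegralZl.
exact: (integrableZl mD c fh).
Qed.

Lemma ipint_ge0 f : 0 <= ipint f f.
Proof. by apply: Rintegral_ge0 => x _; rewrite -expr2 sqr_ge0. Qed.

Lemma ipint_pencil f g t : sqint f -> sqint g ->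
  ipint (fun x => f x + t * g x) (fun x => f x + t * g x) =
    ipint f f + 2 * t * ipint f g + t ^+ 2 * ipint g g.
Proof.
move=> Lf Lg; have Lfg : sqint (fun x => t * g x + f x) by exact: sqint_lin.
have -> : (fun x => f x + t * g x) = (fun x => t * g x + f x).
  by apply/funext => x; rewrite addrC.
rewrite ipint_lin// ![ipint _ (fun x => t * g x + f x)]ipintC !ipint_lin//.
by rewrite (ipintC g f); ring.
Qed.

Lemma ipint_eq0 f : sqint f -> ipint f f = 0 -> {ae mu, forall x, D x -> f x = 0}.
Proof.
move=> [mf f2] f0.
have m2 : measurable_fun D (EFin \o (fun x => f x ^+ 2)).
  by apply/measurable_EFinP; exact: measurable_funX.
have : (\int[mu]_(x in D) `|(f x ^+ 2)%:E| = 0)%E.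
  transitivity (\int[mu]_(x in D) (f x * f x)%:E)%E.
    by apply: eq_integral => x _; rewrite gee0_abs ?lee_fin ?sqr_ge0// expr2.
  rewrite -[LHS]fineK; first by rewrite -/(Rintegral _ _ _) -/(ipint _ _) f0.
  apply: integrable_fin_num => //; exact: (@sqintM f f).
move/(ae_eq_integral_abs mu mD m2); apply: filterS => x h Dx.
by have /= [/eqP] := h Dx; rewrite sqrf_eq0 => /eqP.
Qed.
End square_integrable.

(** * Measurability and null sets in spaces of row vectors *)

Section row_vector_measurability.
Variables (R : realType) (n : nat).
Local Notation pt := 'rV[R]_n.
Local Notation mu := (lebesgue_rV R n).
Implicit Types (S U : set pt) (f g : pt -> R).

Definition cube (c : pt) (r : R) : set pt := [set x | forall i, `|x 0 i - c 0 i| < r].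

Lemma measurable_cube c r : measurable (cube c r).
Proof.
rewrite [X in measurable X](_ : _ = \bigcap_(i in [set: 'I_n])
    ((fun x : pt => x 0 i : measurableTypeR R) @^-1` ball (c 0 i) r)); last first.
  apply/seteqP; split=> x /=.
    by move=> xc i _; rewrite /ball/= distrC; exact: xc.
  by move=> xc i; have := xc i I; rewrite /ball/= distrC.
apply: fin_bigcap_measurable => [|i _]; first exact: finite_finset.
rewrite -[X in measurable X]setTI; apply: measurable_coor => //.
exact: measurable_ball.
Qed.

(** The product sigma-algebra contains the open sets, as these are countable
    unions of cubes with rational data. *)
Lemma open_measurable_rV U : open U -> measurable U.
Proof.
move=> oU; pose F (p : 'rV[rat]_n * rat) : set pt := 
  let Q := cube (map_mx ratr p.1) (ratr p.2) in if `[< Q `<=` U >] then Q else set0.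
have -> : U = \bigcup_p F p.
  apply/seteqP; split=> [x Ux|x [p _]]; last first.
    by rewrite /F; case: asboolP => // QU /QU.
  have /nbhs_ballP[e /= e0 xe] : nbhs x U by exact: open_nbhs_nbhs.
  have /rat_in_itvoo[r] : e / 3 < e / 2 by lra.
  rewrite in_itv/= => /andP[r1 r2].
  have r0 : 0 < (ratr r : R) by rewrite (lt_trans _ r1)// divr_gt0.
  have qP i : exists q : rat, `|x 0 i - ratr q| < ratr r.
    have /rat_in_itvoo[q] : x 0 i - ratr r < x 0 i + ratr r by lra.
    by rewrite in_itv/= => qq; exists q; rewrite distrC ltr_distl.
  have [q qx] := choice qP.
  have mE i : (map_mx ratr (\row_i q i) : pt) 0 i = ratr (q i) by rewrite !mxE.
  exists (\row_i q i, r) => //; rewrite /F /=; case: asboolP => [_|].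
    by move=> i; rewrite mE; exact: qx.
  case=> y yq; apply: xe; split=> // k i; rewrite ord1 /ball/=.
  have := yq i; rewrite mE distrC => y1; have := qx i => x1.
  by rewrite (le_lt_trans (ler_distD (ratr (q i)) _ _))//; lra.
apply: countable_bigcupT_measurable => [|p]; first exact: countableP.
rewrite /F.
by case: asboolP => // _; exact: measurable_cube.
Qed.

Lemma closed_measurable_rV U : closed U -> measurable U.
Proof. by move=> /closed_openC/open_measurable_rV/measurableC; rewrite setCK. Qed.

Lemma within_continuous_measurable S f : measurable S ->
  {within S, continuous f} -> measurable_fun S f.
Proof.
move=> mS /continuousP cf; apply: (measurability _ (RGenOpens.measurableE R)).
move=> _ [_ [a [b ->] <-]]; have /cf : open `]a, b[%classic by exact: interval_open.
move=> /open_subspaceP [V oV VD]; rewrite setIC -VD.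
by apply: measurableI => //; exact: open_measurable_rV.
Qed.

Lemma continuous_measurable_rV S f : measurable S -> continuous f -> measurable_fun S f.
Proof.
by move=> mS cf; apply: within_continuous_measurable => //; exact: continuous_subspaceT.
Qed.

Lemma within_continuous_bounded S f : compact S -> {within S, continuous f} ->
  exists C, forall x, S x -> `|f x| <= C.
Proof.
move=> cS cf; have /compact_bounded[M [_ hM]] := continuous_compact cf cS.
by exists (M + 1) => x Sx; apply: (hM (M + 1)); [rewrite ltrDl|exists x].
Qed.

Lemma measurable_box (a b : 'I_n -> R) :
  measurable [set x : pt | forall i, a i <= x 0 i <= b i].
Proof.
rewrite [X in measurable X](_ : _ = \bigcap_(i in [set: 'I_n])
  ((fun x : pt => x 0 i : measurableTypeR R) @^-1` `[a i, b i]%classic)); last first.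
  apply/seteqP; split=> x /= h i; first by move=> _; rewrite /= in_itv/=.
  by have := h i I; rewrite /= in_itv.
apply: fin_bigcap_measurable => [|i _]; first exact: finite_finset.
by rewrite -[X in measurable X]setTI; exact: measurable_coor.
Qed.

Lemma bounded_measure_fin S : measurable S -> bounded_set S -> (mu S < +oo)%E.
Proof.
move=> mS [M [_ hM]]; pose N := `|M| + 1.
have SN : S `<=` [set x | forall i, - N <= x 0 i <= N].
  move=> x Sx i; rewrite -ler_norml.
  have MN : M < N by rewrite (le_lt_trans (ler_norm M))// ltrDl.
  apply: le_trans (hM _ MN _ Sx); rewrite [leRHS]/Num.norm /= mx_normrE.
  by apply/bigmax_geP; right => /=; exists (0, i).
have N0 (i : 'I_n) : (fun=> - N) i <= N by rewrite /N /=; have := normr_ge0 M; lra.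
apply: (@le_lt_trans _ _ _ _ _ _ (ltry (\prod_(i < n) (N - (- N))))).
rewrite -(lebesgue_rV_box N0); apply: le_measure; rewrite ?inE//.
exact: (measurable_box (fun=> - N) (fun=> N)).
Qed.

(** A nonempty open set contains a box with sides of positive length. *)
Lemma open_null_set0 U : open U -> mu U = 0%E -> U = set0.
Proof.
move=> oU U0; apply/seteqP; split=> // x Ux.
have /nbhs_ballP[e /= e0 xe] : nbhs x U by exact: open_nbhs_nbhs.
pose a i := x 0 i - e / 2; pose b i := x 0 i + e / 2.
have ab i : a i <= b i by rewrite /a /b; lra.
have BU : [set y : pt | forall i, a i <= y 0 i <= b i] `<=` U.
  move=> y yB; apply: xe; split=> // k i; rewrite ord1 /ball/= ltr_distlC.
  by have := yB i; rewrite /a /b => /andP[? ?]; apply/andP; split; lra.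
have mB := measurable_box a b; have mU := open_measurable_rV oU.
have : ((\prod_(i < n) (b i - a i))%:E <= 0)%E.
  by rewrite -(lebesgue_rV_box ab) -U0; apply: le_measure; rewrite ?inE.
rewrite lee_fin leNgt.
suff -> : 0 < \prod_(i < n) (b i - a i) by [].
by apply: prodr_gt0 => i _; rewrite /a /b; lra.
Qed.

Lemma bounded_closure_compact S : bounded_set S -> compact (closure S).
Proof.
move=> [M [Mr hM]]; apply: bounded_closed_compact; last exact: closed_closure.
exists M; split=> // N MN.
have cN : closed [set x : pt | `|x| <= N].
  by apply: (@closed_comp _ _ (@Num.norm R pt) [set y | y <= N]);
    [move=> x _; exact: norm_continuous|exact: closed_le].
by rewrite closureE; apply: smallest_sub => //; exact: hM.
Qed.
End row_vector_measurability.

(** * The energy space is a subspace *)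

Section sobolev_space.
Variables (R : realType) (n : nat).
Local Notation pt := 'rV[R]_n.+1.
Local Notation mu := (lebesgue_rV R n.+1).
Implicit Types (f g : pt -> R) (u v : sob R n).

Lemma sob_lin1 c u v : (c *: u + v).1 = (fun x => c * u.1 x + v.1 x).
Proof. by []. Qed.

Lemma sob_lin2 c u v : (c *: u + v).2 = (fun x => c *: u.2 x + v.2 x).
Proof. by []. Qed.

Lemma derivable_lin c f g x w : derivable f x w -> derivable g x w ->
  derivable (fun x => c * f x + g x) x w.
Proof. by move=> df dg; apply: derivableD => //; exact: derivableZ. Qed.

Lemma grad_lin c f g : (forall i x, derivable f x (delta_mx 0 i)) ->
  (forall i x, derivable g x (delta_mx 0 i)) ->
  grad (fun x => c * f x + g x) = (fun x => c *: grad f x + grad g x).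
Proof.
move=> df dg; apply/funext => x; apply/rowP => i; rewrite !mxE.
rewrite [LHS](@deriveD _ _ _ (fun x => c * f x) g)//; last exact: derivableZ.
by rewrite [X in X + _](@deriveZ _ _ _ f).
Qed.

Lemma continuous_lin c f g : continuous f -> continuous g ->
  continuous (fun x => c * f x + g x).
Proof.
move=> cf cg x.
exact: (continuousD (continuousM (@cst_continuous _ _ c x) (cf x)) (cg x)).
Qed.

Lemma Ck_lin c k f g : Ck k f -> Ck k g -> Ck k (fun x => c * f x + g x).
Proof.
elim: k f g => [|k IH] f g; move=> [cf df] [cg dg]; split; try exact: continuous_lin; first by [].
move=> i; split; first by move=> x; apply: derivable_lin; [case: (df i)|case: (dg i)].
rewrite grad_lin; [|by move=> j; case: (df j)|by move=> j; case: (dg j)].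
rewrite [X in Ck k X](_ : _ = fun x => c * grad f x 0 i + grad g x 0 i); last first.
  by apply/funext => x; rewrite !mxE.
by apply: IH; [case: (df i)|case: (dg i)].
Qed.

Lemma Ck0 k : Ck k (fun _ : pt => 0 : R).
Proof.
elim: k => [|k IH]; split=> //; try exact: cst_continuous.
move=> i; split; first by move=> x; exact: (derivable_cst (0 : R) x).
rewrite [X in Ck k X](_ : _ = (fun=> 0))//.
by apply/funext => x; rewrite !mxE derive_cst.
Qed.

Variable D : set pt.

Lemma test_lin c f g : test_function D f -> test_function D g ->
  test_function D (fun x => c * f x + g x).
Proof.
move=> [cf [S [cS SD fS]]] [cg [S' [cS' SD' gS]]]; split.
  by move=> k; exact: Ck_lin.
exists (S `|` S'); split; first exact: compactU.
  by move=> x [/SD|/SD'].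
by move=> x /not_orP[/fS -> /gS ->]; rewrite mulr0 addr0.
Qed.

Lemma test0 : test_function D (fun=> 0).
Proof.
split; first by move=> k; exact: Ck0.
exists set0; split=> //; exact: compact0.
Qed.

Lemma test_derivable f i x : test_function D f -> derivable f x (delta_mx 0 i).
Proof. by case=> /(_ 1%N)[_ /(_ i)[]]. Qed.

Lemma test_continuous f : test_function D f -> continuous f.
Proof. by case=> /(_ 0%N)[]. Qed.

Lemma test_grad_continuous f i : test_function D f -> continuous (fun x => grad f x 0 i).
Proof. by case=> /(_ 1%N)[_ /(_ i)[_ []]]. Qed.

Lemma test_grad_lin c f g : test_function D f -> test_function D g ->
  grad (fun x => c * f x + g x) = (fun x => c *: grad f x + grad g x).
Proof. by move=> tf tg; apply: grad_lin => i x; exact: test_derivable. Qed.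

Hypotheses (oD : open D) (bD : bounded_set D).

Let mD : measurable D := open_measurable_rV oD.
Let cD := bounded_closure_compact bD.

Lemma inL2_continuous f : {within closure D, continuous f} -> inL2 D f.
Proof.
move=> cf; have [C fC] := within_continuous_bounded cD cf.
apply: (@sqint_bounded _ _ _ mu D mD f C).
- by apply: bounded_measure_fin.
- apply: within_continuous_measurable => //.
  exact: (continuous_subspaceW (@subset_closure _ D)).
- by move=> x Dx; apply: fC; exact: subset_closure.
Qed.

Lemma inL2_test f : test_function D f -> inL2 D f.
Proof. by move=> /test_continuous cf; apply: inL2_continuous; exact: continuous_subspaceT. Qed.

Lemma inL2_test_grad f i : test_function D f -> inL2 D (fun x => grad f x 0 i).
Proof.
move=> tf; apply: inL2_continuous; apply: continuous_subspaceT.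
exact: test_grad_continuous.
Qed.

Definition form1 u v : R := ip0 D u.1 v.1 +
  \sum_i ip0 D (fun x => u.2 x 0 i) (fun x => v.2 x 0 i).

Definition L2sob : set (sob R n) :=
  [set u : sob R n | inL2 D u.1 /\ forall i, inL2 D (fun x => u.2 x 0 i)].

Lemma norm1E u : norm1 D u = snorm form1 u.
Proof.
rewrite /norm1 /snorm /form1 /norm0 sqr_sqrtr; last exact: ipint_ge0.
by congr (Num.sqrt (_ + _)); apply: eq_bigr => i _; rewrite sqr_sqrtr//; exact: ipint_ge0.
Qed.

Lemma L2sob_lin c u v : L2sob u -> L2sob v -> L2sob (c *: u + v).
Proof.
move=> [u1 u2] [v1 v2]; split; first exact: sqint_lin.
move=> i; have -> : (fun x => (c *: u + v).2 x 0 i) =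
    (fun x => c * u.2 x 0 i + v.2 x 0 i) by apply/funext => x; rewrite !mxE.
exact: (sqint_lin mD c (u2 i) (v2 i)).
Qed.

Lemma L2sob0 : L2sob 0.
Proof.
split; first exact: sqint0.
move=> i; have -> : (fun x => (0 : sob R n).2 x 0 i) = (fun=> 0) by apply/funext => x; rewrite mxE.
exact: sqint0.
Qed.

Lemma form1_semi_inner : semi_inner L2sob form1.
Proof.
split; [exact: L2sob0|exact: L2sob_lin| | |].
- move=> u v _ _; congr (_ + _); first exact: ipintC.
  by apply: eq_bigr => i _; exact: ipintC.
- move=> c u v w [u1 u2] [v1 v2] [w1 w2]; rewrite /form1 mulrDr mulr_sumr addrACA -big_split/=.
  congr (_ + _); first exact: (ipint_lin mD c u1 v1 w1).
  apply: eq_bigr => i _; rewrite -[RHS](ipint_lin mD c (u2 i) (v2 i) (w2 i)).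
  by apply: eq_Rintegral => x _; rewrite !mxE.
- move=> u _; rewrite addr_ge0//; first exact: ipint_ge0.
  by apply: sumr_ge0 => i _; exact: ipint_ge0.
Qed.

Lemma H10_L2sob u : H10 D u -> L2sob u.
Proof. by case=> -[]. Qed.

Lemma L2sob_test f : test_function D f -> L2sob (f, grad f).
Proof. by move=> tf; split=> [|i]; [exact: inL2_test|exact: inL2_test_grad]. Qed.

(** Approximability by test functions passes to linear combinations through the
    triangle inequality in [L2sob], which contains the differences with test
    functions. *)
Lemma H10_lin c u v : H10 D u -> H10 D v -> H10 D (c *: u + v).
Proof.
move=> Vu Vv; have Lu := H10_L2sob Vu; have Lv := H10_L2sob Vv.
case: Vu => -[u1 u2 wu] au; case: Vv => -[v1 v2 wv] av.
have [Luv1 Luv2] := L2sob_lin c Lu Lv.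
split; first split => // f tf i.
  have tfL := inL2_test tf; have tgL := inL2_test_grad i tf.
  have := @ipint_lin _ _ _ mu D mD c u.1 v.1 (fun x => grad f x 0 i) u1 v1 tgL.
  rewrite /ipint /= => ->; rewrite wu// wv// mulrN -opprD; congr (- _).
  have := @ipint_lin _ _ _ mu D mD c _ _ f (u2 i) (v2 i) tfL.
  by rewrite /ipint /= => <-; apply: eq_Rintegral => x _; rewrite !mxE.
move=> e e0; have c0 : 0 < 1 + `|c| by rewrite ltr_pwDl.
have [f tf uf] := au (e / 2 / (1 + `|c|)) (divr_gt0 (divr_gt0 e0 (ltr0n _ 2)) c0).
have [g tg vg] := av (e / 2) (divr_gt0 e0 (ltr0n _ 2)).
exists (fun x => c * f x + g x); first exact: test_lin.
rewrite norm1E in uf; rewrite norm1E in vg; rewrite norm1E.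
have -> : c *: u + v - (fun x => c * f x + g x, grad (fun x => c * f x + g x)) =
    c *: (u - (f, grad f)) + (v - (g, grad g)).
  rewrite test_grad_lin// scalerBr addrACA -opprD; congr (_ - _).
have Lf := memB form1_semi_inner Lu (L2sob_test tf).
have Lg := memB form1_semi_inner Lv (L2sob_test tg).
apply: le_lt_trans (snormD form1_semi_inner (memZ form1_semi_inner c Lf) Lg) _.
rewrite (snormZ form1_semi_inner)//.
have : `|c| * snorm form1 (u - (f, grad f)) <= e / 2.
  apply: (@le_trans _ _ (`|c| * (e / 2 / (1 + `|c|)))).
    by rewrite ler_wpM2l// ltW.
  by rewrite mulrCA -[leRHS]mulr1 ler_wpM2l ?divr_ge0 ?(ltW e0)// ler_pdivrMr// mul1r lerDr.
by move=> h; rewrite [ltRHS]splitr; exact: ler_ltD.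
Qed.

Lemma H100 : H10 D 0.
Proof.
have [L1 L2] := L2sob0; split; first split=> //.
  move=> f _ i; rewrite (@eq_Rintegral _ _ _ _ _ (fun=> 0)).
    rewrite [X in _ = - X](@eq_Rintegral _ _ _ _ _ (fun=> 0)).
      by rewrite Rintegral_cst// mul0r oppr0.
    by move=> x _; rewrite mxE mul0r.
  by move=> x _; rewrite mul0r.
move=> e e0; exists (fun=> 0); first exact: test0.
rewrite norm1E (_ : 0 - _ = 0) ?(snorm0 form1_semi_inner)//.
rewrite (_ : (fun=> 0, _) = 0) ?subrr//; congr pair.
by apply/funext => x; apply/rowP => i; rewrite !mxE derive_cst.
Qed.

End sobolev_space.

(** * The energy form *)

Lemma Rintegral_ae_ge0 d (T : measurableType d) (R : realType)
    (mu : {measure set T -> \bar R}) (D : set T) (f : T -> R) :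
  measurable D -> mu.-integrable D (EFin \o f) ->
  {ae mu, forall x, D x -> 0 <= f x} -> 0 <= \int[mu]_(x in D) f x.
Proof.
move=> mD fi f0; rewrite /Rintegral.
have -> : (\int[mu]_(x in D) (f x)%:E = \int[mu]_(x in D) `|(f x)%:E|)%E.
  apply: ae_eq_integral => //.
  - by case/integrableP: fi.
  - by case/integrableP: fi => mf _; apply: measurableT_comp.
  - by apply: filterS f0 => x h Dx; rewrite gee0_abs// lee_fin h.
by rewrite fine_ge0// integral_ge0.
Qed.

Section energy_form.
Variables (R : realType) (n : nat) (pb : problem R n).
Local Notation pt := 'rV[R]_n.+1.
Local Notation mu := (lebesgue_rV R n.+1).
Local Notation D := (dom pb).
Local Notation A := (coefA pb).
Local Notation phi := (coefphi pb).
Local Notation V := (H10 D).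
Hypothesis vp : valid_problem pb.
Implicit Types (f g : pt -> R) (u v w : sob R n).

Lemma dom_open : open D. Proof. by case: vp => -[]. Qed.
Lemma dom_bounded : bounded_set D. Proof. by case: vp => -[]. Qed.
Lemma dom_measurable : measurable D. Proof. exact: open_measurable_rV dom_open. Qed.
Let mD := dom_measurable.

Lemma inL2_Linf h f : inLinf D h -> inL2 D f -> inL2 D (fun x => h x * f x).
Proof. by move=> [mh [C hC]] Lf; exact: (sqint_ess_bounded mD mh hC Lf). Qed.

Lemma fluxE x (g : pt) k : flux pb x g 0 k = \sum_j A x k j * g 0 j.
Proof. by rewrite mxE; apply: eq_bigr => j _; rewrite mxE mulrC. Qed.

Lemma Linf_A i j : inLinf D (fun x => A x i j).
Proof. by case: vp => _ _ /(_ i j)[]. Qed.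

Lemma Linf_phi : inLinf D phi. Proof. by case: vp => _ _ _ []. Qed.

Lemma inL2_flux (G : pt -> pt) k : (forall i, inL2 D (fun x => G x 0 i)) ->
  inL2 D (fun x => flux pb x (G x) 0 k).
Proof.
move=> LG; have := sqint_sum mD (index_enum 'I_n.+1)
  (fun j => inL2_Linf (Linf_A k j) (LG j)).
by apply: eq_sqint => // x _; rewrite fluxE.
Qed.

Definition energy_density u v (x : pt) : R :=
  dot (flux pb x (u.2 x)) (v.2 x) + phi x * u.1 x * v.1 x.

Lemma energy_integrable u v : L2sob D u -> L2sob D v ->
  mu.-integrable D (EFin \o energy_density u v).
Proof.
move=> [u1 u2] [v1 v2].
have -> : EFin \o energy_density u v = (fun x =>
    \sum_i (flux pb x (u.2 x) 0 i * v.2 x 0 i)%:E + ((phi x * u.1 x) * v.1 x)%:E)%E.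
  by apply/funext => x; rewrite /energy_density /= EFinD sumEFin.
apply: integrableD => //.
  apply: integrable_sum => // i _.
  exact: (sqintM mD (inL2_flux i u2) (v2 i)).
exact: (sqintM mD (inL2_Linf Linf_phi u1) v1).
Qed.

Lemma form_a_lin c u v w : L2sob D u -> L2sob D v -> L2sob D w ->
  form_a pb (c *: u + v) w = c * form_a pb u w + form_a pb v w.
Proof.
move=> Lu Lv Lw; have uw := energy_integrable Lu Lw; have vw := energy_integrable Lv Lw.
have cuw := integrableZl mD c uw.
rewrite -RintegralZl// -RintegralD//; apply: eq_Rintegral => x _.
rewrite /energy_density /dot sob_lin1 sob_lin2 [X in _ = X + _]mulrDr
  [in RHS]mulr_sumr [RHS]addrACA -big_split/=; congr (_ + _); last by ring.
apply: eq_bigr => i _; rewrite !fluxE mulrA -mulrDl mulr_sumr -big_split/=; congr (_ * _).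
by apply: eq_bigr => j _; rewrite !mxE; ring.
Qed.

Lemma form_a_sym u v : form_a pb u v = form_a pb v u.
Proof.
apply: eq_Rintegral => x; rewrite inE => Dx; case: vp => _ /(_ x Dx)[AT _] _ _ _.
rewrite mulrAC; congr (_ + _); rewrite /dot.
under eq_bigr do rewrite fluxE mulr_suml.
under [RHS]eq_bigr do rewrite fluxE mulr_suml.
rewrite exchange_big/=; apply: eq_bigr => i _; apply: eq_bigr => j _.
by rewrite -{1}AT mxE; ring.
Qed.

Lemma form_a_ge0 u : L2sob D u -> 0 <= form_a pb u u.
Proof.
move=> Lu; case: (vp) => _ Apos _ [_ phi0] _.
apply: Rintegral_ae_ge0 => //; first exact: energy_integrable.
apply: filterS phi0 => x h Dx; rewrite addr_ge0//; last first.
  by rewrite -mulrA -expr2 mulr_ge0 ?sqr_ge0 ?h.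
have [AT pos] := Apos x Dx; have [->|u0] := eqVneq (u.2 x) 0.
  by rewrite /dot sumr_ge0// => i _; rewrite [X in _ * X]mxE mulr0.
by rewrite /flux AT; exact/ltW/pos.
Qed.

Lemma form_a_semi_inner : semi_inner V (form_a pb).
Proof.
have sub := @H10_L2sob R n D; split.
- exact: H100 dom_open.
- by move=> c u v; apply: H10_lin; [exact: dom_open|exact: dom_bounded].
- by move=> u v _ _; exact: form_a_sym.
- by move=> c u v w /sub Lu /sub Lv /sub Lw; exact: form_a_lin.
- by move=> u /sub; exact: form_a_ge0.
Qed.

Definition form_0 u v : R := ip0 D u.1 v.1.

Lemma form_0_semi_inner : semi_inner V form_0.
Proof.
have [V0 VP _ _ _] := form_a_semi_inner; split=> //.
- by move=> u v _ _; exact: ipintC.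
- by move=> c u v w [[u1 _ _] _] [[v1 _ _] _] [[w1 _ _] _]; exact: (ipint_lin mD c u1 v1 w1).
- by move=> u _; exact: ipint_ge0.
Qed.

Lemma norm0_le_norm1 u : norm0 D u.1 <= norm1 D u.
Proof.
rewrite /norm1 -[leLHS]ger0_norm ?sqrtr_ge0// -sqrtr_sqr ler_wsqrtr// lerDl.
by apply: sumr_ge0 => i _; rewrite sqr_ge0.
Qed.

End energy_form.

(** * Polynomial functions *)

Section polynomial_functions.
Variables (R : realType) (n : nat).
Local Notation pt := 'rV[R]_n.
Local Notation poly := (mpoly.mpoly n R).
Implicit Types (p q : poly) (x v : pt).

(** Evaluation, restriction to a line and differentiation have rules for sums and
    products, so that identities between them reduce to constants and variables. *)
Lemma mpoly_ring_ind (Q : poly -> Prop) :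
  (forall c, Q (mpoly.mpolyC n c)) -> (forall i, Q (mpoly.mpolyX R (mpoly.mnm1 i))) ->
  (forall p q, Q p -> Q q -> Q (p + q)) -> (forall p q, Q p -> Q q -> Q (p * q)) ->
  forall p, Q p.
Proof.
move=> QC QX QD QM; elim/mpoly.mpolyind => [|c m p _ _ Qp].
  by rewrite -mpoly.mpolyC0; exact: QC.
apply: (QD _ _ _ Qp); rewrite -mpoly.mul_mpolyC; apply: (QM) => [|]; first exact: QC.
rewrite mpoly.mpolyXE_id; apply: (big_ind Q) => [|p1 p2|i _].
- by rewrite -mpoly.mpolyC1; exact: QC.
- exact: QM.
set k := (X in _ ^+ X); elim: k => [|k IH]; first by rewrite expr0 -mpoly.mpolyC1; exact: QC.
by rewrite exprS; apply: (QM).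
Qed.

Lemma pevalD p q x : peval (p + q) x = peval p x + peval q x.
Proof. exact: mpoly.mevalD. Qed.

Lemma pevalZ c p x : peval (c *: p) x = c * peval p x.
Proof. exact: mpoly.mevalZ. Qed.

Lemma pevalM p q x : peval (p * q) x = peval p x * peval q x.
Proof. exact: mpoly.mevalM. Qed.

Lemma pevalC c x : peval (mpoly.mpolyC n c) x = c.
Proof. exact: mpoly.mevalC. Qed.

Lemma pevalX i x : peval (mpoly.mpolyX R (mpoly.mnm1 i)) x = x 0 i.
Proof. exact: mpoly.mevalXU. Qed.

Lemma peval_continuous p : continuous (peval p).
Proof.
elim/mpoly_ring_ind: p => [c|i|p q cp cq|p q cp cq] x.
- by rewrite (_ : peval _ = cst c) ?cst_continuous//;
    [exact: cst_continuous|apply/funext => y; rewrite pevalC].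
- rewrite (_ : peval _ = fun y : pt => y 0 i); first exact: coord_continuous.
  by apply/funext => y; rewrite pevalX.
- rewrite (_ : peval _ = peval p + peval q); last by apply/funext => y; rewrite pevalD.
  exact: continuousD (cp x) (cq x).
- rewrite (_ : peval _ = fun y => peval p y * peval q y); last first.
    by apply/funext => y; rewrite pevalM.
  exact: continuousM (cp x) (cq x).
Qed.

(** The restriction of a polynomial to the line through [x] of direction [v]. *)
Definition line_poly p x v : {poly R} :=
  mpoly.mmap (@polyC R) (fun j => (x 0 j)%:P + v 0 j *: 'X) p.

Lemma line_polyE p x v t : (line_poly p x v).[t] = peval p (x + t *: v).
Proof.
rewrite /line_poly; elim/mpoly_ring_ind: p => [c|i|p q hp hq|p q hp hq].
- by rewrite mpoly.mmapC hornerC pevalC.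
- by rewrite mpoly.mmapX mpoly.mmap1U pevalX !hornerE !mxE mulrC.
- by rewrite rmorphD hornerD hp hq pevalD.
- by rewrite rmorphM hornerM hp hq pevalM.
Qed.

Lemma line_poly_deriv p x i t :
  (line_poly p x (delta_mx 0 i))^`().[t] = peval (mpoly.mderiv i p) (x + t *: delta_mx 0 i).
Proof.
elim/mpoly_ring_ind: p => [c|j|p q hp hq|p q hp hq].
- by rewrite /line_poly mpoly.mmapC derivC horner0 mpoly.mderivC -mpoly.mpolyC0 pevalC.
- rewrite /line_poly mpoly.mmapX mpoly.mmap1U derivD derivC add0r derivZ derivX.
  rewrite mpoly.mderivX pevalZ hornerZ hornerC mxE eqxx/= mpoly.mnm1E.
  have [->|ij] := eqVneq j i; last by rewrite !mul0r.
  have -> : mpoly.mpolyX R (mpoly.mnm_sub (mpoly.mnm1 i) (mpoly.mnm1 i)) =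
      mpoly.mpolyC n 1.
    rewrite mpoly.mpolyC1 -[RHS]mpoly.mpolyX0; congr mpoly.mpolyX.
    by apply/mpoly.mnmP => k; rewrite mpoly.mnmBE subnn mpoly.mnm0E.
  by rewrite pevalC ?eqxx ?mulr1.
- by rewrite /line_poly rmorphD derivD hornerD hp hq linearD pevalD.
- rewrite /line_poly rmorphM derivM hornerD !hornerM hp hq mpoly.mderivM pevalD !pevalM.
  by rewrite !(line_polyE _ x).
Qed.

(** The restriction to every line through [c] has infinitely many roots. *)
Lemma peval_eq0 p (S : set pt) c : (forall v,
    exists2 r, 0 < r & forall t, 0 <= t <= r -> S (c + t *: v)) ->
  (forall x, S x -> peval p x = 0) -> forall x, peval p x = 0.
Proof.
move=> Sc p0 x; have [r r0 rS] := Sc (x - c).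
have : line_poly p c (x - c) = 0.
  apply/eqP; apply: contraT => l0.
  pose N := size (line_poly p c (x - c)).
  have := max_poly_roots l0 (rs := [seq r / k.+1%:R | k <- iota 0 N]).
  rewrite size_map size_iota ltnn; apply.
    apply/allP => _ /mapP[k _ ->]; apply/rootP; rewrite line_polyE p0//; apply: rS.
    by rewrite divr_ge0 ?(ltW r0)//= ler_piMr ?(ltW r0)// invf_le1// ler1n.
  rewrite map_inj_uniq ?iota_uniq// => i j /(mulfI (lt0r_neq0 r0))/invr_inj/eqP.
  by rewrite eqr_nat => /eqP[].
move=> l0; have := line_polyE p c (x - c) 1.
by rewrite l0 horner0 scale1r addrC subrK.
Qed.

(** The formal derivative is that of the restriction to a coordinate line, which is
    the zero polynomial because it has infinitely many roots. *)
Lemma peval_deriv_eq0 p i : (forall x, peval p x = 0) ->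
  forall x, peval (mpoly.mderiv i p) x = 0.
Proof.
move=> p0 x; have := line_poly_deriv p x i 0; rewrite scale0r addr0 => <-.
suff -> : line_poly p x (delta_mx 0 i) = 0 by rewrite deriv0 horner0.
apply/eqP; apply: contraT => l0.
pose N := size (line_poly p x (delta_mx 0 i)).
have := max_poly_roots l0 (rs := [seq k%:R | k <- iota 0 N]).
rewrite size_map size_iota ltnn; apply.
  by apply/allP => t _; apply/rootP; rewrite line_polyE p0.
by rewrite map_inj_uniq ?iota_uniq// => j k /eqP; rewrite eqr_nat => /eqP.
Qed.
End polynomial_functions.

(** * Simplices *)

Lemma continuous_sum (R : numFieldType) (T : topologicalType) (W : normedModType R)
    (I : Type) (s : seq I) (F : I -> T -> W) :
  (forall i, continuous (F i)) -> continuous (fun x => \sum_(i <- s) F i x).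
Proof.
move=> cF; elim: s => [|i s IH] x.
  by under eq_fun do rewrite big_nil; exact: cst_continuous.
under eq_fun do rewrite big_cons.
exact: (continuousD (cF i x) (IH x)).
Qed.

Section simplices.
Variables (R : realType) (n : nat).
Local Notation pt := 'rV[R]_n.+1.
Implicit Types (T : element R n) (x v : pt).

(** Merges the coefficients of a convex combination that repeats vertices. *)
Lemma sum_delta k p (f : 'I_p -> 'I_k) (l : 'I_p -> R) (W : lmodType R) (z : 'I_k -> W) :
  \sum_i (\sum_(j | f j == i) l j) *: z i = \sum_j l j *: z (f j).
Proof.
under eq_bigr do rewrite scaler_suml.
rewrite (exchange_big_dep predT)//=; apply: eq_bigr => j _.
by rewrite (big_pred1 (f j)).
Qed.

Lemma carrierP T x : carrier T x <-> exists l : 'I_n.+2 -> R,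
  [/\ forall i, 0 <= l i, \sum_i l i = 1 & x = \sum_i l i *: T.1 i].
Proof.
split=> [[p [z [l [Sz l0 l1 ->]]]]|[l [l0 l1 ->]]]; last first.
  by exists n.+2, T.1, l; split=> // i; exists i.
have /choice[f fz] : forall i, exists j, T.1 j = z i by move=> i; have [j _ <-] := Sz i; exists j.
exists (fun i => \sum_(j | f j == i) l j); split.
- by move=> i; apply: sumr_ge0.
- have := @sum_delta _ _ f l R^o (fun=> 1).
  by under eq_bigr do rewrite [_ *: _]mulr1; move=> ->; under eq_bigr do rewrite [_ *: _]mulr1.
- by rewrite sum_delta; apply: eq_bigr => j _; rewrite fz.
Qed.

Lemma unit_simplex_compact k : compact [set l : 'rV[R]_k |
  (forall i, 0 <= l 0 i) /\ \sum_i l 0 i = 1].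
Proof.
apply: (@subclosed_compact _ _ [set l : 'rV[R]_k | forall i, `[0, 1]%classic (l 0 i)]).
- rewrite (_ : mkset _ =
      \bigcap_(i in [set: 'I_k]) ((fun l : 'rV[R]_k => l 0 i) @^-1` [set y | 0 <= y])
    `&` ((fun l : 'rV[R]_k => \sum_i l 0 i) @^-1` [set 1])); last first.
    apply/seteqP; split=> l [l0 l1]; split=> //.
      by move=> i _; exact: l0.
    by move=> i; exact: (l0 i).
  apply: closedI.
    apply: closed_bigI => i _; apply: closed_comp; last exact: closed_ge.
    by move=> l _; exact: coord_continuous.
  apply: closed_comp; last exact: closed_eq.
  by move=> l _; apply: (@continuous_sum R _ R^o) => i; exact: coord_continuous.
- exact: (@rV_compact R k (fun=> `[0, 1]%classic) (fun=> @segment_compact R 0 1)).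
- move=> l [l0 l1] i; rewrite /= in_itv/= l0 -l1 (bigD1 i)//= lerDl.
  by apply: sumr_ge0 => j _.
Qed.

Lemma carrier_compact T : compact (carrier T).
Proof.
have -> : carrier T = (fun l : 'rV[R]_n.+2 => \sum_i l 0 i *: T.1 i) @`
    [set l : 'rV[R]_n.+2 | (forall i, 0 <= l 0 i) /\ \sum_i l 0 i = 1].
  apply/seteqP; split=> [x /carrierP[l [l0 l1 ->]]|_ [l [l0 l1] <-]].
    exists (\row_i l i); last by apply: eq_bigr => i _; rewrite mxE.
    by split=> [i|]; [rewrite mxE|rewrite -l1; apply: eq_bigr => i _; rewrite mxE].
  by apply/carrierP; exists (l 0).
apply: continuous_compact; last exact: unit_simplex_compact.
apply: continuous_subspaceT; apply: continuous_sum => i l.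
by apply: (@continuousZr_tmp _ _ _ (fun l : 'rV[R]_n.+2 => l 0 i)); exact: coord_continuous.
Qed.

Lemma carrier_closed T : closed (carrier T).
Proof. by apply: compact_closed; [exact: norm_hausdorff|exact: carrier_compact]. Qed.

(** The barycentre is an interior point: every direction has coordinates of sum
    zero with respect to the vertices, and a small multiple of them leaves the
    barycentric coordinates nonnegative. *)
Lemma nondegenerate_lines T : Defs.nondegenerate T -> exists c, forall v,
  exists2 r, 0 < r & forall t, 0 <= t <= r -> carrier T (c + t *: v).
Proof.
(* The rows of [B] are the vertices in homogeneous coordinates, so that
   multiplication by [B] yields the sum of the coefficients together with the
   combination of the vertices. *)
move=> nT; pose B : 'M[R]_n.+2 := \matrix_i (row_mx 1 (T.1 i) : 'rV[R]_(1 + n.+1)).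
have mulB (l : 'rV[R]_n.+2) : l *m B =
    (row_mx (\sum_i l 0 i)%:M (\sum_i l 0 i *: T.1 i) : 'rV[R]_(1 + n.+1)).
  rewrite mulmx_sum_row.
  have -> : (\sum_i l 0 i)%:M = \sum_i l 0 i *: (1 : 'M[R]_1).
    by rewrite raddf_sum; apply: eq_bigr => i _; rewrite scalemx1.
  have rs (I : Type) (s : seq I) (F : I -> 'M[R]_1) (G : I -> pt) :
      row_mx (\sum_(i <- s) F i) (\sum_(i <- s) G i) = \sum_(i <- s) row_mx (F i) (G i).
    elim: s => [|i s IH]; first by rewrite !big_nil row_mx0.
    by rewrite !big_cons -IH add_row_mx.
  by rewrite rs; apply: eq_bigr => i _; rewrite rowK;
    apply/rowP => k; rewrite !mxE; case: splitP => j _; rewrite !mxE.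
have Bunit : B \in unitmx.
  rewrite -row_free_unit; apply: inj_row_free => l.
  rewrite mulB => l0.
  have l2 : \sum_i l 0 i *: T.1 i = 0.
    by have := congr1 (@rsubmx R 1 1 n.+1) l0; rewrite row_mxKr linear0.
  have l1 : ((\sum_i l 0 i)%:M : 'M[R]_1) = 0.
    by have := congr1 (@lsubmx R 1 1 n.+1) l0; rewrite row_mxKl linear0.
  apply/rowP => i; rewrite mxE; apply: (nT (l 0)) => //.
  by have := congr1 (fun M : 'M[R]_1 => M 0 0) l1; rewrite !mxE eqxx.
exists (\sum_i (n.+2%:R^-1) *: T.1 i) => v.
pose mu : 'rV[R]_n.+2 := (row_mx 0 v : 'rV[R]_(1 + n.+1)) *m invmx B.
have : mu *m B = (row_mx 0 v : 'rV[R]_(1 + n.+1)) by rewrite mulmxKV.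
rewrite mulB => h.
have muv : \sum_i mu 0 i *: T.1 i = v.
  by have := congr1 (@rsubmx R 1 1 n.+1) h; rewrite !row_mxKr.
have mu0 : ((\sum_i mu 0 i)%:M : 'M[R]_1) = 0.
  by have := congr1 (@lsubmx R 1 1 n.+1) h; rewrite !row_mxKl.
have {}mu0 : \sum_i mu 0 i = 0 by have := congr1 (fun M : 'M[R]_1 => M 0 0) mu0; rewrite !mxE eqxx.
have N0 : (0 : R) < n.+2%:R^-1 by rewrite invr_gt0.
have s0 : 0 < 1 + \sum_i `|mu 0 i| by rewrite ltr_pwDl// sumr_ge0.
exists (n.+2%:R^-1 / (1 + \sum_i `|mu 0 i|)); first by rewrite divr_gt0.
move=> t /andP[t0 tr]; apply/carrierP; exists (fun i => n.+2%:R^-1 + t * mu 0 i); split.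
- move=> i.
  have : t * `|mu 0 i| <= n.+2%:R^-1.
    apply: le_trans (_ : t * (1 + \sum_i `|mu 0 i|) <= _); last by rewrite -ler_pdivlMr.
    rewrite ler_wpM2l// (bigD1 i)//= addrCA lerDl addr_ge0// sumr_ge0// => j _.
  have : - (t * mu 0 i) <= t * `|mu 0 i|.
    by rewrite -mulrN ler_wpM2l// -normrN ler_norm.
  move=> /= h1 h2; rewrite -[t * _]opprK subr_ge0; exact: le_trans h2.
- rewrite big_split/= -mulr_sumr mu0 mulr0 addr0 sumr_const card_ord -[LHS]mulr_natr mulVf//.
- rewrite -muv scaler_sumr -big_split/=; apply: eq_bigr => i _.
  by rewrite scalerDl scalerA.
Qed.

End simplices.

(** * Finite element functions *)

Section finite_elements.
Variables (R : realType) (n : nat) (pb : problem R n) (m : nat).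
Local Notation pt := 'rV[R]_n.+1.
Local Notation mu := (lebesgue_rV R n.+1).
Local Notation D := (dom pb).
Local Notation A := (coefA pb).
Local Notation phi := (coefphi pb).
Local Notation V := (H10 D).
Hypothesis vp : valid_problem pb.
Implicit Types (f g : pt -> R) (u v w : sob R n) (T : element R n) (M : mesh R n).
Local Notation fe := (fe_space pb m).

Let mD := dom_measurable vp.
Let oD := dom_open vp.
Let bD := dom_bounded vp.

Lemma fe_H10 M : fe M `<=` V. Proof. by move=> v []. Qed.

Lemma fe0 M : fe M 0.
Proof.
split=> //; first exact: H100.
- by apply: continuous_subspaceT => x; exact: cst_continuous.
- by move=> T _; exists 0; [rewrite mpoly.msize0|move=> x _; rewrite -mpoly.mpolyC0 pevalC].
Qed.

Lemma fe_lin M c u v : fe M u -> fe M v -> fe M (c *: u + v).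
Proof.
move=> [Vu cu bu pu] [Vv cv bv pv]; split.
- exact: H10_lin.
- move=> x; rewrite sob_lin1.
  exact: (continuousD (continuousM (@cst_continuous _ _ c x) (cu x)) (cv x)).
- by move=> x xb; rewrite sob_lin1 bu// bv// mulr0 addr0.
- move=> T TM; have [p p1 p2] := pu T TM; have [q q1 q2] := pv T TM.
  exists (c *: p + q); last by move=> x Tx; rewrite sob_lin1 pevalD pevalZ p2// q2.
  apply: leq_trans (mpoly.msizeD_le _ _) _; rewrite geq_max q1 andbT.
  exact: leq_trans (mpoly.msizeZ_le _ _) p1.
Qed.

Lemma fe_nested M M' : nested M M' -> fe M `<=` fe M'.
Proof.
move=> MM' v [Vv cv bv pv]; split=> // T' /MM'[T TM T'T].
by have [p p1 p2] := pv T TM; exists p => // x /T'T; exact: p2.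
Qed.

(** A continuous function that vanishes almost everywhere in an open set
    vanishes there; this is what makes finite element functions, unlike general
    elements of the energy space, determined pointwise by their class. *)
Lemma fe_null M v : fe M v -> norm0 D v.1 = 0 -> forall x, closure D x -> v.1 x = 0.
Proof.
move=> [[[v1 _ _] _] cv bv _] v0 x cx; have [Dx|nDx] := pselect (D x); last exact: bv.
have {}v0 : ip0 D v.1 v.1 = 0.
  apply/eqP; have := v0; rewrite /norm0 => /eqP; rewrite sqrtr_eq0 => h.
  by rewrite eq_le h; exact: ipint_ge0.
have [N [mN N0 vN]] := ipint_eq0 mD v1 v0.
apply: contrapT => /eqP vx0.
have : {within D, continuous v.1} by exact: continuous_subspaceW (@subset_closure _ D) cv.
rewrite continuous_open_subspace// => cvD.
have oU : open (D `&` v.1 @^-1` [set y | y != 0]).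
  rewrite openE => y [Dy vy]; apply: filterI; first exact: open_nbhs_nbhs.
  apply: (cvD y _) => //; first by rewrite inE.
  by apply: open_nbhs_nbhs; split=> //; exact: open_neq.
have U0 : mu (D `&` v.1 @^-1` [set y | y != 0]) = 0%E.
  apply/eqP; rewrite eq_le measure_ge0 andbT -N0 le_measure ?inE//.
    exact: open_measurable_rV.
  by move=> y [Dy /eqP vy]; apply: vN => /(_ Dy).
have : (D `&` v.1 @^-1` [set y | y != 0]) x by [].
by rewrite (open_null_set0 oU U0).
Qed.

Definition polynomial_on T (f : pt -> R) :=
  exists p : mpoly.mpoly n.+1 R, forall x, carrier T x -> f x = peval p x.

Lemma fe_polynomial_on M T v : fe M v -> T \in M -> polynomial_on T v.1.
Proof. by case=> _ _ _ pv /pv[p _ hp]; exists p. Qed.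

Lemma pieceP T f : polynomial_on T f -> forall x, carrier T x -> f x = peval (piece T f) x.
Proof. by case=> p hp; rewrite /piece; case: xgetP => [q _ //|/(_ p)]. Qed.

Lemma eq_piece T f g : (forall x, carrier T x -> f x = g x) -> piece T f = piece T g.
Proof.
move=> fg; congr (xget _ _); apply/seteqP; split=> p /= h x Tx; rewrite -h//.
  by rewrite fg.
by rewrite fg.
Qed.

(** The polynomial [piece T f] is merely some polynomial with the values of [f] on
    [T]; its derivatives are determined by [f], hence linear in [f], because a
    polynomial that vanishes on a nondegenerate simplex has zero derivatives. *)
Lemma piece_deriv_lin T c f g h (i j : 'I_n.+1) :
  Defs.nondegenerate T -> polynomial_on T f -> polynomial_on T g ->
  (forall x, h x = c * f x + g x) ->
  (forall x, peval (mpoly.mderiv i (piece T h)) x =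
    c * peval (mpoly.mderiv i (piece T f)) x + peval (mpoly.mderiv i (piece T g)) x) /\
  (forall x, peval (mpoly.mderiv i (mpoly.mderiv j (piece T h))) x =
    c * peval (mpoly.mderiv i (mpoly.mderiv j (piece T f))) x +
    peval (mpoly.mderiv i (mpoly.mderiv j (piece T g))) x).
Proof.
move=> /nondegenerate_lines[x0 hx0] pf pg hE.
have ph : polynomial_on T h.
  case: pf pg => p hp [q hq]; exists (c *: p + q) => x Tx.
  by rewrite hE pevalD pevalZ hp// hq.
pose r := (c *: piece T f + piece T g) + (-1) *: piece T h.
have r0 : forall x, peval r x = 0.
  apply: (peval_eq0 hx0) => x Tx.
  by rewrite !pevalD !pevalZ -!pieceP// mulN1r hE subrr.
have d0 k := peval_deriv_eq0 k r0; have d1 := peval_deriv_eq0 i (d0 j).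
split=> x; [have := d0 i x|have := d1 x]; rewrite /r !mpoly.mderivD
    !mpoly.mderivZ ?mpoly.mderivD ?mpoly.mderivZ;
  rewrite !pevalD !pevalZ mulN1r => /eqP; rewrite subr_eq0 => /eqP <-//.
Qed.
End finite_elements.

(** * The squared estimator as a quadratic form *)

Section pencils.
Variable R : realType.
Implicit Types (Q : R -> R) (A B : R).

(** The restriction to a line of a quadratic form with value [A] at the base point
    and [B] at the direction. The mixed term is left unspecified, which spares a
    polarised version of the estimator. *)
Definition pencil Q A B := exists C, forall t, Q t = A + 2 * t * C + t ^+ 2 * B.

Lemma pencil0 : pencil (fun=> 0) 0 0.
Proof. by exists 0 => t; ring. Qed.

Lemma pencilD Q A B Q' A' B' : pencil Q A B -> pencil Q' A' B' ->
  pencil (fun t => Q t + Q' t) (A + A') (B + B').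
Proof. by move=> [C QC] [C' QC']; exists (C + C') => t; rewrite QC QC'; ring. Qed.

Lemma pencilZ k Q A B : pencil Q A B -> pencil (fun t => k * Q t) (k * A) (k * B).
Proof. by move=> [C QC]; exists (k * C) => t; rewrite QC; ring. Qed.

Lemma pencil_sum (I : eqType) (s : seq I) (P : pred I) (Q : I -> R -> R) (A B : I -> R) :
  (forall i, i \in s -> P i -> pencil (Q i) (A i) (B i)) ->
  pencil (fun t => \sum_(i <- s | P i) Q i t) (\sum_(i <- s | P i) A i) (\sum_(i <- s | P i) B i).
Proof.
elim: s => [|i s IH] h.
  by rewrite !big_nil; under eq_fun do rewrite big_nil; exact: pencil0.
have {}IH := IH (fun j js Pj => h j (mem_behead (s := i :: s) js) Pj).
rewrite !big_cons; under eq_fun do rewrite big_cons.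
case: ifP => Pi //; apply: pencilD => //; apply: h => //; exact: mem_head.
Qed.
End pencils.

Section estimator.
Variables (R : realType) (n : nat) (pb : problem R n) (m : nat).
Local Notation pt := 'rV[R]_n.+1.
Local Notation mu := (lebesgue_rV R n.+1).
Local Notation D := (dom pb).
Local Notation A := (coefA pb).
Local Notation dA := (dcoefA pb).
Local Notation phi := (coefphi pb).
Hypothesis vp : valid_problem pb.
Implicit Types (f g : pt -> R) (u v w : sob R n) (T : element R n) (M : mesh R n).
Local Notation fe := (fe_space pb m).

Let mD := dom_measurable vp.
Let oD := dom_open vp.
Let bD := dom_bounded vp.
Let cD := bounded_closure_compact bD.
Let mcD : measurable (closure D).
Proof. by apply: closed_measurable_rV; exact: closed_closure. Qed.

Lemma cell_measurable T : measurable (cell pb T).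
Proof.
by apply: measurableI => //; apply: closed_measurable_rV; exact: carrier_closed.
Qed.

Lemma inL2_cell T f : inL2 D f -> inL2 (cell pb T) f.
Proof.
move=> Lf; apply: (sqint_sub mD (cell_measurable T) _ Lf); exact: subIsetr.
Qed.

Lemma inL2_peval p : inL2 D (peval p).
Proof.
by apply: inL2_continuous => //; apply: continuous_subspaceT; exact: peval_continuous.
Qed.

Lemma inL2_residual f v T : inL2 D f -> inL2 D v.1 -> inL2 D (residual pb f v T).
Proof.
move=> Lf Lv; apply: (sqintB mD); last exact: inL2_Linf (Linf_phi vp) Lv.
apply: (sqintD mD) => //; apply: (sqint_sum mD) => i; apply: (sqint_sum mD) => j.
apply: (sqintD mD).
  apply: inL2_Linf (inL2_peval _) => //.
  by case: vp => _ _ /(_ i j)[_ h _] _ _; exact: (h i).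
exact: inL2_Linf (Linf_A vp i j) (inL2_peval _).
Qed.

Lemma residual_lin T t f g u v x : Defs.nondegenerate T ->
  polynomial_on T u.1 -> polynomial_on T v.1 ->
  residual pb (fun x => f x + t * g x) (u + t *: v) T x =
    residual pb f u T x + t * residual pb g v T x.
Proof.
move=> nT pu pv.
have -> : u + t *: v = t *: v + u by rewrite addrC.
rewrite /residual !sob_lin1.
have -> : div_flux pb T (t *: v + u) x = t * div_flux pb T v x + div_flux pb T u x.
  rewrite /div_flux mulr_sumr -big_split/=; apply: eq_bigr => i _.
  rewrite mulr_sumr -big_split/=; apply: eq_bigr => j _.
  have [h1 _] := @piece_deriv_lin R n T t v.1 u.1 (t *: v.1 + u.1) j j nT pv pu (fun=> erefl).
  have [_ h2] := @piece_deriv_lin R n T t v.1 u.1 (t *: v.1 + u.1) i j nT pv pu (fun=> erefl).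
  by rewrite h1 h2; ring.
ring.
Qed.

Lemma jump_lin T i T' i' t u v x : Defs.nondegenerate T -> Defs.nondegenerate T' ->
  polynomial_on T u.1 -> polynomial_on T v.1 ->
  polynomial_on T' u.1 -> polynomial_on T' v.1 ->
  jump pb (u + t *: v) T i T' i' x = jump pb u T i T' i' x + t * jump pb v T i T' i' x.
Proof.
move=> nT nT' pu pv pu' pv'.
have -> : u + t *: v = t *: v + u by rewrite addrC.
have fl T0 (nu : pt) : Defs.nondegenerate T0 -> polynomial_on T0 u.1 -> polynomial_on T0 v.1 ->
    dot (flux pb x (pgrad (piece T0 (t *: v + u).1) x)) nu =
    t * dot (flux pb x (pgrad (piece T0 v.1) x)) nu +
      dot (flux pb x (pgrad (piece T0 u.1) x)) nu.
  move=> nT0 pu0 pv0; rewrite /dot mulr_sumr -big_split/=; apply: eq_bigr => k _.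
  rewrite !fluxE mulrA -mulrDl mulr_sumr -big_split/=; congr (_ * _).
  apply: eq_bigr => j _; rewrite !mxE.
  have [h1 _] := @piece_deriv_lin R n T0 t v.1 u.1 (t *: v.1 + u.1) j j nT0 pv0 pu0 (fun=> erefl).
  by rewrite h1; ring.
by rewrite /jump !fl//; ring.
Qed.

Lemma jump_continuous v T i T' i' : {within closure D, continuous (jump pb v T i T' i')}.
Proof.
have fl (p : mpoly.mpoly n.+1 R) (nu : pt) :
    {within closure D, continuous (fun x => dot (flux pb x (pgrad p x)) nu)}.
  rewrite /dot; apply: (@continuous_sum R (subspace (closure D)) R^o) => k x.
  under eq_fun do rewrite fluxE.
  apply: (@continuousM _ _ (fun x : subspace (closure D) => \sum_j A x k j * pgrad p x 0 j)
    (fun=> nu 0 k)); last exact: cst_continuous.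
  move: x; apply: (@continuous_sum R (subspace (closure D)) R^o) => j x.
  have cA : {within closure D, continuous (fun x => A x k j)} by case: vp.
  have cp : {within closure D, continuous (peval (mpoly.mderiv j p))}.
    by apply: continuous_subspaceT; exact: peval_continuous.
  rewrite (_ : (fun x => _) = (fun x => A x k j * peval (mpoly.mderiv j p) x)); last first.
    by apply/funext => y; rewrite mxE.
  exact: continuousM (cA x) (cp x).
move=> x; apply: (@continuousB _ _ _
  (fun x : subspace (closure D) => - dot (flux pb x (pgrad (piece T v.1) x)) (outer_normal T i))).
  by apply: continuousN; exact: fl.
exact: fl.
Qed.

Definition ref_simplex : set 'rV[R]_n :=
  [set s | (forall k, 0 <= s 0 k) /\ \sum_k s 0 k <= 1].

Lemma ref_simplex_closed : closed ref_simplex.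
Proof.
rewrite (_ : ref_simplex =
    \bigcap_(i in [set: 'I_n]) ((fun l : 'rV[R]_n => l 0 i) @^-1` [set y | 0 <= y])
    `&` ((fun l : 'rV[R]_n => \sum_i l 0 i) @^-1` [set y | y <= 1])); last first.
  apply/seteqP; split=> l [l0 l1]; split=> //.
    by move=> i _; exact: l0.
  by move=> i; exact: (l0 i).
apply: closedI.
  apply: closed_bigI => i _; apply: closed_comp; last exact: closed_ge.
  by move=> l _; exact: coord_continuous.
apply: closed_comp; last exact: closed_le.
by move=> l _; apply: (@continuous_sum R _ R^o) => i; exact: coord_continuous.
Qed.

Lemma ref_simplex_fin : (lebesgue_rV R n ref_simplex < +oo)%E.
Proof.
have mS := closed_measurable_rV ref_simplex_closed.
have ab (i : 'I_n) : (fun=> 0) i <= 1 :> R by [].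
apply: (@le_lt_trans _ _ _ _ _ _ (ltry (\prod_(i < n) (1 - 0)))).
rewrite -(lebesgue_rV_box ab); apply: le_measure; rewrite ?inE//.
  exact: (measurable_box (fun=> 0) (fun=> 1)).
move=> s [s0 s1] i /=; rewrite s0 (le_trans _ s1)// (bigD1 i)//= lerDl.
by apply: sumr_ge0.
Qed.

(** The parametrization of the side opposite to the vertex [i] in [side_int]. *)
Definition side_param T (i : 'I_n.+2) (s : 'rV[R]_n) : pt :=
  T.1 (lift i ord0) +
  s *m (\matrix_(k < n) (T.1 (lift i (lift ord0 k)) - T.1 (lift i ord0)) : 'M[R]_(n, n.+1)).

Lemma side_param_carrier T i s : ref_simplex s -> carrier T (side_param T i s).
Proof.
move=> [s0 s1]; pose l (j : 'I_n.+1) := if unlift ord0 j is Some k then s 0 k else 1 - \sum_k s 0 k.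
have l0 : l ord0 = 1 - \sum_k s 0 k by rewrite /l unlift_none.
have lS k : l (lift ord0 k) = s 0 k by rewrite /l liftK.
exists n.+1, (fun j => T.1 (lift i j)), l; split.
- by move=> j; exists (lift i j).
- by move=> j; rewrite /l; case: unliftP => [k _|_]; rewrite ?subr_ge0.
- by rewrite big_ord_recl l0 (eq_bigr (fun k => s 0 k) (fun k _ => lS k)) subrK.
- rewrite big_ord_recl l0 /side_param mulmx_sum_row scalerBl scale1r -addrA; congr (_ + _).
  rewrite addrC scaler_suml -sumrB; apply: eq_bigr => k _.
  by rewrite lS rowK scalerBr.
Qed.

Lemma side_param_measurable T i : measurable_fun [set: 'rV[R]_n] (side_param T i).
Proof.
apply: measurable_fun_rV => j; apply: continuous_measurable_rV => //.
pose B : 'M[R]_(n, n.+1) := \matrix_(k < n) (T.1 (lift i (lift ord0 k)) - T.1 (lift i ord0)).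
have -> : (fun s => side_param T i s 0 j : R) =
    (fun s => T.1 (lift i ord0) 0 j + \sum_k s 0 k * B k j).
  by apply/funext => s; rewrite /side_param mxE [X in _ + X = _]mxE.
move=> s; apply: (@continuousD _ _ _ (fun=> T.1 (lift i ord0) 0 j)); first exact: cst_continuous.
move: s; apply: (@continuous_sum R _ R^o) => k s.
by apply: (@continuousM _ _ (fun x : 'rV[R]_n => x 0 k));
  [exact: coord_continuous|exact: cst_continuous].
Qed.

(** Sides are null sets, so that essential bounds of the coefficients say nothing
    about the jumps; these are controlled through the continuity of the
    coefficients up to the boundary. *)
Lemma sqint_jump v T i T' i' : carrier T `<=` closure D ->
  sqint (lebesgue_rV R n) ref_simplex (fun s => jump pb v T i T' i' (side_param T i s)).
Proof.
move=> TD; have mS := closed_measurable_rV ref_simplex_closed.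
have [C hC] := within_continuous_bounded cD (@jump_continuous v T i T' i').
apply: (@sqint_bounded _ _ _ _ _ mS _ C); first exact: ref_simplex_fin.
  apply: (measurable_comp (F := closure D)) => //.
  - by move=> _ [s Ss <-]; apply/TD/side_param_carrier.
  - by apply: within_continuous_measurable => //; exact: jump_continuous.
  - by apply: measurable_funTS; exact: side_param_measurable.
by move=> s Ss; apply/hC/TD/side_param_carrier.
Qed.

Lemma diam_ge0 k (S : set 'rV[R]_k) : 0 <= diam S.
Proof.
rewrite /diam; set X := [set r | _].
have [[[r [x [y [Sx Sy rE]]]] ubX]|nsup] := pselect (has_sup X); last first.
  by rewrite sup_out.
apply: (@le_trans _ _ r); first by rewrite rE sqrtr_ge0.
by apply: ub_le_sup => //; exists x, y.
Qed.

Lemma side_size_ge0 T i T' : 0 <= side_size T i T'.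
Proof.
by rewrite /side_size; case: ifP => _; rewrite ?le_max ?diam_ge0.
Qed.

Lemma eta2_ge0 M f v T : 0 <= eta2 pb M f v T.
Proof.
rewrite /eta2; apply: addr_ge0; first by rewrite mulr_ge0 ?sqr_ge0.
apply: sumr_ge0 => i _.
apply: sumr_ge0 => T' _; apply: sumr_ge0 => i' _; rewrite mulr_ge0 ?side_size_ge0//.
by rewrite /side_int mulr_ge0 ?sqrtr_ge0// Rintegral_ge0// => s _; exact: sqr_ge0.
Qed.

Lemma triangulation_carrier M T : triangulation D M -> T \in M -> carrier T `<=` closure D.
Proof. by move=> [_ -> _ _] TM x Tx; exists T. Qed.

Lemma triangulation_nondegenerate M T : triangulation D M -> T \in M -> Defs.nondegenerate T.
Proof. by move=> [[_ h] _ _ _] /h. Qed.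

(** The squared estimator is a quadratic form, whence its square root is a
    seminorm in the pair of the right-hand side and the discrete function. *)
Lemma eta2_pencil M f g u v T : triangulation D M -> T \in M ->
  inL2 D f -> inL2 D g -> fe M u -> fe M v ->
  pencil (fun t => eta2 pb M (fun x => f x + t * g x) (u + t *: v) T)
    (eta2 pb M f u T) (eta2 pb M g v T).
Proof.
move=> trM TM Lf Lg fu fv; have nT := triangulation_nondegenerate trM TM.
have pu := fe_polynomial_on fu TM; have pv := fe_polynomial_on fv TM.
have Lu : inL2 D u.1 by case: (fe_H10 fu) => -[].
have Lv : inL2 D v.1 by case: (fe_H10 fv) => -[].
have mc := cell_measurable T.
apply: pencilD.
  apply: pencilZ.
  have sq h : norm0 (cell pb T) h ^+ 2 = ip0 (cell pb T) h h.
    by rewrite sqr_sqrtr//; exact: ipint_ge0.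
  have Lr1 := inL2_cell T (inL2_residual T Lf Lu).
  have Lr2 := inL2_cell T (inL2_residual T Lg Lv).
  exists (ip0 (cell pb T) (residual pb f u T) (residual pb g v T)) => t.
  rewrite !sq -(ipint_pencil mc t Lr1 Lr2).
  by apply: eq_Rintegral => x _; rewrite residual_lin.
apply: (pencil_sum (P := xpredT)) => i _ _.
apply: (pencil_sum (P := xpredT)) => T' T'M _.
apply: pencil_sum => i' _ _; apply: pencilZ.
have nT' := triangulation_nondegenerate trM T'M.
have pu' := fe_polynomial_on fu T'M; have pv' := fe_polynomial_on fv T'M.
have TD := triangulation_carrier trM TM.
apply: pencilZ.
have mS := closed_measurable_rV ref_simplex_closed.
have Lj1 := sqint_jump u i T' i' TD; have Lj2 := sqint_jump v i T' i' TD.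
exists (ipint (lebesgue_rV R n) ref_simplex (fun s => jump pb u T i T' i' (side_param T i s))
  (fun s => jump pb v T i T' i' (side_param T i s))) => t.
rewrite [X in _ = X + _ + _](_ : _ = ipint (lebesgue_rV R n) ref_simplex
  (fun s => jump pb u T i T' i' (side_param T i s))
  (fun s => jump pb u T i T' i' (side_param T i s)));
  last by apply: eq_Rintegral => s _; rewrite expr2.
rewrite [X in _ = _ + _ * X](_ : _ = ipint (lebesgue_rV R n) ref_simplex
  (fun s => jump pb v T i T' i' (side_param T i s))
  (fun s => jump pb v T i T' i' (side_param T i s)));
  last by apply: eq_Rintegral => s _; rewrite expr2.
rewrite -(ipint_pencil mS t Lj1 Lj2).
by apply: eq_Rintegral => s _; rewrite jump_lin// expr2.
Qed.

Lemma eta_on_pencil M f g u v : triangulation D M ->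
  inL2 D f -> inL2 D g -> fe M u -> fe M v ->
  pencil (fun t => eta_on pb M M (fun x => f x + t * g x) (u + t *: v) ^+ 2)
    (eta_on pb M M f u ^+ 2) (eta_on pb M M g v ^+ 2).
Proof.
move=> trM Lf Lg fu fv.
have sq f' u' : eta_on pb M M f' u' ^+ 2 = \sum_(T <- M) eta2 pb M f' u' T.
  by rewrite sqr_sqrtr// sumr_ge0// => T _; exact: eta2_ge0.
have [T TM _|C hC] := @pencil_sum R _ M xpredT
    (fun T t => eta2 pb M (fun x => f x + t * g x) (u + t *: v) T)
    (eta2 pb M f u) (eta2 pb M g v); first exact: eta2_pencil.
exists C => t; apply: etrans (sq _ _) (etrans (hC t) _).
exact: (congr2 (fun a b => a + 2 * t * C + t ^+ 2 * b) (esym (sq f u)) (esym (sq g v))).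
Qed.

(** The estimator does not see which representative of a discrete function is
    used, once the values in the closed domain are known. *)
Lemma eq_eta_on M f u v : triangulation D M -> (forall x, closure D x -> u.1 x = v.1 x) ->
  eta_on pb M M f u = eta_on pb M M f v.
Proof.
move=> trM uv; apply: (congr1 Num.sqrt); apply: eq_big_seq => T TM.
have pE T' : T' \in M -> piece T' u.1 = piece T' v.1.
  move=> T'M; apply: eq_piece => x Tx; apply: uv; exact: (triangulation_carrier trM T'M Tx).
rewrite /eta2; apply: f_equal2.
  apply: (congr1 (fun a => _ * a ^+ 2)); apply: (congr1 Num.sqrt).
  apply: eq_Rintegral => x; rewrite inE => -[Tx Dx].
  by rewrite /residual /div_flux (pE _ TM) (uv x)//; exact: subset_closure.
apply: eq_bigr => i _; apply: eq_big_seq => T' T'M; apply: eq_bigr => i' _.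
apply: (congr1 (fun a => _ * (_ * a))); apply: eq_Rintegral => s _.
by rewrite /jump (pE _ TM) (pE _ T'M).
Qed.
End estimator.

(** * Square roots of quadratic functions *)

Section quadratic_functions.
Variables (R : realType) (X : lmodType R) (V : set X).
Hypothesis V0 : V 0.
Hypothesis VP : forall c u v, V u -> V v -> V (c *: u + v).
Variable Q : X -> R.

Definition quadratic := (forall f, V f -> 0 <= Q f) /\
  forall f g, V f -> V g -> pencil (fun t => Q (f + t *: g)) (Q f) (Q g).

Hypothesis qQ : quadratic.

Lemma quadraticZ t f : V f -> Q (t *: f) = t ^+ 2 * Q f.
Proof.
case: qQ => Q0 pQ Vf.
have Z : Q 0 = 0.
  have [C hC] := pQ 0 0 V0 V0.
  by have := hC 1; have := hC (-1); rewrite !scaler0 !addr0; lra.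
have [C hC] := pQ 0 f V0 Vf.
have C0 : C ^+ 2 <= 0 * Q f.
  apply: pencil_discriminant => s; rewrite -[X in X + _ + _]Z -hC Q0// add0r.
  by rewrite -[_ *: _]addr0; exact: VP.
have {}C0 : C = 0 by apply/eqP; rewrite -sqrf_eq0 eq_le sqr_ge0 andbT -(mul0r (Q f)).
by rewrite -[t *: f]add0r hC Z C0; ring.
Qed.

Lemma sqrt_quadraticZ t f : V f -> Num.sqrt (Q (t *: f)) = `|t| * Num.sqrt (Q f).
Proof. by move=> Vf; rewrite quadraticZ// sqrtrM ?sqr_ge0// sqrtr_sqr. Qed.

Lemma sqrt_quadraticD f g : V f -> V g ->
  Num.sqrt (Q (f + g)) <= Num.sqrt (Q f) + Num.sqrt (Q g).
Proof.
move=> Vf Vg; case: qQ => Q0 pQ; have [C hC] := pQ f g Vf Vg.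
rewrite -[g in f + g]scale1r hC mulr1 expr1n mul1r; apply: pencil_triangle => t.
by rewrite -hC Q0// addrC; exact: VP.
Qed.
End quadratic_functions.

(** * The spectral gap *)

Section spectral_gap.
Variables (R : realType) (X : lmodType R) (V : set X) (a b : X -> X -> R).
Variables (ca : R) (lam : nat -> R) (uh : nat -> X).
Hypotheses (aP : semi_inner V a) (bP : semi_inner V b).
Hypotheses (ca0 : 0 < ca) (ca_le : forall u, V u -> ca * snorm b u <= snorm a u).
Hypothesis Vuh : forall i, V (uh i).
Hypothesis uhP : forall i v, V v -> a (uh i) v = lam i * b (uh i) v.
Hypothesis uh_orth : forall i j, a (uh i) (uh j) = (i == j)%:R.
Hypotheses (lam0 : 0 < lam 0%N) (lam01 : lam 0%N < lam 1%N).
Hypothesis lam_le : forall i, lam i <= lam i.+1.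
Hypothesis dense : forall v, V v -> forall e : R, 0 < e ->
  exists (N : nat) (c : nat -> R), snorm a (v - \sum_(i < N) c i *: uh i) < e.

Lemma mem_sum (N : nat) (c : nat -> R) (x : nat -> X) :
  (forall i, V (x i)) -> V (\sum_(i < N) c i *: x i).
Proof.
move=> Vx; elim: N => [|N IH]; first by rewrite big_ord0; case: aP.
by rewrite big_ord_recr /= addrC; exact: (si_memP aP).
Qed.

Lemma si_suml (d : X -> X -> R) (N : nat) (c : nat -> R) (x : nat -> X) w :
  semi_inner V d -> (forall i, V (x i)) -> V w ->
  d (\sum_(i < N) c i *: x i) w = \sum_(i < N) c i * d (x i) w.
Proof.
move=> dP Vx Vw; elim: N => [|N IH]; first by rewrite !big_ord0 (si0l dP).
rewrite !big_ord_recr /= addrC (si_lin dP)//; last exact: mem_sum.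
by rewrite IH addrC.
Qed.

Lemma lam_ge1 i : (0 < i)%N -> lam 1%N <= lam i.
Proof. by case: i => // i _; elim: i => // i IH; exact: le_trans IH (lam_le _). Qed.

Lemma lam_gt0 i : 0 < lam i.
Proof. by case: i => // i; exact: lt_le_trans (lt_trans lam0 lam01) (lam_ge1 _). Qed.

(** The Rayleigh quotient of a vector orthogonal to the first eigenvector is at
    least the second eigenvalue: on finite combinations of eigenvectors this is
    Parseval's identity, and these combinations are dense. *)
Lemma spectral_gap v : V v -> a v (uh 0%N) = 0 -> lam 1%N * b v v <= a v v.
Proof.
move=> Vv v0; have l1 := lam_gt0 1; pose r := lam 1%N / lam 0%N.
suff h : Num.sqrt (lam 1%N) * snorm b v <= snorm a v.
  have : (Num.sqrt (lam 1%N) * snorm b v) ^+ 2 <= snorm a v ^+ 2.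
    by rewrite ler_pXn2r ?nnegrE ?mulr_ge0 ?sqrtr_ge0 ?snorm_ge0.
  by rewrite exprMn (sqr_snorm aP)// (sqr_snorm bP)// sqr_sqrtr// ltW.
have r0 : 0 < r by rewrite divr_gt0.
(* The approximation error of [v] by a finite combination enters three times:
   in the energy norm, through the coefficient of the first eigenvector, and in
   the weak norm. [C] is the sum of the three factors. *)
pose C := 1 + Num.sqrt r + Num.sqrt (lam 1%N) / ca.
have C0 : 0 < C by rewrite /C -addrA ltr_pwDl// addr_ge0 ?sqrtr_ge0// divr_ge0 ?sqrtr_ge0// ltW.
apply/ler_addgt0Pr => e e0.
have [N [c hc]] := dense Vv (divr_gt0 e0 C0).
set s := \sum_(i < N) _ in hc; have Vs : V s by exact: mem_sum.
have Vd := memB aP Vv Vs.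
have b_uh i j : b (uh i) (uh j) = (i == j)%:R / lam i.
  by rewrite -uh_orth uhP// mulrC mulKf// gt_eqF// lam_gt0.
have as_uh (j : 'I_N) : a s (uh j) = c j.
  rewrite (si_suml _ _ aP)// (bigD1 j)//= uh_orth eqxx mulr1 big1 ?addr0// => i ij.
  by rewrite uh_orth (_ : (i == j :> nat) = false) ?mulr0//; exact/negbTE.
have bs_uh (j : 'I_N) : b s (uh j) = c j / lam j.
  rewrite (si_suml _ _ bP)// (bigD1 j)//= b_uh eqxx mul1r big1 ?addr0// => i ij.
  by rewrite b_uh (_ : (i == j :> nat) = false) ?mul0r ?mulr0//; exact/negbTE.
have ass : a s s = \sum_(i < N) c i ^+ 2.
  rewrite {1}/s (si_suml _ _ aP)//; apply: eq_bigr => i _.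
  by rewrite (si_sym aP)// as_uh.
have bss : b s s = \sum_(i < N) c i ^+ 2 / lam i.
  rewrite {1}/s (si_suml _ _ bP)//; apply: eq_bigr => i _.
  by rewrite (si_sym bP)// bs_uh mulrA.
(* All coefficients but the first obey the gap; the first one is as small as
   the approximation error, as [v] is orthogonal to the first eigenvector. *)
have sb : lam 1%N * b s s <= a s s + r * (e / C) ^+ 2.
  rewrite ass bss mulr_sumr.
  have [N0|N0] := posnP N.
    rewrite [in leLHS]big1; last by case=> i hi _; exfalso; rewrite N0 in hi.
    by rewrite addr_ge0 ?sumr_ge0// => [i _|]; rewrite ?sqr_ge0// mulr_ge0 ?sqr_ge0// ltW.
  pose z := Ordinal N0.
  rewrite (bigD1 z)//= [in leRHS](bigD1 z)//= [leRHS]addrAC; apply: lerD.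
    have c0 : `|c 0%N| <= e / C.
      have -> : c 0%N = - a (v - s) (uh 0%N).
        by rewrite (siBl aP)// v0 sub0r opprK -(as_uh z).
      rewrite normrN; apply/ltW/(le_lt_trans _ hc).
      apply: le_trans (cauchy_schwarz aP Vd (Vuh 0)) _.
      by rewrite [X in _ * X]/snorm uh_orth eqxx sqrtr1 mulr1.
    have cz : c 0%N ^+ 2 <= (e / C) ^+ 2.
      by rewrite -[leLHS]real_normK ?num_real// ler_pXn2r ?nnegrE// (le_trans _ c0).
    rewrite mulrCA [leLHS]mulrC -/r; have := sqr_ge0 (c 0%N); have := ler_wpM2l (ltW r0) cz; lra.
  apply: ler_sum => i iz; rewrite mulrCA ler_piMr ?sqr_ge0// ler_pdivrMr ?mul1r ?lam_gt0//.
  by rewrite lam_ge1// lt0n; apply: contraNneq iz => i0; exact/eqP/val_inj.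
have sqb : Num.sqrt (lam 1%N) * snorm b s <= snorm a s + Num.sqrt r * (e / C).
  have p : 0 <= snorm a s + Num.sqrt r * (e / C).
    by rewrite addr_ge0 ?snorm_ge0// mulr_ge0 ?sqrtr_ge0// divr_ge0// ltW.
  rewrite -(ger0_norm p) -sqrtr_sqr.
  rewrite /snorm -sqrtrM ?(ltW l1)// ler_wsqrtr// (le_trans sb)//.
  rewrite sqrrD [(Num.sqrt r * _) ^+ 2]exprMn !sqr_sqrtr ?(ltW r0) ?(si_ge0 aP)// lerD2r lerDl.
  by rewrite mulrn_wge0// mulr_ge0 ?sqrtr_ge0// mulr_ge0 ?sqrtr_ge0// divr_ge0// ltW.
have h1 := snorm_le_subD bP Vv Vs; 
have h2 : snorm b (v - s) <= snorm a (v - s) / ca by rewrite ler_pdivlMr// mulrC ca_le.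
have h3 := snorm_le_subD aP Vs Vv; rewrite (snorm_subC aP Vs Vv) in h3.
have l1s : 0 <= Num.sqrt (lam 1%N) by rewrite sqrtr_ge0.
have h4 : Num.sqrt (lam 1%N) * snorm b v <=
    Num.sqrt (lam 1%N) * snorm b s + Num.sqrt (lam 1%N) / ca * (e / C).
  rewrite -mulrA -mulrDr ler_wpM2l// (le_trans h1)// lerD2l (le_trans h2)//.
  by rewrite mulrC ler_wpM2l ?invr_ge0 ?(ltW ca0)// ltW.
have eE : e = e / C + Num.sqrt r * (e / C) + Num.sqrt (lam 1%N) / ca * (e / C).
  by rewrite -[X in X + _ + _]mul1r -!mulrDl -/C mulrC divfK// gt_eqF.
rewrite [leRHS](_ : _ = snorm a v + (e / C + Num.sqrt r * (e / C) +
  Num.sqrt (lam 1%N) / ca * (e / C))); last by rewrite -eE.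
have {}hc := ltW hc; apply: (le_trans h4); apply: (le_trans (lerD sqb (lexx _))).
apply: (le_trans (lerD (lerD h3 (lexx _)) (lexx _))).
by rewrite -!addrA lerD2l lerD2r.
Qed.
End spectral_gap.

(** * The boundary value problem as an instance of the model *)

Section approximation_quantities.
Variables (R : realType) (n : nat) (pb : problem R n) (ca : R).
Variables (lam : nat -> R) (uh : nat -> sob R n).
Variables (K : ('rV[R]_n.+1 -> R) -> sob R n) (E : sob R n -> sob R n).
Local Notation pt := 'rV[R]_n.+1.
Local Notation D := (dom pb).
Local Notation V := (H10 D).
Local Notation l := (lam 0%N).
Local Notation na := (norm_a pb).
Local Notation a := (form_a pb).
Local Notation b := (form_0 pb).
Local Notation e0 := (uh 0%N).
Local Notation nd u := (snorm a (defl a e0 u)).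
Hypothesis vp : valid_problem pb.
Hypothesis ca0 : 0 < ca.
Hypothesis ca_norm1 : forall w, V w -> ca * norm1 D w <= na w.
Hypothesis eigP : eigen_system pb lam uh.
Hypothesis KP : solution_operator pb K.
Hypothesis EP : a_projection pb (eigenspace_of pb l) E.
Implicit Types (f g : pt -> R) (u v w : sob R n) (M : mesh R n) (W : set (sob R n)).

Let aP := form_a_semi_inner vp.
Let bP := form_0_semi_inner vp.

Let mD := dom_measurable vp.

Lemma ip0_semi_inner : semi_inner (inL2 D) (ip0 D).
Proof.
split; first exact: sqint0.
- by move=> c f g Lf Lg; exact: (sqint_lin mD c Lf Lg).
- by move=> f g _ _; exact: ipintC.
- by move=> c f g h Lf Lg Lh; exact: (ipint_lin mD c Lf Lg Lh).
- by move=> f _; exact: ipint_ge0.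
Qed.

#[local] Opaque form_a ip0.

Lemma norm_aE : na = snorm a. Proof. by []. Qed.
Lemma norm0E u : norm0 D u.1 = snorm b u. Proof. by []. Qed.

Lemma ca_norm0 u : V u -> ca * snorm b u <= snorm a u.
Proof.
move=> Vu; apply: le_trans (ca_norm1 Vu); rewrite ler_wpM2l ?(ltW ca0)//.
exact: norm0_le_norm1.
Qed.

Lemma eigenfun_mem i : V (uh i). Proof. by case: eigP => /(_ i)[]. Qed.
Lemma eigenfun_eq i v : V v -> a (uh i) v = lam i * b (uh i) v.
Proof. by case: eigP => /(_ i)[_ h] _ _ _ _; exact: h. Qed.
Lemma eigenfun_norm : a e0 e0 = 1. Proof. by case: eigP => _ h _ _ _; rewrite h. Qed.
Lemma lam0_gt0 : 0 < l. Proof. by case: eigP => _ _ [h _]. Qed.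
Lemma lam0_lt : l < lam 1%N. Proof. by case: eigP => _ _ [_ h]. Qed.

Lemma eigen_gap v : V v -> a v e0 = 0 -> lam 1%N * b v v <= a v v.
Proof.
case: eigP => _ h2 [h3 h4] h5 h6.
exact: (spectral_gap aP bP ca0 ca_norm0 eigenfun_mem eigenfun_eq h2 h3 h4 h5 h6).
Qed.

Lemma sol_mem u : V u -> V (K u.1).
Proof. by move=> [[u1 _ _] _]; case: (KP u1). Qed.

Lemma sol_eq u v : V u -> V v -> a (K u.1) v = b u v.
Proof. by move=> [[u1 _ _] _]; case: (KP u1) => _; exact. Qed.

Lemma pde_model : eigen_model V a b ca l (lam 1%N) e0 (fun u => K u.1).
Proof.
split; [exact: aP|exact: bP|exact: ca0|exact: ca_norm0|exact: eigenfun_mem|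
  exact: eigenfun_norm|exact: lam0_gt0|exact: lam0_lt|exact: eigenfun_eq|
  exact: eigen_gap|exact: sol_mem|exact: sol_eq].
Qed.

Lemma eigenspace_null v : eigenspace_of pb l v -> nd v = 0.
Proof. by move=> [Vv hv]; exact: (eigenvector_null pde_model Vv hv). Qed.

Lemma eigenspace_e0 : eigenspace_of pb l e0.
Proof. by split; [exact: eigenfun_mem|exact: eigenfun_eq]. Qed.

(** The first eigenspace is a line up to vectors of zero energy, so that the given
    projection and the explicit one leave remainders of the same size. *)
Lemma defl_projection u : V u ->
  na (u - E u) = nd u /\ norm0 D (u - E u).1 = snorm b (defl a e0 u).
Proof.
move=> Vu; have [ME orth] := EP Vu; have VE : V (E u) by case: ME.
exact: (defl_sub_eigenvector pde_model Vu VE (eigenspace_null ME) (orth _ eigenspace_e0)).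
Qed.

(** * Distances to subspaces *)

Lemma dist_a_le v w W : W w -> dist_a pb v W <= na (v - w).
Proof.
move=> Ww; apply: ge_inf; last by exists w.
by exists 0 => _ [w' _ <-]; exact: snorm_ge0.
Qed.

Lemma dist_a_ge v W x : W 0 -> (forall w, W w -> x <= na (v - w)) -> x <= dist_a pb v W.
Proof.
move=> W0 h; apply: lb_le_inf; first by exists (na (v - 0)), 0.
by move=> _ [w Ww <-]; exact: h.
Qed.

Lemma dist_a_sub v W W' : W 0 -> W `<=` W' -> dist_a pb v W' <= dist_a pb v W.
Proof. by move=> W0 WW'; apply: dist_a_ge => // w /WW' W'w; exact: dist_a_le. Qed.

Lemma le_sup_image (T : Type) (X : set T) (F G : T -> R) (C : R) :
  (forall x, X x -> F x <= G x) -> (forall x, X x -> G x <= C) ->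
  sup [set F x | x in X] <= sup [set G x | x in X].
Proof.
move=> FG GC; have [[x0 Xx0]|X0] := pselect (X !=set0); last first.
  by have -> : X = set0; [apply/seteqP; split=> // x Xx; apply: X0; exists x|rewrite !image_set0].
apply: ge_sup; first by exists (F x0), x0.
move=> _ [x Xx <-]; apply: le_trans (FG _ Xx) _; apply: ub_le_sup; last by exists x.
by exists C => _ [y Xy <-]; exact: GC.
Qed.

Lemma delta_a_sub W W' : W 0 -> W `<=` W' -> delta_a pb l W' <= delta_a pb l W.
Proof.
move=> W0 WW'; apply: (@le_sup_image _ _ _ _ 1) => v; first by move=> _; exact: dist_a_sub.
by move=> [_ v1]; have := dist_a_le v W0; rewrite subr0 v1.
Qed.

(** The first eigenspace is a line, and the distance of a unit vector of one line
    to another line is symmetric in the two lines. *)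
Lemma delta_a_le W u : (forall c, W (c *: u)) -> V u -> na u = 1 ->
  delta_a pb l W <= nd u.
Proof.
move=> Wu Vu u1; apply: ge_sup.
  exists (dist_a pb e0 W); exists e0; last exact: erefl.
  by split; [exact: eigenspace_e0|rewrite /norm_a eigenfun_norm sqrtr1].
move=> _ [v [ev v1] <-]; have Vv : V v by case: ev.
apply: le_trans (dist_a_le v (Wu (a v u))) _.
exact: (unit_multiple_dist pde_model Vu Vv u1 v1 (eigenspace_null ev)).
Qed.

Lemma sol_bound f : inL2 D f -> na (K f) <= norm0 D f / ca.
Proof.
move=> Lf; have [Vk kP] := KP Lf; have Lk : inL2 D (K f).1 by case: Vk => -[].
rewrite norm_aE; have h : snorm a (K f) ^+ 2 <= norm0 D f / ca * snorm a (K f).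
  rewrite (sqr_snorm aP Vk) (kP _ Vk); apply: le_trans (ler_norm _) _.
  apply: le_trans (cauchy_schwarz ip0_semi_inner Lf Lk) _.
  rewrite -mulrA ler_wpM2l ?snorm_ge0// mulrC.
  exact: (nb_le pde_model Vk).
have := snorm_ge0 a (K f); rewrite le_eqVlt => /predU1P[<-|p].
  by rewrite divr_ge0 ?sqrtr_ge0// ltW.
by rewrite -(ler_pM2r p) -expr2.
Qed.

Lemma dist_sol_bound W f : W 0 -> inL2 D f -> norm0 D f = 1 -> dist_a pb (K f) W <= 1 / ca.
Proof.
by move=> W0 Lf f1; have := dist_a_le (K f) W0;
rewrite subr0 => /le_trans; apply; rewrite -f1 sol_bound.
Qed.

Lemma eta_a_sub W W' : W 0 -> W `<=` W' -> eta_a pb K W' <= eta_a pb K W.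
Proof.
move=> W0 WW'; apply: (@le_sup_image _ _ _ _ (1 / ca)) => f.
  by move=> _; exact: dist_a_sub.
by move=> [Lf f1]; exact: dist_sol_bound.
Qed.

Lemma eta_a_ge0 W : W 0 -> 0 <= eta_a pb K W.
Proof.
move=> W0; rewrite /eta_a; set X := [set f | _].
have [[[r [f Xf fr]] ubX]|nsup] := pselect (has_sup [set dist_a pb (K f) W | f in X]); last first.
  by rewrite sup_out.
apply: (@le_trans _ _ r); last by apply: ub_le_sup => //; exists f.
by rewrite -fr; apply: dist_a_ge => // w _; exact: snorm_ge0.
Qed.

(** The Galerkin error is at most [eta_a] times the norm of the datum: this is
    the scaling of the supremum over normalised data. *)
Lemma galerkin_error_le W u w : W `<=` V -> W 0 ->
    (forall c v v', W v -> W v' -> W (c *: v + v')) ->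
  V u -> W w -> (forall v, W v -> a (K u.1 - w) v = 0) ->
  na (K u.1 - w) <= eta_a pb K W * norm0 D u.1.
Proof.
move=> WV W0 WP Vu Ww orth; have Vk := sol_mem Vu.
have WB v v' : W v -> W v' -> W (v - v').
  by move=> h h'; rewrite addrC -scaleN1r; exact: WP.
have [n0|n0] := eqVneq (norm0 D u.1) 0.
  rewrite n0 mulr0; have [h _] := snorm_galerkin aP WV WB W0 Vk Ww orth.
  apply: le_trans h _; have := sol_bound (f := u.1); rewrite n0 mul0r; apply.
  by case: Vu => -[].
have np : 0 < norm0 D u.1 by rewrite lt_def n0 sqrtr_ge0.
rewrite -ler_pdivrMr//; set s := (norm0 D u.1)^-1.
have s0 : 0 < s by rewrite invr_gt0.
have Vsu := memZ aP s Vu; have Vk' := sol_mem Vsu.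
apply: (@le_trans _ _ (dist_a pb (K (s *: u).1) W)); last first.
  apply: ub_le_sup.
    exists (1 / ca) => _ [f [Lf f1] <-]; exact: dist_sol_bound.
  exists (s *: u).1 => //; split; first by case: Vsu => -[].
  by rewrite norm0E (snormZ bP)// ger0_norm ?(ltW s0)// -norm0E mulVf.
apply: dist_a_ge => // v Wv; have Vv := WV _ Wv.
have Wv' : W (s^-1 *: v) by rewrite -[_ *: _]addr0; exact: WP.
apply: (@le_trans _ _ (s * na (K u.1 - s^-1 *: v))); last first.
  by rewrite -(na_kapZ pde_model s0 Vu Vv).
rewrite mulrC ler_pM2l//.
exact: (galerkin_best aP WV WB Vk Ww orth Wv').
Qed.
End approximation_quantities.

(** * Estimates for an abstract adaptive iteration *)

(** The perturbation [z] affects both neighbours; half of the slack is enough for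
    each of them because [al < 1]. *)
Lemma absorb (R : realType) (z ah al x x' : R) : 0 < ah -> al < 1 -> 0 <= z ->
  2 * z <= al - ah -> 0 <= x -> x' <= ah * x + (z * x + z * x') -> x' <= al * x.
Proof.
move=> ah0 al1 z0 cs x0 h.
have z1 : 0 < 1 - z by lra.
have zal : z * al <= z by rewrite ler_piMr// ltW.
have h1 : (ah + z) * x <= (1 - z) * al * x by rewrite ler_wpM2r//; lra.
rewrite -(ler_pM2l z1) mulrA; apply: le_trans h1; lra.
Qed.

Section inverse_iteration.
Variables (R : realType) (X : lmodType R) (V : set X) (a b : X -> X -> R).
Variables (ca l l2 : R) (e0 : X) (kap : X -> X).
Hypothesis em : eigen_model V a b ca l l2 e0 kap.
Variables (W : nat -> set X) (G : nat -> X -> X) (eta : nat -> X -> R).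
(* [eps] is the approximation quantity of the coarse space, [dl] bounds the
   direction error of every eigensolve, and [C0] is the stability constant of
   the estimator on discrete data. *)
Variables (eps dl Cea Ce0 Can Cup C0 gam alphah alpha theta2 : R).
Local Notation na := (snorm a).
Local Notation nb := (snorm b).
Local Notation nd u := (na (defl a e0 u)).
Local Notation aligned := (aligned V a l l2 e0).
Local Notation t0 := (tol l l2).
Implicit Types (k j : nat) (f g u w : X).

Let aP := em_a em.
Let bP := em_b em.
Let l0 := em_l0 em.
Let ca0 := em_ca0 em.
Let kapV := em_kapV em.
Let kapP := em_kap em.

Hypothesis WV : forall k, (1 <= k)%N -> W k `<=` V.
Hypothesis W0 : forall k, W k 0.
Hypothesis WP : forall k c u v, W k u -> W k v -> W k (c *: u + v).
Hypothesis WS : forall k, (1 <= k)%N -> W k `<=` W k.+1.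
Hypothesis GW : forall k f, (1 <= k)%N -> V f -> W k (G k f).
Hypothesis GP : forall k f, (1 <= k)%N -> V f -> forall v, W k v -> a (kap f - G k f) v = 0.

Definition galerkin_err k f := na (kap f - G k f).
Local Notation err := galerkin_err.

Hypothesis eta_ge0 : forall k f, 0 <= eta k f.
Hypothesis eta_quadratic : forall k, (1 <= k)%N -> quadratic V (fun f => eta k f ^+ 2).
Hypotheses (eps0 : 0 <= eps) (Cea0 : 0 < Cea) (Ce00 : 0 < Ce0) (Can0 : 0 < Can).
Hypotheses (Cup0 : 0 < Cup) (C00 : 0 <= C0) (gam0 : 0 < gam).
Hypotheses (alphah0 : 0 < alphah) (alpha_gt : alphah < alpha) (alpha1 : alpha < 1).
Hypothesis theta20 : 0 < theta2.
Hypothesis err_eps : forall k f, (1 <= k)%N -> V f -> err k f <= eps * nb f.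
Hypothesis err_weak : forall k f, (1 <= k)%N -> V f ->
  nb (kap f - G k f) <= Can * eps * err k f.
Hypothesis err_up : forall k f, (1 <= k)%N -> V f -> err k f <= Cup * eta k f.
Hypothesis eta_low : forall k f, (1 <= k)%N -> W k f -> eta k f <= C0 * na (kap f).

Let WB k u v : W k u -> W k v -> W k (u - v).
Proof. by move=> h h'; rewrite addrC -scaleN1r; exact: WP. Qed.

Let WZ k c u : W k u -> W k (c *: u).
Proof. by move=> h; rewrite -[_ *: _]addr0; exact: WP. Qed.

Lemma galerkin_eq k f v : (1 <= k)%N -> V f -> W k v -> a (G k f) v = b f v.
Proof.
move=> k1 Vf Wv; have Vv := WV k1 Wv; have := GP k1 Vf Wv.
rewrite (siBl aP)//; [rewrite kapP// => /subr0_eq //|exact: kapV|exact: (WV k1 (GW k1 Vf))].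
Qed.

Lemma galerkin_null k f w : (1 <= k)%N -> V f -> W k w ->
  (forall v, W k v -> a w v = b f v) -> na (w - G k f) = 0.
Proof.
move=> k1 Vf Ww h; have WG := GW k1 Vf; have Wz := WB Ww WG.
have Vz := WV k1 Wz.
suff : a (w - G k f) (w - G k f) = 0 by rewrite /snorm => ->; rewrite sqrtr0.
by rewrite (siBl aP (WV k1 Ww) (WV k1 WG) Vz) (h _ Wz) (galerkin_eq k1 Vf Wz) subrr.
Qed.

Lemma galerkin_solve_err k f w : (1 <= k)%N -> V f -> W k w ->
  (forall v, W k v -> a w v = b f v) ->
  na (kap f - w) = err k f /\ nb (kap f - w) = nb (kap f - G k f).
Proof.
move=> k1 Vf Ww h; have z := galerkin_null k1 Vf Ww h.
have VG := WV k1 (GW k1 Vf); have Vw := WV k1 Ww; have Vk := kapV Vf.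
have V1 := memB aP Vk Vw; have V2 := memB aP Vk VG; have V3 := memB aP VG Vw.
have e : kap f - w - (kap f - G k f) = G k f - w by rewrite opprB addrC addrA subrK.
have z' : na (G k f - w) = 0 by rewrite (snorm_subC aP VG Vw).
split; first by apply: (snorm_null_eq aP V1 V2); rewrite e.
by apply: (snorm_null_eq bP V1 V2); rewrite e; exact: (null_b em V3 z').
Qed.

(** [kap] and [G] are linear up to vectors of zero energy, which do not change the
    error. *)
Lemma err_quadratic k : (1 <= k)%N -> quadratic V (fun f => err k f ^+ 2).
Proof.
move=> k1; split; first by move=> f _; exact: sqr_ge0.
move=> f g Vf Vg; have Vkf := kapV Vf; have Vkg := kapV Vg.
have WGf := GW k1 Vf; have WGg := GW k1 Vg.
have VGf := WV k1 WGf; have VGg := WV k1 WGg.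
have Vxf := memB aP Vkf VGf; have Vxg := memB aP Vkg VGg.
exists (a (kap f - G k f) (kap g - G k g)) => t.
rewrite /err !(sqr_snorm aP Vxf, sqr_snorm aP Vxg) -(si_pencil aP t Vxf Vxg).
have Vtg := memZ aP t Vg; have Vfg := memD aP Vf Vtg.
have Vk := kapV Vfg; have WG := GW k1 Vfg; have VG := WV k1 WG.
have Vx := memB aP Vk VG; have Vtx := memZ aP t Vxg; have Vy := memD aP Vxf Vtx.
rewrite -(sqr_snorm aP Vy); congr (_ ^+ 2); apply: (snorm_null_eq aP Vx Vy).
have kn := kap_null em (-t) Vf Vg; rewrite !scaleNr !opprK in kn.
have Vtkg := memZ aP t Vkg; have Vtgg := memZ aP t VGg.
have Vz1 : V (kap (f + t *: g) - (kap f + t *: kap g)).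
  by apply: (memB aP) => //; exact: (memD aP).
have WGs : W k (G k f + t *: G k g) by rewrite addrC; exact: WP.
have VGs := WV k1 WGs.
have gn : na (G k f + t *: G k g - G k (f + t *: g)) = 0.
  apply: galerkin_null => // v Wv; have Vv := WV k1 Wv.
  by rewrite (siDl aP)// (siZl aP)// !galerkin_eq// (siDl bP)// (siZl bP).
have Vz2 := memB aP VGs VG.
have -> : kap (f + t *: g) - G k (f + t *: g) - (kap f - G k f + t *: (kap g - G k g)) =
    (kap (f + t *: g) - (kap f + t *: kap g)) + (G k f + t *: G k g - G k (f + t *: g)).
  rewrite scalerBr [kap f - G k f + _]addrACA -[- G k f - _]opprD.
  set p := kap f + _; set q := G k f + _.
  by rewrite opprB [q - p]addrC addrACA [X in _ + X]addrC.
apply/eqP; rewrite eq_le snorm_ge0 andbT.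
by apply: le_trans (snormD aP Vz1 Vz2) _; rewrite kn gn addr0.
Qed.

(** The quantity contracted by the algorithm, seen as a seminorm of the datum. *)
Definition total_error k f := Num.sqrt (err k f ^+ 2 + gam * eta k f ^+ 2).
Local Notation te := total_error.

Lemma total_quadratic k : (1 <= k)%N ->
  quadratic V (fun f => err k f ^+ 2 + gam * eta k f ^+ 2).
Proof.
move=> k1; have [h1 h2] := err_quadratic k1; have [h3 h4] := eta_quadratic k1.
split; first by move=> f Vf; rewrite addr_ge0 ?h1// mulr_ge0 ?h3// ltW.
by move=> f g Vf Vg; apply: pencilD; [exact: h2|apply: pencilZ; exact: h4].
Qed.

Let V0 : V 0. Proof. by case: aP. Qed.
Let VP c u v : V u -> V v -> V (c *: u + v). Proof. by case: aP => _ h _ _ _; exact: h. Qed.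

Lemma sqr_te k f : te k f ^+ 2 = err k f ^+ 2 + gam * eta k f ^+ 2.
Proof.
rewrite /total_error sqr_sqrtr//; apply: addr_ge0; first exact: sqr_ge0.
exact: mulr_ge0 (ltW gam0) (sqr_ge0 _).
Qed.

Lemma teZ k t f : (1 <= k)%N -> V f -> te k (t *: f) = `|t| * te k f.
Proof. by move=> k1 Vf; exact: (sqrt_quadraticZ V0 VP (total_quadratic k1)). Qed.

Lemma teD k f g : (1 <= k)%N -> V f -> V g -> te k (f + g) <= te k f + te k g.
Proof. by move=> k1 Vf Vg; exact: (sqrt_quadraticD VP (total_quadratic k1)). Qed.

Lemma etaZ k t f : (1 <= k)%N -> V f -> eta k (t *: f) = `|t| * eta k f.
Proof.
move=> k1 Vf; have := sqrt_quadraticZ V0 VP (eta_quadratic k1) t Vf.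
by rewrite !sqrtr_sqr !(ger0_norm (eta_ge0 _ _)).
Qed.

Lemma kapZ_null t f : V f -> na (kap (t *: f) - t *: kap f) = 0.
Proof.
move=> Vf; have Vk := kapV Vf; have V2 := kapV (memZ aP t Vf).
have Vtk := memZ aP t Vk; have Vz := memB aP V2 Vtk.
suff : a (kap (t *: f) - t *: kap f) (kap (t *: f) - t *: kap f) = 0.
  by rewrite /snorm => ->; rewrite sqrtr0.
rewrite (siBl aP V2 Vtk Vz) (siZl aP _ Vk Vz) (kapP (memZ aP t Vf) Vz) (kapP Vf Vz).
by rewrite (siZl bP _ Vf Vz) subrr.
Qed.

Lemma na_kapZr t f : V f -> na (kap (t *: f)) = `|t| * na (kap f).
Proof.
move=> Vf; have Vk := kapV Vf; rewrite -(snormZ aP)//.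
exact: (snorm_null_eq aP (kapV (memZ aP t Vf)) (memZ aP t Vk) (kapZ_null t Vf)).
Qed.

Lemma nd_kapZr t f : V f -> nd (kap (t *: f)) = `|t| * nd (kap f).
Proof.
move=> Vf; have Vk := kapV Vf; have Ve := em_mem em; have Vd := deflV em Vk.
have V2 := kapV (memZ aP t Vf); have Vtk := memZ aP t Vk.
rewrite -(snormZ aP _ Vd) -(deflZ em _ Vk).
apply: (snorm_null_eq aP (deflV em V2) (deflV em Vtk)).
rewrite -(deflB em V2 Vtk); apply/eqP; rewrite eq_le snorm_ge0 andbT.
by rewrite -(kapZ_null t Vf); exact: (nd_le em (memB aP V2 Vtk)).
Qed.

(** * Invariants of the adaptive iteration *)

(* Level [k] consists of the passes up to [jl k] of the inner loop, and [el k] is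
   the reference value with which its stopping test compares the estimator. The
   first datum is an eigenvector of the discrete problem for [mu]. *)
Variables (fbar ubar : nat -> nat -> X) (jl : nat -> nat) (el : nat -> R) (mu : R).
Local Notation uu k j := ((na (ubar k j))^-1 *: ubar k j).
Local Notation fl k := (fbar k (jl k)).
Local Notation ul k := (uu k (jl k)).

(** An eigensolve in the coarse space enriched by [u] is at least as good as the
    coarse space and as [u], and it gains a factor [eps] in the weak norm. *)
Definition esolved k u w :=
  [/\ W k w, na w = 1, nd w <= dl, nd w <= Cea * nd u &
      nb (defl a e0 w) <= Ce0 * eps * nd w].

Hypothesis f1W : W 1 (fl 1).
Hypothesis f1_eig : forall v, W 1 v -> a (fl 1) v = mu * b (fl 1) v.
Hypothesis f1_solved : esolved 1 (fl 1) (fl 1).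
Hypothesis f2E : fbar 2 0 = fl 1.
Hypothesis el2E : el 2 = eta 1 (fl 1).
Hypothesis ubarW : forall k j, (2 <= k)%N -> (j <= jl k)%N -> W k (ubar k j).
Hypothesis ubarP : forall k j, (2 <= k)%N -> (j <= jl k)%N ->
  forall v, W k v -> a (ubar k j) v = b (fbar k j) v.
Hypothesis inner_small : forall k j, (2 <= k)%N -> (j < jl k)%N ->
  eta k (fbar k j) <= theta2 ^+ j.+1 * el k.
Hypothesis inner_solved : forall k j, (2 <= k)%N -> (j < jl k)%N ->
  na (uu k j) = 1 -> esolved k (uu k j) (fbar k j.+1).
Hypothesis inner_last : forall k, (2 <= k)%N -> theta2 ^+ (jl k).+1 * el k < eta k (fl k).
Hypothesis outer_solved : forall k, (2 <= k)%N -> (0 < jl k)%N ->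
  (na (ul k) = 1 -> esolved k (ul k) (fbar k.+1 0)) /\ el k.+1 = eta k (fl k).
Hypothesis outer_plain : forall k, (2 <= k)%N -> jl k = 0%N ->
  fbar k.+1 0 = ul k /\ el k.+1 = el k.
Hypothesis contraction : forall k, (1 <= k)%N ->
  err k.+1 (fl k) ^+ 2 + gam * eta k.+1 (fl k) ^+ 2 <=
  alphah ^+ 2 * (err k (fl k) ^+ 2 + gam * eta k (fl k) ^+ 2).

Local Notation cw := (Cw ca l Cea Ce0 Can Cup gam alpha theta2).
Local Notation cwbar0 := (Cwbar0 ca l Cea Ce0 Can Cup gam alpha).
Local Notation cwu := (Cwu ca l Cea Ce0).

Let CL := Num.sqrt (1 + gam * C0 ^+ 2).

(* Each condition is linear in [dl] or in [eps], hence met by fine coarse meshes. *)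
Hypothesis small_dl : dl <= t0.
Hypothesis small_err : eps / ca <= t0 ^+ 2 / l.
Hypothesis small_init : 2 * l * (Ce0 / ca * eps) <= 1 / 2.
Hypothesis small_inner : cwu * eps <= theta2.
Hypothesis small_base : 2 * l * cwbar0 / ca ^+ 2 * eps <= Cup * theta2.
Hypothesis small_outer : cw * eps <= Cup.
Hypothesis small_compare : 4 * CL * (cw / Num.sqrt gam) * eps <= alpha - alphah.

Lemma aligned_err k f : (1 <= k)%N -> aligned f -> err k f <= t0 ^+ 2 / l.
Proof.
move=> k1 [Vf f1 _]; apply: le_trans (err_eps k1 Vf) _; apply: le_trans small_err.
by rewrite ler_wpM2l// (le_trans (nb_le em Vf))// f1 mul1r.
Qed.

Lemma solved_aligned k u w : (1 <= k)%N -> esolved k u w -> aligned w.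
Proof. by move=> k1 [Ww w1 wd _ _]; split=> //; [exact: WV Ww|exact: le_trans small_dl]. Qed.

Lemma ubar_aligned k j : (2 <= k)%N -> (j <= jl k)%N -> aligned (fbar k j) ->
  [/\ aligned (uu k j), W k (uu k j) &
    nd (uu k j) <= 2 * l * (Cup * eta k (fbar k j) + nd (kap (fbar k j)))].
Proof.
move=> k2 jk gf; have k1 := ltnW k2; have Vf : V (fbar k j) by case: gf.
have Wu := ubarW k2 jk; have Vu := WV k1 Wu.
have [ee _] := galerkin_solve_err k1 Vf Wu (ubarP k2 jk).
have ge := aligned_err k1 gf; rewrite -ee in ge.
have [gu _ _ hu] := aligned_step em gf Vu ge; split=> //; first exact: WZ.
apply: le_trans hu _; rewrite ler_wpM2l ?mulr_ge0 ?(ltW l0)// lerD2r ee.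
exact: err_up.
Qed.

Lemma ubar_unit k j : (2 <= k)%N -> (j <= jl k)%N -> aligned (fbar k j) -> na (uu k j) = 1.
Proof. by move=> k2 jk gf; have [[]] := ubar_aligned k2 jk gf. Qed.

Lemma solved_kap k u w x : (1 <= k)%N -> esolved k u w -> nd u <= x ->
  nd (kap w) <= Ce0 / ca * eps * (Cea * x).
Proof.
move=> k1 [Ww _ _ h1 h2] ux; apply: (weak_gain em (WV k1 Ww)) => //; first exact: ltW.
by apply: le_trans h1 _; rewrite ler_wpM2l// ltW.
Qed.

(** An eigensolve on top of a step whose direction error does not exceed the
    estimator turns the estimator bound into a direction error of higher order. *)
Lemma solved_gain k j w x : (2 <= k)%N -> (j <= jl k)%N -> aligned (fbar k j) ->
  esolved k (uu k j) w -> eta k (fbar k j) <= x -> nd (kap (fbar k j)) <= Cup * x ->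
  nd (kap w) <= cwu * eps * Cup * x.
Proof.
move=> k2 jk gf ew ex kx; have [_ _ hu] := ubar_aligned k2 jk gf.
have hu' : nd (uu k j) <= 2 * l * (Cup * x + Cup * x).
  apply: le_trans hu _; rewrite ler_wpM2l ?mulr_ge0 ?(ltW l0)// lerD//.
  by rewrite ler_wpM2l// ltW.
apply: le_trans (solved_kap (ltnW k2) ew hu') _.
by rewrite le_eqVlt; apply/orP; left; apply/eqP; rewrite /Cwu; ring.
Qed.

Let theta_ge0 j : 0 <= theta2 ^+ j. Proof. by rewrite exprn_ge0// ltW. Qed.

(** Each pass of the inner loop improves the bound of the direction error by the
    factor [theta2], as does the test that triggers it with the estimator. *)
Lemma inner_loop k : (2 <= k)%N -> aligned (fbar k 0) -> W k (fbar k 0) -> 0 <= el k ->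
  nd (kap (fbar k 0)) <= Cup * (theta2 * el k) ->
  forall j, (j <= jl k)%N -> [/\ aligned (fbar k j), W k (fbar k j) &
    nd (kap (fbar k j)) <= Cup * (theta2 ^+ j.+1 * el k)].
Proof.
move=> k2 g0 Wf0 ek x0; elim=> [|j IH] jk; first by rewrite expr1.
have [gf Wf xf] := IH (ltnW jk); have es := inner_solved k2 jk (ubar_unit k2 (ltnW jk) gf).
split; [exact: solved_aligned (ltnW k2) es|by case: es|].
apply: le_trans (solved_gain k2 (ltnW jk) gf es (inner_small k2 jk) xf) _.
have -> : cwu * eps * Cup * (theta2 ^+ j.+1 * el k) =
    cwu * eps * (Cup * (theta2 ^+ j.+1 * el k)) by ring.
have -> : Cup * (theta2 ^+ j.+2 * el k) = theta2 * (Cup * (theta2 ^+ j.+1 * el k)).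
  by rewrite exprS; ring.
by rewrite ler_wpM2r// !mulr_ge0// ltW.
Qed.

(** The first eigenvalue is the square of a ratio of the two norms. *)
Lemma ca2_le : ca ^+ 2 <= l.
Proof.
have Ve := em_mem em; have h := em_ca em Ve.
have n1 : na e0 = 1 by rewrite /snorm (em_norm em) sqrtr1.
have b1 : nb e0 ^+ 2 = l^-1.
  rewrite (sqr_snorm bP)//; apply: (mulfI (lt0r_neq0 l0)).
  by rewrite -(em_eig em)// (em_norm em) mulfV// gt_eqF.
rewrite n1 in h; have : (ca * nb e0) ^+ 2 <= 1.
  by rewrite -(expr1n _ 2) ler_pXn2r ?nnegrE ?mulr_ge0 ?snorm_ge0// ltW.
by rewrite exprMn b1 ler_pdivrMr// mul1r.
Qed.

Lemma cwu_gt0 : 0 < cwu.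
Proof. by rewrite /Cwu divr_gt0 ?mulr_gt0. Qed.

Let ratio_ge0 : 0 <= alpha / (1 - alpha).
Proof. by rewrite divr_ge0 ?subr_ge0 ?ltW// (lt_trans alphah0). Qed.

Let cww := Cww ca l Can.
Let cww_ge0 : 0 <= cww.
Proof. by rewrite /cww /Cww divr_ge0 ?mulr_ge0 ?ltW. Qed.

Let Cte := Num.sqrt (Cup ^+ 2 + gam).

Let Cte_ge0 : 0 <= Cte. Proof. exact: sqrtr_ge0. Qed.
Let CL_ge0 : 0 <= CL. Proof. exact: sqrtr_ge0. Qed.

Let Cte_sqr : Cte ^+ 2 = Cup ^+ 2 + gam.
Proof. by rewrite sqr_sqrtr// addr_ge0 ?sqr_ge0// ltW. Qed.
Let CL_sqr : CL ^+ 2 = 1 + gam * C0 ^+ 2.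
Proof. by rewrite sqr_sqrtr// addr_ge0// mulr_ge0 ?sqr_ge0// ltW. Qed.

Lemma cwbar0E : cwbar0 = cww * (alpha / (1 - alpha)) * Cte + 2 * cwu * Cup.
Proof. by rewrite /Cwbar0 /cww /Cte; ring. Qed.

Lemma cwbar0_ge0 : 0 <= cwbar0.
Proof.
rewrite cwbar0E; apply: addr_ge0; first exact: mulr_ge0 (mulr_ge0 cww_ge0 ratio_ge0) Cte_ge0.
exact: mulr_ge0 (mulr_ge0 (ler0n _ 2) (ltW cwu_gt0)) (ltW Cup0).
Qed.

Lemma cw_ge1 : Cw1 ca l Ce0 Cup <= cw. Proof. by rewrite /Cw le_max lexx. Qed.

Lemma cw_ge2 : cwu * Cup / theta2 <= cw.
Proof.
apply: (@le_trans _ _ (8 * cwu * l * Cup / (theta2 * ca ^+ 2))).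
  have -> : 8 * cwu * l * Cup / (theta2 * ca ^+ 2) =
      8 * (l / ca ^+ 2) * (cwu * Cup / theta2).
    by field; rewrite !gt_eqF.
  have p : 0 <= cwu * Cup / theta2 := divr_ge0 (mulr_ge0 (ltW cwu_gt0) (ltW Cup0)) (ltW theta20).
  rewrite -[leLHS]mul1r ler_wpM2r//.
  have : 1 <= l / ca ^+ 2 by rewrite ler_pdivlMr ?exprn_gt0// mul1r ca2_le.
  by lra.
by rewrite /Cw /Cw2 !le_max lexx !orbT.
Qed.

Lemma cw_ge3 : 2 * cwbar0 * l / (theta2 * ca ^+ 2) <= cw.
Proof. by rewrite /Cw /Cwbar !le_max lexx !orbT. Qed.

Lemma cw_ge0 : 0 <= cw.
Proof.
by apply: le_trans cw_ge1; rewrite /Cw1 divr_ge0 ?mulr_ge0 ?ltW.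
Qed.

(** The relative direction error of the first iterate of a level, and the
    estimator-based quantity of a level, both made invariant under scaling. *)
Let rdir k := nd (kap (fbar k 0)) / na (kap (fbar k 0)).
Let rte k := te k (fl k) / na (kap (fl k)).

(** The second summand anticipates the whole remaining geometric series of
    Galerkin errors, so that the sum cannot increase while no level is closed. *)
Let potential k := rdir k + cww * eps * (alpha / (1 - alpha)) * rte k.-1.

Lemma te_le k f : (1 <= k)%N -> V f -> te k f <= Cte * eta k f.
Proof.
move=> k1 Vf; have p : 0 <= Cte * eta k f by rewrite mulr_ge0.
rewrite -(ger0_norm p) -sqrtr_sqr ler_wsqrtr// [leRHS]exprMn Cte_sqr.
rewrite mulrDl lerD2r -exprMn ler_pXn2r ?nnegrE ?snorm_ge0 ?mulr_ge0 ?(ltW Cup0)//.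
exact: err_up.
Qed.

Lemma err_le_te k f : err k f <= te k f.
Proof.
rewrite -[leLHS](@ger0_norm _ (err k f)) ?snorm_ge0// -sqrtr_sqr ler_wsqrtr//.
by rewrite lerDl mulr_ge0 ?sqr_ge0// ltW.
Qed.

Lemma eta_le_te k f : eta k f <= te k f / Num.sqrt gam.
Proof.
rewrite ler_pdivlMr ?sqrtr_gt0// mulrC -[eta k f]ger0_norm// -sqrtr_sqr.
by rewrite -sqrtrM ?(ltW gam0)// ler_wsqrtr// lerDr sqr_ge0.
Qed.

(** Stability on discrete data: this allows two data of small difference to be
    compared through their total errors. *)
Lemma te_le_kap k f : (1 <= k)%N -> W k f -> te k f <= CL * na (kap f).
Proof.
move=> k1 Wf; have Vf := WV k1 Wf; have Vk := kapV Vf.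
have p : 0 <= CL * na (kap f) by rewrite mulr_ge0 ?snorm_ge0.
rewrite -(ger0_norm p) -sqrtr_sqr ler_wsqrtr// [leRHS]exprMn CL_sqr.
rewrite mulrDl mul1r lerD//.
  rewrite ler_pXn2r ?nnegrE ?snorm_ge0//.
  have [h _] := snorm_galerkin aP (WV k1) (@WB k) (@W0 k) Vk (GW k1 Vf) (GP k1 Vf).
  exact: h.
rewrite -mulrA ler_wpM2l ?(ltW gam0)// -exprMn ler_pXn2r ?nnegrE ?mulr_ge0 ?snorm_ge0//.
exact: eta_low.
Qed.

(** A level is closed: the direction error of the next datum is a higher order
    term relative to the estimator, which becomes the new reference value. *)
Lemma potential_start k : (1 <= k)%N -> aligned (fl k) -> aligned (fbar k.+1 0) ->
  nd (kap (fbar k.+1 0)) <= 2 * cwu * eps * Cup * eta k (fl k) ->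
  potential k.+1 <= 2 * l * eps * cwbar0 * eta k (fl k).
Proof.
move=> k1 gf gf' hx; have [_ _ n3 n4 _] := aligned_kap em gf'.
have [_ _ m3 m4 _] := aligned_kap em gf; have Vf : V (fl k) by case: gf.
rewrite cwbar0E /potential /=.
have h1 : rdir k.+1 <= 2 * l * (2 * cwu * eps * Cup * eta k (fl k)).
  rewrite /rdir mulrC; apply: ler_pM => //; rewrite ?invr_ge0 ?snorm_ge0//.
have h2 : rte k <= 2 * l * (Cte * eta k (fl k)).
  rewrite /rte mulrC; apply: ler_pM => //; rewrite ?invr_ge0 ?snorm_ge0 ?sqrtr_ge0//.
  exact: te_le.
have c0 : 0 <= cww * eps * (alpha / (1 - alpha)) by rewrite (mulr_ge0 (mulr_ge0 cww_ge0 eps0)).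
apply: le_trans (lerD h1 (ler_wpM2l c0 h2)) _.
by rewrite le_eqVlt; apply/orP; left; apply/eqP; ring.
Qed.

(** The first datum is a multiple of its own Galerkin solution. Its direction error
    is therefore at most the Galerkin error, up to the direction error of its
    image under [kap], which is a small fraction of the left-hand side. *)
Lemma f1_bounds : [/\ aligned (fl 1), nd (kap (fl 1)) <= cw * eps * eta 1 (fl 1) &
  nd (kap (fl 1)) <= cwu * eps * Cup * eta 1 (fl 1)].
Proof.
set f := fl 1; have gf : aligned f by exact: solved_aligned f1_solved.
have [Vf f1 ft] := gf; have [_ _ _ hC hb] := f1_solved; rewrite -/f in hC hb.
have Vk := kapV Vf; have [q0 qt t00 t04] := tol_bounds em.
have Ve := em_mem em; have Vd := deflV em Vf; have V1 : V f := Vf.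
have cf := aligned_coef em gf.
(* The component of [f] along the eigenvector bounds the weak norm from below,
   and with it the discrete eigenvalue from above. *)
have bff : 1 / (2 * l) <= b f f.
  have Vce := memZ aP (a f e0) Ve.
  have E : b f f = (a f e0) ^+ 2 / l + b (defl a e0 f) (defl a e0 f).
    have bee : b e0 e0 = l^-1.
      apply: (mulfI (lt0r_neq0 l0)).
      by rewrite -(em_eig em)// (em_norm em) mulfV// gt_eqF.
    have -> : b f f = b (defl a e0 f + a f e0 *: e0) (defl a e0 f + a f e0 *: e0).
      by rewrite /defl subrK.
    rewrite (si_pencil bP)// (si_sym bP Vd Ve) (b_e0_defl em)// bee; ring.
  rewrite E; have := si_ge0 bP Vd; suff : 1 / (2 * l) <= a f e0 ^+ 2 / l by lra.
  rewrite mul1r invfM ler_pM2r ?invr_gt0// -real_normK ?num_real//.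
  have : (3 / 4) ^+ 2 <= `|a f e0| ^+ 2 by rewrite ler_pXn2r ?nnegrE//; lra.
  by rewrite expr2; lra.
have mub : mu * b f f = 1 by rewrite -(f1_eig f1W) -(sqr_snorm aP)// f1 expr1n.
have bp : 0 < b f f by apply: lt_le_trans bff; rewrite divr_gt0 ?mulr_gt0.
have mu0 : 0 < mu by rewrite -(pmulr_lgt0 _ bp) mub.
have mul : mu <= 2 * l.
  have : mu * (1 / (2 * l)) <= mu * b f f by rewrite ler_pM2l.
  by rewrite mub mul1r ler_pdivrMr ?mulr_gt0// mul1r.
have Wg : W 1 (mu^-1 *: f) by exact: WZ.
have Vg := WV (leqnn 1) Wg.
have gP v : W 1 v -> a (mu^-1 *: f) v = b f v.
  move=> Wv; have Vv := WV (leqnn 1) Wv.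
  by rewrite (siZl aP)// f1_eig// mulKf// gt_eqF.
have [ge _] := galerkin_solve_err (leqnn 1) Vf Wg gP.
have x1 : nd (kap f) <= Ce0 / ca * eps * nd f.
  by apply: (weak_gain em Vf _ eps0 hb (lexx _)); exact: ltW.
have ndf : nd f <= 2 * l * (Cup * eta 1 f + nd (kap f)).
  have -> : nd f = mu * nd (mu^-1 *: f).
    rewrite (deflZ em)// (snormZ aP)// ger0_norm ?invr_ge0 ?(ltW mu0)//.
    by rewrite mulrA mulfV ?mul1r// gt_eqF.
  apply: ler_pM; rewrite ?snorm_ge0 ?(ltW mu0)//.
  rewrite -[X in defl _ _ X](subKr (kap f)) (deflB em)//; last exact: (memB aP Vk Vg).
  have Vkg := memB aP Vk Vg.
  apply: le_trans (snormB aP (deflV em Vk) (deflV em Vkg)) _.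
  rewrite addrC lerD2r; apply: le_trans (nd_le em Vkg) _.
  by rewrite ge; exact: err_up.
have c0 : 0 <= Ce0 / ca * eps := mulr_ge0 (divr_ge0 (ltW Ce00) (ltW ca0)) eps0.
have ndf' : nd f <= 4 * l * Cup * eta 1 f.
  have h1 : 2 * l * nd (kap f) <= 2 * l * (Ce0 / ca * eps * nd f).
    by rewrite ler_wpM2l ?mulr_ge0 ?(ltW l0).
  have h2 : 2 * l * (Ce0 / ca * eps) * nd f <= 1 / 2 * nd f.
    by rewrite ler_wpM2r ?snorm_ge0.
  rewrite mulrA in h1; move: ndf h1 h2; rewrite mulrDr.
  move: (nd f) (nd (kap f)) => p1 p2.
  have -> : 2 * l * (Ce0 / ca * eps) * p1 = 2 * l * (Ce0 / ca * eps * p1) by ring.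
  rewrite mulrA; lra.
split=> //.
  apply: le_trans x1 _.
  apply: (@le_trans _ _ (Cw1 ca l Ce0 Cup * eps * eta 1 f)); last first.
    by rewrite ler_wpM2r ?eta_ge0// ler_wpM2r// cw_ge1.
  have -> : Cw1 ca l Ce0 Cup * eps * eta 1 f = Ce0 / ca * eps * (4 * l * Cup * eta 1 f).
    by rewrite /Cw1; ring.
  by rewrite ler_wpM2l.
apply: le_trans x1 _.
have -> : cwu * eps * Cup * eta 1 f = Ce0 / ca * eps * (Cea * (4 * l * Cup * eta 1 f)).
  by rewrite /Cwu; ring.
rewrite ler_wpM2l//; apply: le_trans hC _.
by rewrite ler_wpM2l// ltW.
Qed.

(** On each level the direction error is of higher order relative to the
    estimator: either the reference value of the level was not undercut at the
    first pass, and the potential bounds the error, or the last eigensolve of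
    the inner loop gains a factor. *)
Lemma level_bound k : (2 <= k)%N -> aligned (fbar k 0) -> W k (fbar k 0) -> 0 <= el k ->
  rdir k <= 2 * l * eps * cwbar0 * el k ->
  [/\ aligned (fl k), W k (fl k) & nd (kap (fl k)) <= cw * eps * eta k (fl k)].
Proof.
move=> k2 g0 Wf0 ek yk; have [_ _ _ n4 n5] := aligned_kap em g0.
have x0 : nd (kap (fbar k 0)) <= 2 * l * cwbar0 / ca ^+ 2 * eps * el k.
  have -> : nd (kap (fbar k 0)) = na (kap (fbar k 0)) * rdir k.
    by rewrite /rdir mulrCA mulfV ?mulr1// gt_eqF.
  have -> : 2 * l * cwbar0 / ca ^+ 2 * eps * el k =
      1 / ca ^+ 2 * (2 * l * eps * cwbar0 * el k) by ring.
  apply: ler_pM => //; first exact: snorm_ge0.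
  by rewrite /rdir divr_ge0 ?snorm_ge0.
have lastk := inner_last k2.
have [j0|jp] := posnP (jl k).
  move: lastk; rewrite j0 expr1 => lastk; split=> //; apply: le_trans x0 _.
  apply: (@le_trans _ _ (2 * cwbar0 * l / (theta2 * ca ^+ 2) * eps * (theta2 * el k))).
    by rewrite le_eqVlt; apply/orP; left; apply/eqP; field; rewrite !gt_eqF.
  have c0 : 0 <= 2 * cwbar0 * l / (theta2 * ca ^+ 2).
    apply: divr_ge0; first exact: mulr_ge0 (mulr_ge0 (ler0n _ 2) cwbar0_ge0) (ltW l0).
    by rewrite mulr_ge0 ?exprn_ge0 ?ltW.
  apply: ler_pM; [exact: mulr_ge0 c0 eps0|exact: mulr_ge0 (ltW theta20) ek| |exact: ltW].
  by rewrite ler_wpM2r// cw_ge3.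
have base : nd (kap (fbar k 0)) <= Cup * (theta2 * el k).
  by apply: le_trans x0 _; rewrite mulrA ler_wpM2r.
have H := inner_loop k2 g0 Wf0 ek base.
have [gf Wf _] := H _ (leqnn (jl k)); split=> //.
have jk : ((jl k).-1 < jl k)%N by rewrite prednK.
have [gp Wp xp] := H _ (ltnW jk).
have es := inner_solved k2 jk (ubar_unit k2 (ltnW jk) gp); have sm := inner_small k2 jk.
rewrite prednK// in es xp sm.
apply: le_trans (solved_gain k2 (ltnW jk) gp es sm xp) _.
apply: (@le_trans _ _ (cwu * Cup / theta2 * eps * (theta2 ^+ (jl k).+1 * el k))).
  rewrite le_eqVlt exprS; apply/orP; left; apply/eqP; field; rewrite gt_eqF//.
have p : 0 <= cwu * Cup / theta2 := divr_ge0 (mulr_ge0 (ltW cwu_gt0) (ltW Cup0)) (ltW theta20).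
apply: ler_pM; [exact: mulr_ge0 p eps0|exact: mulr_ge0 (theta_ge0 _) ek| |exact: ltW].
by rewrite ler_wpM2r// cw_ge2.
Qed.

(** Contraction from one level to the next. The data of the two levels differ,
    but after normalisation and up to sign only by their direction errors, which
    are of higher order; the slack between [alphah] and [alpha] absorbs them. *)
Lemma level_contraction k : (1 <= k)%N -> aligned (fl k) -> W k (fl k) ->
  nd (kap (fl k)) <= cw * eps * eta k (fl k) ->
  aligned (fl k.+1) -> W k.+1 (fl k.+1) ->
  nd (kap (fl k.+1)) <= cw * eps * eta k.+1 (fl k.+1) -> rte k.+1 <= alpha * rte k.
Proof.
move=> k1 g1 W1 x1 g2 W2 x2.
have [_ _ _ p1 _] := aligned_kap em g1; have [_ _ _ p2 _] := aligned_kap em g2.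
have [V1 _ _] := g1; have [V2 _ _] := g2.
pose f1 := (na (kap (fl k)))^-1 *: fl k; pose f2 := (na (kap (fl k.+1)))^-1 *: fl k.+1.
have Vf1 : V f1 := memZ aP _ V1; have Vf2 : V f2 := memZ aP _ V2.
have Vk1 := kapV Vf1; have Vk2 := kapV Vf2.
have i1 : 0 <= (na (kap (fl k)))^-1 by rewrite invr_ge0 ltW.
have i2 : 0 <= (na (kap (fl k.+1)))^-1 by rewrite invr_ge0 ltW.
have n1 : na (kap f1) = 1 by rewrite na_kapZr// ger0_norm// mulVf// gt_eqF.
have n2 : na (kap f2) = 1 by rewrite na_kapZr// ger0_norm// mulVf// gt_eqF.
have ne1 : rte k = te k f1 by rewrite teZ// ger0_norm// mulrC.
have ne2 : rte k.+1 = te k.+1 f2 by rewrite teZ// ger0_norm// mulrC.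
pose s := cw * eps / Num.sqrt gam.
have s0 : 0 <= s by rewrite divr_ge0 ?sqrtr_ge0// mulr_ge0 ?cw_ge0.
have dir k' f N : 0 <= N^-1 -> nd (kap f) <= cw * eps * eta k' f ->
    N^-1 * nd (kap f) <= s * (N^-1 * te k' f).
  move=> N0 hx; rewrite mulrCA ler_wpM2l// (le_trans hx)//.
  have -> : s * te k' f = cw * eps * (te k' f / Num.sqrt gam) by rewrite /s; ring.
  by rewrite ler_wpM2l ?eta_le_te// mulr_ge0 ?cw_ge0.
have d1 : nd (kap f1) <= s * rte k.
  by rewrite nd_kapZr// ger0_norm// /rte [te _ _ / _]mulrC; exact: dir.
have d2 : nd (kap f2) <= s * rte k.+1.
  by rewrite nd_kapZr// ger0_norm// /rte [te _ _ / _]mulrC; exact: dir.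
have [sg sg1 hsg] := unit_compare em Vk1 Vk2 n1 n2.
have Wf1 : W k.+1 f1 by apply: WZ; exact: WS.
have Wf2 : W k.+1 f2 by exact: WZ.
have Vsf1 := memZ aP sg Vf1; have Wd : W k.+1 (f2 - sg *: f1) by apply: WB => //; exact: WZ.
have Vd := memB aP Vf2 Vsf1.
have hd : te k.+1 (f2 - sg *: f1) <= CL * (2 * (s * rte k + s * rte k.+1)).
  apply: le_trans (te_le_kap _ Wd) _ => //; rewrite ler_wpM2l//.
  have Vz := kapV Vd; have Vz' := memB aP Vk2 (memZ aP sg Vk1).
  rewrite (snorm_null_eq aP Vz Vz' (kap_null em sg Vf2 Vf1)) (le_trans hsg)//.
  by rewrite ler_wpM2l// lerD.
have h1 : te k.+1 (sg *: f1) <= alphah * rte k.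
  rewrite teZ// sg1 mul1r teZ// ger0_norm// /rte [te k _ / _]mulrC mulrCA ler_wpM2l//.
  have p : 0 <= alphah * te k (fl k) by rewrite mulr_ge0 ?sqrtr_ge0// ltW.
  rewrite -(ger0_norm p) -sqrtr_sqr ler_wsqrtr// [leRHS]exprMn sqr_te.
  exact: contraction.
have h2 : rte k.+1 <= alphah * rte k + CL * (2 * (s * rte k + s * rte k.+1)).
  rewrite {1}ne2 -[X in te _ X](addrNK (sg *: f1)) [X in te _ X]addrC.
  by apply: le_trans (teD _ Vsf1 Vd) _ => //; rewrite lerD.
have cs : 2 * (2 * CL * s) <= alpha - alphah.
  apply: le_trans small_compare; rewrite le_eqVlt; apply/orP; left; apply/eqP.
  by rewrite /s; ring.
have z0 : 0 <= 2 * CL * s := mulr_ge0 (mulr_ge0 (ler0n _ 2) CL_ge0) s0.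
have nk0 : 0 <= rte k by rewrite ne1 sqrtr_ge0.
have nk1 : 0 <= rte k.+1 by rewrite ne2 sqrtr_ge0.
move: h2; have -> : CL * (2 * (s * rte k + s * rte k.+1)) =
   2 * CL * s * rte k + 2 * CL * s * rte k.+1 by ring.
exact: absorb alphah0 alpha1 z0 cs nk0.
Qed.

(** The bound of the potential yields the direction error of a level, two direction
    errors yield the contraction, and the contraction pays for the Galerkin error
    that the next iterate adds to the potential. *)
Lemma algorithm_invariant k : (1 <= k)%N ->
  [/\ [/\ aligned (fl k), W k (fl k) & nd (kap (fl k)) <= cw * eps * eta k (fl k)],
      [/\ aligned (fbar k.+1 0), W k.+1 (fbar k.+1 0) & 0 <= el k.+1],
      potential k.+1 <= 2 * l * eps * cwbar0 * el k.+1 &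
      (2 <= k)%N -> rte k <= alpha * rte k.-1].
Proof.
case: k => // k _; elim: k => [|k [[gf Wf xf] [gn Wn ek] pot _]].
  have [g1 x1 x1'] := f1_bounds; split=> //.
    by rewrite f2E el2E; split=> //; exact: WS.
  rewrite el2E; apply: potential_start => //; rewrite f2E//.
  apply: le_trans x1' _; rewrite ler_wpM2r// ler_wpM2r ?(ltW Cup0)// ler_wpM2r//.
  by have := cwu_gt0; lra.
have k2 : (2 <= k.+2)%N by [].
have c0 : 0 <= cww * eps * (alpha / (1 - alpha)) by rewrite (mulr_ge0 (mulr_ge0 cww_ge0 eps0)).
have nk0 i : 0 <= rte i by rewrite /rte divr_ge0 ?sqrtr_ge0 ?snorm_ge0.
have yk : rdir k.+2 <= 2 * l * eps * cwbar0 * el k.+2.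
  by apply: le_trans pot; rewrite /potential lerDl mulr_ge0.
have [gf' Wf' xf'] := level_bound k2 gn Wn ek yk.
have ulE := ubar_unit k2 (leqnn _) gf'.
have ctr := level_contraction (ltn0Sn k) gf Wf xf gf' Wf' xf'.
split=> //.
  have [j0|jp] := posnP (jl k.+2).
    have [-> ->] := outer_plain k2 j0.
    by have [gu Wu _] := ubar_aligned k2 (leqnn _) gf'; split=> //; exact: WS.
  have [/(_ ulE) es ->] := outer_solved k2 jp; split=> //.
    exact: solved_aligned es.
  by apply: WS => //; case: es.
have [j0|jp] := posnP (jl k.+2); last first.
  have [/(_ ulE) es elE] := outer_solved k2 jp; rewrite elE; apply: potential_start => //.
    exact: solved_aligned es.
  have xs : nd (kap (fl k.+2)) <= Cup * eta k.+2 (fl k.+2).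
    by apply: le_trans xf' _; rewrite ler_wpM2r.
  apply: le_trans (solved_gain k2 (leqnn _) gf' es (lexx _) xs) _.
  rewrite ler_wpM2r// ler_wpM2r ?(ltW Cup0)// ler_wpM2r//.
  by have := cwu_gt0; lra.
have [fE elE] := outer_plain k2 j0; rewrite elE; apply: le_trans pot.
have Vf : V (fl k.+2) by case: gf'.
have Wu := ubarW k2 (leqnn (jl k.+2)); have Vu := WV (ltnW k2) Wu.
have [ea eb] := galerkin_solve_err (ltnW k2) Vf Wu (ubarP k2 (leqnn _)).
have ge := aligned_err (ltnW k2) gf'; rewrite -ea in ge.
have gw := err_weak (ltnW k2) Vf; rewrite -eb -ea in gw.
have d0 : 0 <= Can * eps by rewrite mulr_ge0// ltW.
have := chain_step em gf' Vu ge gw d0; rewrite ea => chain.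
have yE : rdir k.+2 = nd (kap (fl k.+2)) / na (kap (fl k.+2)) by rewrite /rdir j0.
have h1 : rdir k.+3 <= rdir k.+2 + cww * eps * rte k.+2.
  rewrite {1}/rdir fE; apply: le_trans chain _; rewrite yE lerD2l.
  have -> : 2 * l * (Can * eps) / ca = cww * eps by rewrite /cww /Cww; ring.
  apply: ler_wpM2l; first exact: mulr_ge0.
  by apply: ler_wpM2r; [rewrite invr_ge0 snorm_ge0|exact: err_le_te].
rewrite /potential /=.
have a10 : 0 < 1 - alpha by rewrite subr_gt0.
have ce0 : 0 <= cww * eps by rewrite mulr_ge0.
have h2 : cww * eps * rte k.+2 + cww * eps * (alpha / (1 - alpha)) * rte k.+2 <=
    cww * eps * (alpha / (1 - alpha)) * rte k.+1.
  have -> : cww * eps * rte k.+2 + cww * eps * (alpha / (1 - alpha)) * rte k.+2 =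
      cww * eps / (1 - alpha) * rte k.+2 by field; rewrite gt_eqF.
  have -> : cww * eps * (alpha / (1 - alpha)) * rte k.+1 =
      cww * eps / (1 - alpha) * (alpha * rte k.+1) by field; rewrite gt_eqF.
  by rewrite ler_wpM2l// divr_ge0// ltW.
apply: le_trans (lerD h1 (lexx _)) _.
by rewrite -addrA lerD2l.
Qed.

Theorem adaptive_iteration k : (1 <= k)%N ->
  [/\ V (fl k), 0 < na (kap (fl k)), nd (kap (fl k)) <= cw * eps * eta k (fl k) &
    te k.+1 (fl k.+1) / na (kap (fl k.+1)) <= alpha * (te k (fl k) / na (kap (fl k)))].
Proof.
move=> k1; have [[gf _ xf] _ _ _] := algorithm_invariant k1.
have [_ _ _ ctr] := algorithm_invariant (ltn0Sn k).
have [_ _ _ p _] := aligned_kap em gf; split=> //; first by case: gf.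
exact: ctr.
Qed.
End inverse_iteration.

(** * Runs of the adaptive algorithm *)

Lemma common_threshold (R : realType) (s : seq (R * R)) : all (fun p => 0 < p.2) s ->
  exists2 e : R, 0 < e & forall x, 0 <= x <= e -> all (fun p => p.1 * x <= p.2) s.
Proof.
elim: s => [_|[C B] s IH /= /andP[B0 /IH[e e0 he]]]; first by exists 1.
have c0 : 0 < `|C| + 1 by rewrite ltr_wpDl.
exists (Num.min e (B / (`|C| + 1))); first by rewrite lt_min e0 divr_gt0.
move=> x; rewrite le_min => /andP[x0 /andP[xe xB]]; rewrite he ?x0// andbT.
move: xB; rewrite ler_pdivlMr// => xB; apply: le_trans xB.
by rewrite mulrC ler_wpM2l// (le_trans (ler_norm C))// lerDl.
Qed.

Section adaptive_run.
Variables (R : realType) (n : nat) (pb : problem R n) (m : nat) (gstar ca : R).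
Variables (lam : nat -> R) (uh : nat -> sob R n).
Variables (K : ('rV[R]_n.+1 -> R) -> sob R n) (E : sob R n -> sob R n).
Variables (Rk : mesh R n -> sob R n -> sob R n).
Variables (P : element R n -> ('rV[R]_n.+1 -> R) -> 'rV[R]_n.+1 -> R).
Variables (bis : element R n -> element R n * element R n).
Variables (theta1 theta2 Cea Ce0 Can Cup Clow Coa gam alphah alpha : R).
Local Notation D := (dom pb).
Local Notation V := (H10 D).
Local Notation l := (lam 0%N).
Local Notation na := (norm_a pb).
Local Notation a := (form_a pb).
Local Notation b := (form_0 pb).
Local Notation e0 := (uh 0%N).
Local Notation nd u := (snorm a (defl a e0 u)).
Local Notation fe := (fe_space pb m).
Hypothesis vp : valid_problem pb.
Hypothesis ca0 : 0 < ca.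
Hypothesis ca_norm1 : forall w, V w -> ca * norm1 D w <= na w.
Hypothesis eigP : eigen_system pb lam uh.
Hypothesis KP : solution_operator pb K.
Hypothesis EP : a_projection pb (eigenspace_of pb l) E.
Hypothesis RP : forall M, admissible D gstar M -> galerkin pb (fe M) (Rk M).
Hypothesis oscP : osc_property pb P m gstar.
Hypotheses (theta20 : 0 < theta2).
Hypotheses (Cea0 : 0 < Cea) (Ce00 : 0 < Ce0) (Can0 : 0 < Can) (Cup0 : 0 < Cup).
Hypotheses (Clow0 : 0 < Clow) (Coa0 : 0 < Coa) (gam0 : 0 < gam).
Hypotheses (alphah0 : 0 < alphah) (alpha_gt : alphah < alpha) (alpha1 : alpha < 1).

Let em := pde_model vp ca0 ca_norm1 eigP KP.
Let aP := form_a_semi_inner vp.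
Let bP := form_0_semi_inner vp.
Implicit Types (f g u v w : sob R n) (M : mesh R n) (k j : nat).

Lemma eta_ge0 M f : 0 <= eta pb K Rk M f.1.
Proof. exact: sqrtr_ge0. Qed.

#[local] Opaque form_a ip0 norm0 H10 eta_on.

Let solV f : V f -> V (K f.1). Proof. exact: (em_kapV em). Qed.
Let feV M : fe M `<=` V. Proof. exact: fe_H10. Qed.
Let feP M c u v : fe M u -> fe M v -> fe M (c *: u + v). Proof. exact: fe_lin. Qed.
Let feB M u v : fe M u -> fe M v -> fe M (u - v).
Proof. by move=> fu fv; rewrite addrC -scaleN1r; exact: feP. Qed.
Let feZ M c u : fe M u -> fe M (c *: u).
Proof. by move=> fu; rewrite -[_ *: _]addr0; apply: feP => //; exact: fe0. Qed.

Let H10_L2 u : V u -> inL2 D u.1. Proof. by case/H10_L2sob. Qed.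

Lemma galerkin_mem M f : admissible D gstar M -> V f -> fe M (Rk M (K f.1)).
Proof. by move=> adM Vf; have [] := RP adM (solV Vf). Qed.

Lemma galerkin_orth M f v : admissible D gstar M -> V f -> fe M v ->
  a (K f.1 - Rk M (K f.1)) v = 0.
Proof. by move=> adM Vf fv; have [_ h] := RP adM (solV Vf); exact: h. Qed.

(** Galerkin solutions are determined pointwise, although the projection [Rk]
    and the operator [K] are only given up to functions of zero energy. *)
Lemma galerkin_pointwise M f w : admissible D gstar M -> V f -> fe M w ->
  (forall v, fe M v -> a w v = b f v) ->
  forall x, closure D x -> w.1 x = (Rk M (K f.1)).1 x.
Proof.
move=> adM Vf fw hw x cx; have fG := galerkin_mem adM Vf; have fz := feB fw fG.
have z : snorm a (w - Rk M (K f.1)) = 0.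
  apply: (@galerkin_null _ _ _ _ _ _ _ _ _ _ em (fun=> fe M) (fun _ f => Rk M (K f.1))
    (fun _ _ => @feV M) (fun _ => @feP M) (fun _ f _ => @galerkin_mem M f adM)
    (fun _ f _ Vf v => @galerkin_orth M f v adM Vf) 1) => //.
have z0 : norm0 D (w - Rk M (K f.1)).1 = 0 by exact: (null_b em (feV fz) z).
exact: (subr0_eq (fe_null vp fz z0 cx)).
Qed.

Lemma eta_quadratic M : admissible D gstar M -> quadratic V (fun f => eta pb K Rk M f.1 ^+ 2).
Proof.
move=> adM; have [trM _] := adM; split; first by move=> f _; exact: sqr_ge0.
move=> f g Vf Vg; have fGf := galerkin_mem adM Vf; have fGg := galerkin_mem adM Vg.
have [C hC] := eta_on_pencil vp trM (H10_L2 Vf) (H10_L2 Vg) fGf fGg.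
exists C => t; rewrite /eta /eta_sub -(hC t).
have Vfg : V (f + t *: g) := memD aP Vf (memZ aP t Vg).
have fw : fe M (Rk M (K f.1) + t *: Rk M (K g.1)) by rewrite addrC; exact: feP.
apply: (congr1 (fun x => x ^+ 2)); apply/esym.
apply: (eq_eta_on (f + t *: g).1 trM) => x cx.
apply: (galerkin_pointwise adM Vfg fw _ cx) => v fv; have Vv := feV fv.
have VGf := feV fGf; have VGg := feV fGg.
have gE h : V h -> a (Rk M (K h.1)) v = b h v.
  move=> Vh; exact: (@galerkin_eq _ _ _ _ _ _ _ _ _ _ em (fun=> fe M) (fun _ f => Rk M (K f.1))
    (fun _ _ => @feV M) (fun _ f _ => @galerkin_mem M f adM)
    (fun _ f _ Vf v => @galerkin_orth M f v adM Vf) 1 h v (leqnn 1) Vh fv).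
rewrite (siDl aP VGf (memZ aP t VGg) Vv) (siZl aP t VGg Vv) (gE _ Vf) (gE _ Vg).
by rewrite (siDl bP Vf (memZ bP t Vg) Vv) (siZl bP t Vg Vv).
Qed.

Section fixed_run.
Variables (MH : mesh R n) (r : run R n).
Hypothesis alg : algorithmC pb m gstar bis theta1 theta2 MH r.
Hypothesis est : run_estimates pb K Rk E P m l MH r Cea Ce0 Can Cup Clow Coa gam alphah.
Local Notation W := (fun k => fe (msh r k)).
Local Notation eps := (eta_a pb K (fe MH)).
Local Notation dl := (Cea * delta_a pb l (fe MH)).

Lemma run_admissible k : (1 <= k)%N -> admissible D gstar (msh r k).
Proof. by case: alg => _ h _ _ /h[]. Qed.

Lemma run_nested k : (1 <= k)%N -> fe (msh r k) `<=` fe (msh r k.+1).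
Proof. by case: alg => _ h _ _ /h[_]; exact: fe_nested. Qed.

Lemma coarse_sub k : (1 <= k)%N -> fe MH `<=` fe (msh r k).
Proof.
case: k => // k _; elim: k => [|k IH].
  by apply: fe_nested; case: alg => _ _ [].
by move=> v /IH; exact: run_nested.
Qed.

(** Both approximation quantities decrease when the space grows, so that the
    estimates for the eigensolve may be stated with the coarse space. *)
Lemma esolve_solved (Wd : set (sob R n)) k u lt w : fe MH `<=` Wd ->
  Wd `<=` fe (msh r k) -> (forall c, Wd (c *: u)) -> V u -> na u = 1 ->
  eigen_approx pb K E l Cea Ce0 Wd -> ESOLVE pb Wd lt w ->
  esolved a b e0 W eps dl Cea Ce0 k u w.
Proof.
move=> HW Wk Wu Vu u1 ap es; have [h1 h2] := ap _ _ es.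
case: es => -[Ww w1 _] _; have fw := Wk _ Ww; have Vw := feV fw.
have [d1 d2] := defl_projection vp ca0 ca_norm1 eigP KP EP Vw.
rewrite d1 d2 in h2; rewrite d1 in h1.
have H0 := fe0 m vp MH.
split; [exact: fw|exact: w1| | |].
- apply: (le_trans h1); rewrite (ler_pM2l Cea0); exact: delta_a_sub.
- apply: (le_trans h1); rewrite (ler_pM2l Cea0).
  exact: (delta_a_le vp ca0 ca_norm1 eigP KP Wu Vu u1).
- apply: (le_trans h2); apply: ler_wpM2r; first exact: snorm_ge0.
  rewrite (ler_pM2l Ce00); exact: (eta_a_sub vp ca0 ca_norm1 eigP KP H0 HW).
Qed.

Lemma add_span_sub k u : (1 <= k)%N -> fe (msh r k) u ->
  add_span (fe MH) u `<=` fe (msh r k).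
Proof.
move=> k1 fu v [w Hw [c ->]]; rewrite addrC; apply: feP => //.
exact: (coarse_sub k1 Hw).
Qed.

Lemma span_solved k u lt w : (1 <= k)%N -> fe (msh r k) u -> na u = 1 ->
  eigen_approx pb K E l Cea Ce0 (add_span (fe MH) u) ->
  ESOLVE pb (add_span (fe MH) u) lt w ->
  esolved a b e0 W eps dl Cea Ce0 k u w.
Proof.
move=> k1 fu u1; apply: esolve_solved u1; [|exact: add_span_sub| |exact: feV fu].
- by move=> v Hv; exists v => //; exists 0; rewrite scale0r addr0.
- by move=> c; exists 0; [exact: fe0|exists c; rewrite add0r].
Qed.

Let init : algorithmC_init pb m MH r. Proof. by case: alg. Qed.
Let step k : (2 <= k)%N -> algorithmC_step pb m bis theta1 theta2 MH r k.
Proof. by case: alg => _ _ _; exact. Qed.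

Lemma lev_ge1 k : (2 <= k)%N -> (1 <= lev r k)%N.
Proof.
case: k => // -[//|k] _; elim: k => [|k IH]; first by case: init => _ _ _ _ [->].
have [_ _ _ _] := step (isT : 2 <= k.+2)%N.
by case: ifP => [_ [_ [_ _ ->]]|_ [_ ->]].
Qed.

(** The eigensolves of level [k] are based on a vector recorded under the
    number of the level, since the level is closed whenever one is made. *)
Lemma level_eigen_approx k j : (2 <= k)%N -> (0 < jlast r k)%N -> (j <= jlast r k)%N ->
  eigen_approx pb K E l Cea Ce0 (add_span (fe MH) (uu r k j)).
Proof.
move=> k2 jp jk; have [_ _ _ _] := step k2; rewrite jp => -[_ [_ nE lE]].
have [[_ h] _ _ _ _] := est.
have := h (lev r k).+1 k.+1 j (leqW k2); rewrite nE lE leqnn andbT ltnS.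
by move/(_ (lev_ge1 k2) jk).
Qed.

Lemma run_ubar k j : (2 <= k)%N -> (j <= jlast r k)%N ->
  [/\ fe (msh r k) (ubar r k j),
    forall v, fe (msh r k) v -> a (ubar r k j) v = b (fbar r k j) v &
    uu r k j = (snorm a (ubar r k j))^-1 *: ubar r k j].
Proof. by move=> k2 jk; have [_ _ h _ _] := step k2; have [[h1 h2] h3 _] := h j jk. Qed.

Lemma run_uu_mem k j : (2 <= k)%N -> (j <= jlast r k)%N -> fe (msh r k) (uu r k j).
Proof. by move=> k2 jk; have [fu _ ->] := run_ubar k2 jk; exact: feZ. Qed.

Lemma run_first_mem : fe (msh r 1) (uu r 1 0).
Proof. by case: init => _ [[h _ _] _] _ _ _. Qed.

Lemma run_fbar_mem k j : (1 <= k)%N -> (j <= jlast r k)%N -> fe (msh r k) (fbar r k j).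
Proof.
have [_ _ [f1 _ j1] f2 _] := init.
case: k => // -[_|k _].
  by rewrite j1 leqn0 => /eqP ->; rewrite f1; exact: run_first_mem.
case: j => [_|j jk]; last first.
  have [_ _ _ [/(_ j jk)[_ [lt [[Wf _ _] _]]] _] _] := step (isT : 2 <= k.+2)%N.
  exact: (add_span_sub (ltn0Sn k.+1) (run_uu_mem (isT : 2 <= k.+2)%N (ltnW jk)) Wf).
case: k => [|k]; first by rewrite f2; exact: run_nested run_first_mem.
have uk := run_uu_mem (isT : 2 <= k.+2)%N (leqnn _).
apply: (run_nested (ltn0Sn k.+1)).
have [_ _ _ _] := step (isT : 2 <= k.+2)%N.
case: ifP => [_ [[lt [[Wf _ _] _]] _]|_ [-> _]]; last exact: uk.
exact: (add_span_sub (ltn0Sn k.+1) uk Wf).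
Qed.

Lemma run_eta k j : (2 <= k)%N -> (j <= jlast r k)%N ->
  eta_run pb r k j = eta pb K Rk (msh r k) (fbar r k j).1.
Proof.
move=> k2 jk; have k1 := ltnW k2; have adM := run_admissible k1.
have [fu hu _] := run_ubar k2 jk; have [trM _] := adM.
apply: (eq_eta_on (fbar r k j).1 trM) => x cx.
exact: (galerkin_pointwise adM (feV (run_fbar_mem k1 jk)) fu hu cx).
Qed.

Lemma run_first_eta : eta_run pb r 1 0 = eta pb K Rk (msh r 1) (fbar r 1 0).1.
Proof.
have [_ [[fu u1 hu] _] [f1 u1E _] _ _] := init.
have adM := run_admissible (leqnn 1); have [trM _] := adM.
have Vu := feV fu.
have ll0 : ll r 1 0 != 0.
  apply/eqP => l0; have := hu _ fu; rewrite l0 mul0r => h.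
  by move/eqP: u1; rewrite /norm_a h sqrtr0 eq_sym oner_eq0.
apply: (eq_eta_on (fbar r 1 0).1 trM) => x cx; rewrite f1.
rewrite u1E; apply: (galerkin_pointwise adM Vu (feZ _ fu) _ cx) => v fv.
rewrite (siZl aP _ Vu (feV fv)) (hu _ fv) mulrA mulVf// mul1r.
by [].
Qed.

Let eta_lowC : 0 <= (1 + Coa) / Clow.
Proof. by rewrite divr_ge0 ?addr_ge0 ?ltW. Qed.

(** The estimator is efficient up to oscillation, and for a discrete datum the
    oscillation is that of the operator applied to the Galerkin solution, which is
    bounded by its energy. *)
Lemma run_eta_low k f : (1 <= k)%N -> fe (msh r k) f ->
  eta pb K Rk (msh r k) f.1 <= (1 + Coa) / Clow * snorm a (K f.1).
Proof.
move=> k1 ff; have [_ _ h3 h4 _] := est; have Vf := feV ff.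
have adM := run_admissible k1; have Vk := solV Vf; have fG := galerkin_mem adM Vf.
have [_ low] := h3 k f.1 k1 (H10_L2 Vf).
have os := h4 k _ k1 fG.
have oE : osc_res pb K Rk P (msh r k) f.1 =
    osc pb P (msh r k) (fun T => elemL pb T (Rk (msh r k) (K f.1))).
  exact: (oscP adM ff fG).
have [e1 e2] := snorm_galerkin aP (@feV _) (@feB _) (fe0 m vp _) Vk fG
  (fun v fv => galerkin_orth adM Vf fv).
rewrite mulrAC ler_pdivlMr// mulrC; apply: (le_trans low); rewrite oE mulrDl mul1r.
apply: lerD; first exact: e1.
by apply: (le_trans os); rewrite (ler_pM2l Coa0); exact: e2.
Qed.

Local Notation t0 := (tol l (lam 1%N)).
Local Notation cw := (Cw ca l Cea Ce0 Can Cup gam alpha theta2).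
Local Notation CL := (Num.sqrt (1 + gam * ((1 + Coa) / Clow) ^+ 2)).
Hypothesis small_dl : dl <= t0.
Hypothesis small_err : eps / ca <= t0 ^+ 2 / l.
Hypothesis small_init : 2 * l * (Ce0 / ca * eps) <= 1 / 2.
Hypothesis small_inner : Cwu ca l Cea Ce0 * eps <= theta2.
Hypothesis small_base :
  2 * l * Cwbar0 ca l Cea Ce0 Can Cup gam alpha / ca ^+ 2 * eps <= Cup * theta2.
Hypothesis small_outer : cw * eps <= Cup.
Hypothesis small_compare : 4 * CL * (cw / Num.sqrt gam) * eps <= alpha - alphah.

Local Notation G := (fun k f => Rk (msh r k) (K f.1)).
Local Notation et := (fun k f => eta pb K Rk (msh r k) f.1).
Local Notation fl k := (fbar_last r k).
Local Notation te := (total_error a (fun u => K u.1) G et gam).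

Lemma run_iteration k : (1 <= k)%N ->
  [/\ V (fl k), 0 < snorm a (K (fl k).1), nd (K (fl k).1) <= cw * eps * et k (fl k) &
    te k.+1 (fl k.+1) / snorm a (K (fl k.+1).1) <=
      alpha * (te k (fl k) / snorm a (K (fl k).1))].
Proof.
have H0 := fe0 m vp MH; have eps0 := eta_a_ge0 pb K H0.
have [[es1 _] h2 h3 _ h5] := est.
have [_ [[fu u1 hu] hmin] [f1 u1E j1] f2 [lev2 n1 et1]] := init.
have fl1 : fl 1 = uu r 1 0 by rewrite /fbar_last j1 f1.
refine (@adaptive_iteration _ _ _ _ _ _ _ _ _ _ em W G et eps dl Cea Ce0 Can Cup
  ((1 + Coa) / Clow) gam alphah alpha theta2
  _ _ _ _ _ _ _ _ eps0 Cea0 Ce00 Can0 Cup0 eta_lowC gam0 alphah0 alpha_gt alpha1 theta20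
  _ _ _ _ (fbar r) (ubar r) (jlast r) (fun k => etal r (lev r k)) (ll r 1 0)
  _ _ _ _ _ _ _ _ _ _ _ _ _ small_dl small_err small_init small_inner small_base
  small_outer small_compare k).
- by move=> i _; exact: feV.
- by move=> i; exact: fe0.
- by move=> i; exact: feP.
- by move=> i; exact: run_nested.
- by move=> i f i1; exact: (galerkin_mem (run_admissible i1)).
- by move=> i f i1 Vf v; exact: (galerkin_orth (run_admissible i1) Vf).
- by move=> i f; exact: eta_ge0.
- by move=> i i1; exact: (eta_quadratic (run_admissible i1)).
- move=> i f i1 Vf; have adM := run_admissible i1.
  have h := galerkin_error_le vp ca0 ca_norm1 eigP KP (@feV (msh r i)) (fe0 m vp _)
    (@feP _) Vf (galerkin_mem adM Vf) (fun v fv => galerkin_orth adM Vf fv).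
  apply: (le_trans h); apply: ler_wpM2r; first exact: snorm_ge0.
  exact: (eta_a_sub vp ca0 ca_norm1 eigP KP H0 (coarse_sub i1)).
- move=> i f i1 Vf; have h := h2 i (K f.1) i1 (solV Vf).
  apply: (le_trans h); apply: ler_wpM2r; first exact: snorm_ge0.
  rewrite (ler_pM2l Can0).
  exact: (eta_a_sub vp ca0 ca_norm1 eigP KP H0 (coarse_sub i1)).
- by move=> i f i1 Vf; have [h _] := h3 i f.1 i1 (H10_L2 Vf).
- by move=> i f i1 ff; exact: run_eta_low.
- by rewrite -/(fbar_last r 1) fl1.
- by rewrite -/(fbar_last r 1) fl1 => v fv; exact: (hu _ fv).
- rewrite -/(fbar_last r 1) fl1.
  apply: (esolve_solved (coarse_sub (leqnn 1)) _ (fun c => feZ c fu) (feV fu) u1 es1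
    (conj (And3 fu u1 hu) hmin)).
  by move=> v.
- by rewrite -/(fbar_last r 1) fl1.
- rewrite lev2 et1 run_first_eta -/(fbar_last r 1) fl1 f1; exact: erefl.
- by move=> i j i2 ji; have [] := run_ubar i2 ji.
- by move=> i j i2 ji; have [] := run_ubar i2 ji.
- move=> i j i2 ji; have [_ _ _ [/(_ j ji)[h _] _] _] := step i2.
  by rewrite -(run_eta i2 (ltnW ji)).
- move=> i j i2 ji uE; have [_ _ _ [/(_ j ji)[_ [lt h]] _] _] := step i2.
  have [_ _ ue] := run_ubar i2 (ltnW ji); rewrite -ue in uE *.
  have jp : (0 < jlast r i)%N by exact: leq_ltn_trans ji.
  exact: (span_solved (ltnW i2) (run_uu_mem i2 (ltnW ji)) uE
    (level_eigen_approx i2 jp (ltnW ji)) h).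
- move=> i i2; have [_ _ _ [_ h] _] := step i2.
  by rewrite ltNge -(run_eta i2 (leqnn _)).
- move=> i i2 jp; have [_ _ _ _] := step i2; rewrite jp => -[[lt h] [eE nE lE]].
  have [_ _ ue] := run_ubar i2 (leqnn (jlast r i)); rewrite -ue; split.
    move=> uE; exact: (span_solved (ltnW i2) (run_uu_mem i2 (leqnn _)) uE
      (level_eigen_approx i2 jp (leqnn _)) h).
  by rewrite lE eE; exact: (run_eta i2 (leqnn _)).
- move=> i i2 j0; have [_ _ _ _ h] := step i2; rewrite j0 in h; have [fE lE] := h.
  have [_ _ ue] := run_ubar i2 (leqnn (jlast r i)); rewrite lE; split; last exact: erefl.
  exact: etrans fE ue.
- by move=> i i1; exact: h5.
Qed.

(** Normalisation of the data is a scaling, and all quantities are homogeneous. *)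
Theorem run_bounds k : (1 <= k)%N ->
  na (wrun pb K r k - E (wrun pb K r k)) <=
    cw * eps * eta pb K Rk (msh r k) (fnorm pb K r k).1 /\
  na (wrun pb K r k.+1 - Rk (msh r k.+1) (wrun pb K r k.+1)) ^+ 2
    + gam * eta pb K Rk (msh r k.+1) (fnorm pb K r k.+1).1 ^+ 2 <=
  alpha ^+ 2 * (na (wrun pb K r k - Rk (msh r k) (wrun pb K r k)) ^+ 2
    + gam * eta pb K Rk (msh r k) (fnorm pb K r k).1 ^+ 2).
Proof.
move=> k1; have [Vf p x ctr] := run_iteration k1.
have [Vf' p' _ _] := run_iteration (ltn0Sn k).
have eq i : (1 <= i)%N -> quadratic V (fun f => et i f ^+ 2).
  by move=> i1; exact: (eta_quadratic (run_admissible i1)).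
have fE i : fnorm pb K r i = (snorm a (K (fl i).1))^-1 *: fl i by [].
have tE i : (1 <= i)%N -> V (fl i) -> 0 < snorm a (K (fl i).1) ->
    te i (fnorm pb K r i) = te i (fl i) / snorm a (K (fl i).1).
  move=> i1 Vi pi; rewrite fE (@teZ _ _ _ _ _ _ _ _ _ _ em W G et gam (fun i _ => @feV _)
    (fun i => @feP _) (fun i f i1 => galerkin_mem (run_admissible i1))
    (fun i f i1 Vf v => galerkin_orth (run_admissible i1) Vf) eq gam0 i _ _ i1 Vi).
  by rewrite ger0_norm ?invr_ge0 ?(ltW pi)// mulrC.
have i0 : 0 <= (snorm a (K (fl k).1))^-1 by rewrite invr_ge0 ltW.
split.
  have Vfn : V (fnorm pb K r k) := memZ aP _ Vf.
  have [-> _] := defl_projection vp ca0 ca_norm1 eigP KP EP (solV Vfn).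
  rewrite fE (nd_kapZr em _ Vf) (etaZ em (eta := et) (fun i f => eta_ge0 _ f) eq _ k1 Vf).
  by rewrite ger0_norm// mulrCA; apply: ler_wpM2l.
have sq i : na (wrun pb K r i - Rk (msh r i) (wrun pb K r i)) ^+ 2 +
    gam * eta pb K Rk (msh r i) (fnorm pb K r i).1 ^+ 2 = te i (fnorm pb K r i) ^+ 2.
  by rewrite (sqr_te a _ G et gam0).
have h : te k.+1 (fnorm pb K r k.+1) <= alpha * te k (fnorm pb K r k).
  by rewrite (tE _ (ltn0Sn k) Vf' p') (tE _ k1 Vf p).
have {}h : te k.+1 (fnorm pb K r k.+1) ^+ 2 <= alpha ^+ 2 * te k (fnorm pb K r k) ^+ 2.
  rewrite -exprMn ler_pXn2r ?nnegrE ?sqrtr_ge0//.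
  by rewrite mulr_ge0 ?sqrtr_ge0// ltW// (lt_trans alphah0).
apply: (eq_ind_r (fun z => z <= _) _ (sq k.+1)).
exact: (eq_ind_r (fun z => _ <= alpha ^+ 2 * z) h (sq k)).
Qed.
End fixed_run.
End adaptive_run.

(** * Contraction of the adaptive algorithm *)

Theorem theorem3p1 (R : realType) (n : nat) (pb : problem R n)
  (m q : nat) (gstar : R)
  (bis : element R n -> element R n * element R n)
  (ca Ca : R) (lam : nat -> R) (uh : nat -> sob R n)
  (K : ('rV[R]_n.+1 -> R) -> sob R n)
  (E : sob R n -> sob R n)
  (Rk : mesh R n -> sob R n -> sob R n)
  (P : element R n -> ('rV[R]_n.+1 -> R) -> 'rV[R]_n.+1 -> R)
  (theta1 theta2 thetas : R)
  (Cea Ce0 Can Cup Clow Coa gam alphah alpha : R) :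
  valid_problem pb ->
  (1 <= m)%N ->
  bisection_rule bis ->
  0 < ca -> 0 < Ca ->
  (forall w, H10 (dom pb) w ->
     ca * norm1 (dom pb) w <= norm_a pb w <= Ca * norm1 (dom pb) w) ->
  eigen_system pb lam uh ->
  ~ piecewise_polynomial pb (uh 0%N) ->
  solution_operator pb K ->
  a_projection pb (eigenspace_of pb (lam 0%N)) E ->
  (forall M, admissible (dom pb) gstar M ->
     galerkin pb (fe_space pb m M) (Rk M)) ->
  l2_projection pb q P ->
  osc_property pb P m gstar ->
  vanishing_approximation pb K m gstar (lam 0%N) ->
  0 < theta1 < 1 -> 0 < theta2 < 1 ->
  marking_property pb K Rk P gstar bis thetas -> theta1 < thetas ->
  0 < Cea -> 0 < Ce0 -> 0 < Can -> 0 < Cup -> 0 < Clow -> 0 < Coa ->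
  0 < gam -> 0 < alphah < 1 ->
  alphah < alpha < 1 ->
  exists2 H0 : R, 0 < H0 &
    forall (MH : mesh R n) (r : run R n),
      meshsize MH <= H0 ->
      algorithmC pb m gstar bis theta1 theta2 MH r ->
      run_estimates pb K Rk E P m (lam 0%N) MH r
        Cea Ce0 Can Cup Clow Coa gam alphah ->
      forall k, (1 <= k)%N ->
        norm_a pb (wrun pb K r k - E (wrun pb K r k)) <=
          Cw ca (lam 0%N) Cea Ce0 Can Cup gam alpha theta2 *
          eta_a pb K (fe_space pb m MH) *
          eta pb K Rk (msh r k) (fnorm pb K r k).1
        /\
        norm_a pb (wrun pb K r k.+1 - Rk (msh r k.+1) (wrun pb K r k.+1)) ^+ 2
          + gam * eta pb K Rk (msh r k.+1) (fnorm pb K r k.+1).1 ^+ 2 <=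
        alpha ^+ 2 *
          (norm_a pb (wrun pb K r k - Rk (msh r k) (wrun pb K r k)) ^+ 2
             + gam * eta pb K Rk (msh r k) (fnorm pb K r k).1 ^+ 2).

Proof.
move=> vp m1 bisP ca0 Ca0 caP eigP npw KP EP RP PP oscP van th1 /andP[theta20 _] mk th1s.
move=> Cea0 Ce00 Can0 Cup0 Clow0 Coa0 gam0 /andP[alphah0 _] /andP[alpha_gt alpha1].
have ca_norm1 w : H10 (dom pb) w -> ca * norm1 (dom pb) w <= norm_a pb w.
  by move=> Vw; have /andP[] := caP w Vw.
have em := pde_model vp ca0 ca_norm1 eigP KP.
have [_ _ t00 _] := tol_bounds em; have l0 := em_l0 em.
set t0 := tol _ _ in t00.
pose cw := Cw ca (lam 0%N) Cea Ce0 Can Cup gam alpha theta2.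
pose CL := Num.sqrt (1 + gam * ((1 + Coa) / Clow) ^+ 2).
(* Each pair bounds a multiple of one of the two approximation quantities of the
   coarse space, which tend to zero with its mesh size. *)
have [|e e0 he] := @common_threshold R [:: (Cea, t0); (ca^-1, t0 ^+ 2 / lam 0%N);
    (2 * lam 0%N * (Ce0 / ca), 1 / 2); (Cwu ca (lam 0%N) Cea Ce0, theta2);
    (2 * lam 0%N * Cwbar0 ca (lam 0%N) Cea Ce0 Can Cup gam alpha / ca ^+ 2, Cup * theta2);
    (cw, Cup); (4 * CL * (cw / Num.sqrt gam), alpha - alphah)].
  by rewrite /= t00 !divr_gt0 ?exprn_gt0// theta20 mulr_gt0// Cup0 subr_gt0 alpha_gt.
have [H1 H10 hH1] := van e e0; exists H1 => // MH r hMH alg est.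
have adMH : admissible (dom pb) gstar MH by case: alg.
have [epse de] := hH1 MH adMH hMH.
have eps0 := eta_a_ge0 pb K (fe0 m vp MH).
have /= /andP[dle _] : all (fun p => p.1 * e <= p.2) _ :=
  he e (introT andP (conj (ltW e0) (lexx e))).
have /= := he _ (introT andP (conj eps0 epse)).
move=> /andP[_ /andP[h2 /andP[h3 /andP[h4 /andP[h5 /andP[h6 /andP[h7 _]]]]]]].
apply: (run_bounds vp ca0 ca_norm1 eigP KP EP RP oscP theta20 Cea0 Ce00 Can0 Cup0 Clow0 Coa0
  gam0 alphah0 alpha_gt alpha1 alg est _ _ _ h4 h5 h6 h7).
- by apply: le_trans dle; rewrite ler_pM2l.
- by rewrite mulrC.
- by rewrite mulrA.
Qed.
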